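(* Let $(\mathfrak b,H,\widehat\beta,\alpha,\beta,V)$ be a $C^*$-pseudo-multiplicative unitary, put $C_V:=[\langle\alpha|_1V|\alpha\rangle_2]\subseteq\mathcal L(H)$, and assume that $C_V=C_V^*$. (i) Let $({}_\gamma K_{\widehat\delta},X)$ be a representation of $V$. Then $(\widehat A_X)_K^{\gamma,\widehat\delta}$ is a $C^*$-$(\mathfrak b,\mathfrak b^\dagger)$-algebra. (ii) $(\widehat A_V)_H^{\alpha,\widehat\beta}$ is a $C^*$-$(\mathfrak b,\mathfrak b^\dagger)$-algebra and $(A_V)_H^{\beta,\alpha}$ is a $C^*$-$(\mathfrak b^\dagger,\mathfrak b)$-algebra.
   Context: General notions. $[Y]$ denotes the closed linear span of $Y$; products of sets of operators are elementwise. A $C^*$-base is a triple $\mathfrak b=(\mathfrak K,\mathfrak B,\mathfrak B^\dagger)$ of a Hilbert space and two commuting nondegenerate $C^*$-algebras $\mathfrak B,\mathfrak B^\dagger\subseteq\mathcal L(\mathfrak K)$; $\mathfrak b^\dagger=(\mathfrak K,\mathfrak B^\dagger,\mathfrak B)$. A $C^*$-$\mathfrak b$-module $H_\alpha=(H,\alpha)$ is a Hilbert space $H$ with a closed subspace $\alpha\subseteq\mathcal L(\mathfrak K,H)$ such that $[\alpha\mathfrak K]=H$, $[\alpha\mathfrak B]=\alpha$, $[\alpha^*\alpha]=\mathfrak B$; it carries the representation $\rho_\alpha\colon\mathfrak B^\dagger\to\mathcal L(H)$, $\rho_\alpha(b^\dagger)\xi\zeta=\xi b^\dagger\zeta$ ($\xi\in\alpha,\zeta\in\mathfrak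 K$). For $C^*$-$\mathfrak b^\dagger$-modules the roles of $\mathfrak B,\mathfrak B^\dagger$ are swapped. A $C^*$-$(\mathfrak b_1,\dots,\mathfrak b_n)$-module is $(H,\alpha_1,\dots,\alpha_n)$ with each $(H,\alpha_i)$ a $C^*$-$\mathfrak b_i$-module and $[\rho_{\alpha_i}(\mathfrak B_i^\dagger)\alpha_j]=\alpha_j$ for $i\neq j$. ${}_\alpha H_\beta:=(H,\alpha,\beta)$. To say that $A_H^{\alpha_1,\alpha_2}$ is a $C^*$-$(\mathfrak b_1,\mathfrak b_2)$-algebra means that $(H,\alpha_1,\alpha_2)$ is a $C^*$-$(\mathfrak b_1,\mathfrak b_2)$-module and $A\subseteq\mathcal L(H)$ is a $C^*$-algebra with $\rho_{\alpha_i}(\mathfrak B_i^\dagger)A\subseteq A$ for $i=1,2$. Relative tensor product. For a $C^*$-$\mathfrak b$-module $H_\beta$ and a $C^*$-$\mathfrak b^\dagger$-module $K_\gamma$, $H\,{}_\beta\otimes_\gamma K$ (base suppressed; same definition with $\mathfrak b,\mathfrak b^\dagger$ interchanged) is the Hilbert space generated by elements $\xi\otimes\zeta\otimes\eta$ ($\xi\in\beta,\zeta\in\mathfrak K,\eta\in\gamma$) with $\langle\xi\otimes\zeta\otimes\eta|\xi'\otimes\zeta'\otimes\eta'\rangle=\langle\zeta|\xi^*\xi'\eta^*\eta'\zeta'\rangle$. $|\xi\rangle_1\colon K\to H\,{}_\beta\otimes_\gamma K$, $|\eta\rangle_2\colon H\to H\,{}_\beta\otimes_\gamma K$ are given by $|\xi\rangle_1\eta\zeta=\xi\otimes\zeta\otimes\eta=|\eta\rangle_2\xi\zeta$,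 with adjoints $\langle\xi|_1,\langle\eta|_2$; $|\beta\rangle_1=\{|\xi\rangle_1:\xi\in\beta\}$ etc. For further module structures $\alpha$ on $H$, $\delta$ on $K$: $\alpha\triangleleft\gamma=[|\gamma\rangle_2\alpha]$, $\beta\triangleright\delta=[|\beta\rangle_1\delta]$, module structures on $H\,{}_\beta\otimes_\gamma K$. $S\otimes\mathrm{id}$, $\mathrm{id}\otimes T$ are determined by $(S\otimes\mathrm{id})|\eta\rangle_2=|\eta\rangle_2S$, $(\mathrm{id}\otimes T)|\xi\rangle_1=|\xi\rangle_1T$ for $S,T$ intertwining the representations $\rho_\beta$ resp. $\rho_\gamma$. Iterated products are identified by associativity; $\Sigma$ is the flip. $C^*$-pseudo-multiplicative unitary: a tuple $(\mathfrak b,H,\widehat\beta,\alpha,\beta,V)$ with $\mathfrak b$ a $C^*$-base, $(H,\widehat\beta,\alpha,\beta)$ a $C^*$-$(\mathfrak b^\dagger,\mathfrak b,\mathfrak b^\dagger)$-module and $V\colon H\,{}_{\widehat\beta}\otimes_\alpha H\to H\,{}_\alpha\otimes_\beta H$ a unitary with $V(\alpha\triangleleft\alpha)=\alpha\triangleright\alpha$, $V(\widehat\beta\triangleright\beta)=\widehat\beta\triangleleft\beta$, $V(\widehat\beta\triangleright\widehat\beta)=\alpha\triangleright\widehat\beta$, $V(\beta\triangleleft\alpha)=\beta\triangleleft\beta$ and $V_{23}V_{12}=V_{12}V_{13}V_{23}$ as operators $H\,{}_{\widehat\beta}\otimes_\alpha H\,{}_{\widehat\beta}\otimes_\alpha H\to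 H\,{}_\alpha\otimes_\beta H\,{}_\alpha\otimes_\beta H$, where $V_{12}=V\otimes\mathrm{id}$, $V_{23}=\mathrm{id}\otimes V$, and $V_{13}\colon H\,{}_{\widehat\beta}\otimes_{\alpha\triangleright\alpha}(H\,{}_\alpha\otimes_\beta H)\to(H\,{}_{\widehat\beta}\otimes_\alpha H)\,{}_{\alpha\triangleleft\alpha}\otimes_\beta H$ is $\Sigma_{23}(V\otimes\mathrm{id})(\mathrm{id}\otimes\Sigma)$ with $\Sigma_{23}$ exchanging the last two factors (from $(H\,{}_\alpha\otimes_\beta H)\,{}_{\widehat\beta\triangleleft\beta}\otimes_\alpha H$). $\widehat A_V=[\langle\beta|_2V|\alpha\rangle_2]$, $A_V=[\langle\alpha|_1V|\widehat\beta\rangle_1]\subseteq\mathcal L(H)$. Representations. A representation of $V$ is a $C^*$-$(\mathfrak b,\mathfrak b^\dagger)$-module ${}_\gamma K_{\widehat\delta}$ with a unitary $X\colon K\,{}_{\widehat\delta}\otimes_\alpha H\to K\,{}_\gamma\otimes_\beta H$ such that $X(\gamma\triangleleft\alpha)=\gamma\triangleright\alpha$, $X(\widehat\delta\triangleright\beta)=\widehat\delta\triangleleft\beta$, $X(\widehat\delta\triangleright\widehat\beta)=\gamma\triangleright\widehat\beta$ and $V_{23}X_{12}=X_{12}X_{13}V_{23}$ as operators $K\,{}_{\widehat\delta}\otimes_\alpha H\,{}_{\widehat\beta}\otimes_\alpha H\to K\,{}_\gamma\otimes_\beta H\,{}_\alpha\otimes_\beta H$, where $X_{12}=X\otimes\mathrm{id}$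 and $X_{13}\colon K\,{}_{\widehat\delta}\otimes_{\alpha\triangleright\alpha}(H\,{}_\alpha\otimes_\beta H)\to(K\,{}_{\widehat\delta}\otimes_\alpha H)\,{}_{\gamma\triangleleft\alpha}\otimes_\beta H$ acts as $X$ on the first and third factor. $\widehat A_X=[\langle\beta|_2X|\alpha\rangle_2]\subseteq\mathcal L(K)$. *)

(* Defs.v *)
From HB Require Import structures.
From mathcomp Require Import all_boot all_order all_algebra.
From mathcomp Require Import complex.
From mathcomp Require Import all_classical all_reals topology normedtype.

Set Implicit Arguments.
Unset Strict Implicit.
Unset Printing Implicit Defensive.

Import Order.TTheory GRing.Theory Num.Theory.
Import numFieldNormedType.Exports.

Local Open Scope classical_set_scope.
Local Open Scope ring_scope.

HB.mixin Record isHilbert (R : realType) H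
    of CompleteNormedModule R[i] H := {
  hdot : {dot H for (@Num.conj_op R[i])};
  hdot_norm : forall x : H, hdot x x = `|x| ^+ 2 }.

#[short(type="hilbertType")]
HB.structure Definition Hilbert (R : realType) :=
  {H of isHilbert R H & CompleteNormedModule R[i] H}.

(* The forms of [sesquilinear] are linear in their first argument, whereas
   [inner x y], the inner product of x and y, is linear in y. *)
Definition inner (R : realType) (H : hilbertType R) (x y : H) : R[i] :=
  hdot y x.

Record bop (R : realType) (H K : hilbertType R) := BOp {
  bop_fun :> H -> K;
  bop_linear : linear bop_fun;
  bop_continuous : continuous bop_fun }.

Notation "''L' ( H , K )" := (bop H K)
  (at level 8, format "''L' ( H ,  K )") : type_scope.

HB.instance Definition _ (R : realType) (H K : hilbertType R) (T : 'L(H, K)) :=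
  GRing.isLinear.Build R[i] H K *:%R (bop_fun T) (bop_linear T).

Section BasicOperators.
Context {R : realType}.
Implicit Types H K L : hilbertType R.

Lemma bop0_linear H K : linear (fun _ : H => 0 : K).
Proof. by move=> a x y; rewrite scaler0 addr0. Qed.

Lemma bop0_continuous H K : continuous (fun _ : H => 0 : K).
Proof. by move=> x; exact: cvg_cst. Qed.

Definition bop0 H K : 'L(H, K) :=
  BOp (@bop0_linear H K) (@bop0_continuous H K).

Lemma bop1_linear H : linear (fun x : H => x).
Proof. by []. Qed.

Lemma bop1_continuous H : continuous (fun x : H => x).
Proof. by move=> x; exact: cvg_id. Qed.

Definition bop1 H : 'L(H, H) := BOp (@bop1_linear H) (@bop1_continuous H).

Lemma bcomp_linear H K L (S : 'L(K, L)) (T : 'L(H, K)) :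
  linear (fun x => S (T x)).
Proof. by move=> a x y; rewrite !linearP. Qed.

Lemma bcomp_continuous H K L (S : 'L(K, L)) (T : 'L(H, K)) :
  continuous (fun x => S (T x)).
Proof.
by move=> x; apply: continuous_comp; exact: bop_continuous.
Qed.

Definition bcomp H K L (S : 'L(K, L)) (T : 'L(H, K)) : 'L(H, L) :=
  BOp (bcomp_linear S T) (@bcomp_continuous H K L S T).

(* "The" operator with property P: every use below is for a property that
   determines the operator uniquely. *)
Definition the_bop H K (P : set 'L(H, K)) : 'L(H, K) :=
  if pselect (exists T, P T) is left h then projT1 (cid h) else bop0 H K.

Definition adj H K (T : 'L(H, K)) : 'L(K, H) :=
  the_bop [set S | forall x y, inner (T x) y = inner x (S y)].

End BasicOperators.

Notation "S \ob T" := (bcomp S T) (at level 40, left associativity).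

Section OperatorSets.
Context {R : realType}.
Implicit Types H K L : hilbertType R.

Definition unitary H K (U : 'L(H, K)) : Prop :=
  adj U \ob U = bop1 H /\ U \ob adj U = bop1 K.

Definition oprod H K L (Y : set 'L(K, L)) (Z : set 'L(H, K)) : set 'L(H, L) :=
  [set T | exists2 S, Y S & exists2 S', Z S' & T = S \ob S'].

Definition oadj H K (Y : set 'L(H, K)) : set 'L(K, H) := @adj R H K @` Y.

Definition oapp H K (Y : set 'L(H, K)) : set K :=
  [set z | exists2 T, Y T & exists x, z = T x].

Definition vspan H (Z : set H) : set H :=
  [set x | forall e : R[i], 0 < e ->
    exists (n : nat) (c : 'I_n -> R[i]) (z : 'I_n -> H),
      (forall i, Z (z i)) /\ `|x - \sum_i c i *: z i| <= e].

(* The closure is for the operator norm: the estimate is uniform in x. *)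
Definition ospan H K (Y : set 'L(H, K)) : set 'L(H, K) :=
  [set T | forall e : R[i], 0 < e ->
    exists (n : nat) (c : 'I_n -> R[i]) (S : 'I_n -> 'L(H, K)),
      (forall i, Y (S i)) /\
      (forall x, `|T x - \sum_i c i *: S i x| <= e * `|x|)].

Definition nondegenerate H K (Y : set 'L(H, K)) : Prop :=
  vspan (oapp Y) = setT.

Definition cstar_algebra H (A : set 'L(H, H)) : Prop :=
  [/\ ospan A = A, oprod A A `<=` A & oadj A = A].

End OperatorSets.

Record cstar_base (R : realType) := CstarBase {
  bspace : hilbertType R;
  balg : set 'L(bspace, bspace);
  bdag : set 'L(bspace, bspace);
  balg_cstar : cstar_algebra balg;
  bdag_cstar : cstar_algebra bdag;
  balg_nondeg : nondegenerate balg;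
  bdag_nondeg : nondegenerate bdag;
  base_commute : forall S T, balg S -> bdag T -> S \ob T = T \ob S }.

Arguments balg {R} _ _.
Arguments bdag {R} _ _.

Definition dag_base (R : realType) (b : cstar_base R) : cstar_base R :=
  CstarBase (bdag_cstar b) (balg_cstar b) (bdag_nondeg b) (balg_nondeg b)
    (fun S T hS hT => esym (base_commute hT hS)).

Section Modules.
Context {R : realType}.
Implicit Types (b : cstar_base R) (H : hilbertType R).

Definition cstar_module b H (a : set 'L(bspace b, H)) : Prop :=
  [/\ ospan a = a,
      nondegenerate a,
      ospan (oprod a (balg b)) = a &
      ospan (oprod (oadj a) a) = balg b].

Definition rho (KK H : hilbertType R) (a : set 'L(KK, H)) (T : 'L(KK, KK)) :
    'L(H, H) :=
  the_bop [set S | forall xi, a xi -> forall zeta, S (xi zeta) = xi (T zeta)].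

Definition rho_dag b H (a : set 'L(bspace b, H)) : set 'L(H, H) :=
  rho a @` bdag b.

Definition cstar_module2 b1 b2 H
    (a1 : set 'L(bspace b1, H)) (a2 : set 'L(bspace b2, H)) : Prop :=
  [/\ cstar_module a1, cstar_module a2,
      ospan (oprod (rho_dag a1) a2) = a2 &
      ospan (oprod (rho_dag a2) a1) = a1].

Definition cstar_module3 b1 b2 b3 H (a1 : set 'L(bspace b1, H))
    (a2 : set 'L(bspace b2, H)) (a3 : set 'L(bspace b3, H)) : Prop :=
  [/\ cstar_module2 a1 a2, cstar_module2 a1 a3 & cstar_module2 a2 a3].

Definition cstar_algebra2 b1 b2 H (a1 : set 'L(bspace b1, H))
    (a2 : set 'L(bspace b2, H)) (A : set 'L(H, H)) : Prop :=
  [/\ cstar_module2 a1 a2, cstar_algebra A,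
      oprod (rho_dag a1) A `<=` A & oprod (rho_dag a2) A `<=` A].

End Modules.

Arguments cstar_module {R} b {H} a.
Arguments rho_dag {R} b {H} a.
Arguments cstar_module2 {R} b1 b2 {H} a1 a2.
Arguments cstar_module3 {R} b1 b2 b3 {H} a1 a2 a3.
Arguments cstar_algebra2 {R} b1 b2 {H} a1 a2 A.

Unset Implicit Arguments.

Section RelativeTensorProduct.
Context {R : realType} {KK : hilbertType R}.
Implicit Types H K L : hilbertType R.

Definition is_rtensor {H K} (be : set 'L(KK, H)) (ga : set 'L(KK, K))
    (T : hilbertType R) (t : 'L(KK, H) -> KK -> 'L(KK, K) -> T) : Prop :=
  (forall xi xi' zeta zeta' eta eta', be xi -> be xi' -> ga eta -> ga eta' ->
    inner (t xi zeta eta) (t xi' zeta' eta') =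
    inner zeta (adj xi (xi' (adj eta (eta' zeta'))))) /\
  vspan [set t p.1.1 p.1.2 p.2 | p in [set p | be p.1.1 /\ ga p.2]] = setT.

(* [is_rtensor] determines the space up to a unitary matching the generators.
   Such a space exists when be is a C*-b-module and ga a C*-b^dag-module, since
   the kernel <zeta|xi^* xi' eta^* eta' zeta'> is then positive;
   the value for other be and ga is irrelevant. *)
Definition rtensor_data {H K} (be : set 'L(KK, H)) (ga : set 'L(KK, K)) :
    {T : hilbertType R & 'L(KK, H) -> KK -> 'L(KK, K) -> T} :=
  if pselect (exists p : {T : hilbertType R & 'L(KK, H) -> KK -> 'L(KK, K) -> T},
      is_rtensor be ga (projT1 p) (projT2 p)) is left h
  then projT1 (cid h) else existT _ KK (fun _ _ _ => 0).

Definition rtensor {H K} (be : set 'L(KK, H)) (ga : set 'L(KK, K)) :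
  hilbertType R := projT1 (rtensor_data be ga).

Definition rgen {H K} (be : set 'L(KK, H)) (ga : set 'L(KK, K))
    (xi : 'L(KK, H)) (zeta : KK) (eta : 'L(KK, K)) : rtensor be ga :=
  projT2 (rtensor_data be ga) xi zeta eta.

Definition ket1 {H K} (be : set 'L(KK, H)) (ga : set 'L(KK, K))
    (xi : 'L(KK, H)) : 'L(K, rtensor be ga) :=
  the_bop [set T | forall eta, ga eta -> forall zeta,
    T (eta zeta) = rgen be ga xi zeta eta].

Definition ket2 {H K} (be : set 'L(KK, H)) (ga : set 'L(KK, K))
    (eta : 'L(KK, K)) : 'L(H, rtensor be ga) :=
  the_bop [set T | forall xi, be xi -> forall zeta,
    T (xi zeta) = rgen be ga xi zeta eta].

Definition kets1 {H K} (be : set 'L(KK, H)) (ga : set 'L(KK, K)) (Y : set 'L(KK, H)) :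
  set 'L(K, rtensor be ga) := ket1 be ga @` Y.
Definition kets2 {H K} (be : set 'L(KK, H)) (ga : set 'L(KK, K)) (Y : set 'L(KK, K)) :
  set 'L(H, rtensor be ga) := ket2 be ga @` Y.
Definition bras1 {H K} (be : set 'L(KK, H)) (ga : set 'L(KK, K)) (Y : set 'L(KK, H)) :
  set 'L(rtensor be ga, K) := oadj (kets1 be ga Y).
Definition bras2 {H K} (be : set 'L(KK, H)) (ga : set 'L(KK, K)) (Y : set 'L(KK, K)) :
  set 'L(rtensor be ga, H) := oadj (kets2 be ga Y).

(* [ltri be ga al] is the module structure written al <| ga, and
   [rtri be ga de] the one written be |> de, on [rtensor be ga]. *)
Definition ltri {H K} (be : set 'L(KK, H)) (ga : set 'L(KK, K))
    (al : set 'L(KK, H)) : set 'L(KK, rtensor be ga) :=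
  ospan (oprod (kets2 be ga ga) al).

Definition rtri {H K} (be : set 'L(KK, H)) (ga : set 'L(KK, K))
    (de : set 'L(KK, K)) : set 'L(KK, rtensor be ga) :=
  ospan (oprod (kets1 be ga be) de).

Definition tensl {H H' K} (be : set 'L(KK, H)) (ga : set 'L(KK, K))
    (be' : set 'L(KK, H')) (S : 'L(H, H')) : 'L(rtensor be ga, rtensor be' ga) :=
  the_bop [set T | forall eta, ga eta ->
    T \ob ket2 be ga eta = ket2 be' ga eta \ob S].

Definition tensr {H K K'} (be : set 'L(KK, H)) (ga : set 'L(KK, K))
    (ga' : set 'L(KK, K')) (S : 'L(K, K')) : 'L(rtensor be ga, rtensor be ga') :=
  the_bop [set T | forall xi, be xi ->
    T \ob ket1 be ga xi = ket1 be ga' xi \ob S].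

Definition flip {H K} (be : set 'L(KK, H)) (ga : set 'L(KK, K)) :
    'L(rtensor be ga, rtensor ga be) :=
  the_bop [set T | forall xi eta, be xi -> ga eta -> forall zeta,
    T (rgen be ga xi zeta eta) = rgen ga be eta zeta xi].

(* The unitary identifying (H be(x)ga K) (x)ep L, where the first factor carries
   be |> de, with H be(x) (K de(x)ep L), where the second one carries ga <| ep.
   It sends |eta>_2 |xi>_1 k to |xi>_1 |eta>_2 k. *)
Definition assoc {H K L} (be : set 'L(KK, H)) (ga de : set 'L(KK, K))
    (ep : set 'L(KK, L)) :
    'L(rtensor (rtri be ga de) ep, rtensor be (ltri de ep ga)) :=
  the_bop [set T | forall xi eta, be xi -> ep eta ->
    T \ob (ket2 (rtri be ga de) ep eta \ob ket1 be ga xi) =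
    ket1 be (ltri de ep ga) xi \ob ket2 de ep eta].

(* The exchange of the last two factors, from (H be(x)ga K) (x)ep L with the
   structure de <| ga on the first factor, to (H de(x)ep L) (x)ga K with the
   structure be <| ep. *)
Definition flip23 {H K L} (be de : set 'L(KK, H)) (ga : set 'L(KK, K))
    (ep : set 'L(KK, L)) :
    'L(rtensor (ltri be ga de) ep, rtensor (ltri de ep be) ga) :=
  the_bop [set T | forall eta eta', ga eta -> ep eta' ->
    T \ob (ket2 (ltri be ga de) ep eta' \ob ket2 be ga eta) =
    ket2 (ltri de ep be) ga eta \ob ket2 de ep eta'].

End RelativeTensorProduct.

Set Implicit Arguments.

Section PseudoMultiplicativeUnitary.
Context {R : realType}.

Definition oimage (H K L : hilbertType R) (S : 'L(K, L)) (Y : set 'L(H, K)) :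
  set 'L(H, L) := [set S \ob T | T in Y].

Section Pentagon.
Context {KK H K : hilbertType R}.
Variables (bh al be : set 'L(KK, H)) (ga dh : set 'L(KK, K)).
Variables (V : 'L(rtensor bh al, rtensor al be)).
Variables (X : 'L(rtensor dh al, rtensor ga be)).

(* X_13, from K dh(x) (H al(x)be H) to (K dh(x)al H) (x)be H *)
Definition leg13 :
    'L(rtensor dh (rtri al be al), rtensor (ltri dh al ga) be) :=
  flip23 ga dh be al \ob
  tensl (rtri dh al be) al (ltri ga be dh) X \ob
  adj (assoc dh al be al) \ob
  tensr dh (rtri al be al) (ltri be al al) (flip al be).

(* V_23 X_12, with the associativity isomorphisms made explicit *)
Definition pentagon_lhs :
    'L(rtensor (rtri dh al bh) al, rtensor (rtri ga be al) be) :=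
  adj (assoc ga be al be) \ob
  tensr ga (ltri bh al be) (ltri al be be) V \ob
  assoc ga be bh al \ob
  tensl (rtri dh al bh) al (rtri ga be bh) X.

(* X_12 X_13 V_23, with the associativity isomorphisms made explicit *)
Definition pentagon_rhs :
    'L(rtensor (rtri dh al bh) al, rtensor (rtri ga be al) be) :=
  tensl (ltri dh al ga) be (rtri ga be al) X \ob
  leg13 \ob
  tensr dh (ltri bh al al) (rtri al be al) V \ob
  assoc dh al bh al.

End Pentagon.

Record is_pmu (b : cstar_base R) (H : hilbertType R)
    (bh al be : set 'L(bspace b, H))
    (V : 'L(rtensor bh al, rtensor al be)) : Prop := IsPmu {
  pmu_module : cstar_module3 (dag_base b) b (dag_base b) bh al be;
  pmu_unitary : unitary V;
  pmu_al_al : oimage V (ltri bh al al) = rtri al be al;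
  pmu_bh_be : oimage V (rtri bh al be) = ltri al be bh;
  pmu_bh_bh : oimage V (rtri bh al bh) = rtri al be bh;
  pmu_be_al : oimage V (ltri bh al be) = ltri al be be;
  pmu_pentagon : pentagon_lhs V V = pentagon_rhs V V }.

Record is_representation (b : cstar_base R) (H : hilbertType R)
    (bh al be : set 'L(bspace b, H)) (V : 'L(rtensor bh al, rtensor al be))
    (K : hilbertType R) (ga dh : set 'L(bspace b, K))
    (X : 'L(rtensor dh al, rtensor ga be)) : Prop := IsRepresentation {
  rep_module : cstar_module2 b (dag_base b) ga dh;
  rep_unitary : unitary X;
  rep_ga_al : oimage X (ltri dh al ga) = rtri ga be al;
  rep_dh_be : oimage X (rtri dh al be) = ltri ga be dh;
  rep_dh_bh : oimage X (rtri dh al bh) = rtri ga be bh;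
  rep_pentagon : pentagon_lhs V X = pentagon_rhs V X }.

Section Algebras.
Context {KK H K : hilbertType R}.

(* [ahat] is applied to V and to its representations X. *)
Definition ahat (al be : set 'L(KK, H)) (ga dh : set 'L(KK, K))
    (X : 'L(rtensor dh al, rtensor ga be)) : set 'L(K, K) :=
  ospan (oprod (bras2 ga be be) (oimage X (kets2 dh al al))).

Definition apmu (bh al be : set 'L(KK, H))
    (V : 'L(rtensor bh al, rtensor al be)) : set 'L(H, H) :=
  ospan (oprod (bras1 al be al) (oimage V (kets1 bh al bh))).

Definition cpmu (bh al be : set 'L(KK, H))
    (V : 'L(rtensor bh al, rtensor al be)) : set 'L(H, H) :=
  ospan (oprod (bras1 al be al) (oimage V (kets2 bh al al))).

End Algebras.
End PseudoMultiplicativeUnitary.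

(* Main.v *)
(* Cutting the pentagon equation V23 X12 = X12 X13 V23 by |xi>_3 and |a>_2 on the
   right and by <b|_3 on the left shows how the slices <b|_2 X |a>_2 multiply: since
   al |> al = V (al <| al), a product of two of them is a limit of sums of slices. The
   same identity gives
     <b'|_2 X (1 (x) c) X^* |b>_2 = (<T b|_2 X |eta>_2)^*
   for c = <eta|_1 V |xi>_2 and T = <b'|_2 V |xi>_2. The left-hand side is, for all c in
   C_V, turned into its adjoint by exchanging b and b' and replacing c by c^*; as
   C_V = C_V^* and the elements T b span be, the algebra is self-adjoint. The claim
   about A_V is the one about the slices of the opposite unitary S V^* S, S being the
   flip, whose pentagon equation is the adjoint of that of V. *)

Require Import Defs.
From HB Require Import structures.
From mathcomp Require Import all_boot all_order all_algebra.
From mathcomp Require Import complex.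
From mathcomp Require Import all_classical all_reals topology normedtype.
From mathcomp Require Import ring lra.

Set Implicit Arguments.
Unset Strict Implicit.
Unset Printing Implicit Defensive.

Import Order.TTheory GRing.Theory Num.Theory.
Import numFieldNormedType.Exports.

Local Open Scope classical_set_scope.
Local Open Scope ring_scope.
Local Notation "x %:C" := (real_complex _ x) : ring_scope.

Local Notation Re := complex.Re.
Local Notation Im := complex.Im.

(** * Hilbert spaces and bounded operators *)

(** The tensor products, kets and maps S (x) id of the statement are chosen objects: each means
    something only once an object with its defining property has been exhibited. These existence
    claims rest on two inequalities. One is positivity of the kernel <zeta|xi^* xi' eta^* eta'
    zeta'>, where every entry of the Gram matrix of the xi commutes with every entry of that of the
    eta. The other is |sum x'_i S z_i| <= |S| |sum x_i z_i| for an operator S that intertwines the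
    Gram operators of the families x and x'. Both are usually drawn from square roots of positive
    operators. Here they come from an elementary estimate for maps that are symmetric for a
    semidefinite form dominated by another one; its constant disappears in the limit of high powers.
    The algebraic half starts from [sliced_pentagon] instead of the pentagon equation. For the
    opposite of V only this sliced form is derived, by contracting the adjoint pentagon of V in its
    first leg, and one argument then serves V, its representations and its opposite. *)

Section ComplexModulus.
Context {R : realType}.
Implicit Types (z w : R[i]) (t : R).

(** The norm of [R[i]] takes its values in [R[i]]. The estimates are carried out in [R], where [lra]
    and [nra] apply; [nrm] below serves the same purpose for vectors. *)
Definition cabs z : R := Re `|z|.

Lemma cabsE z : `|z| = (cabs z)%:C.
Proof. by rewrite /cabs normc_def. Qed.

Lemma cabs_ge0 z : 0 <= cabs z.
Proof. by rewrite -lecR -cabsE normr_ge0. Qed.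

Lemma cabsM z w : cabs (z * w) = cabs z * cabs w.
Proof. by apply: complexI; rewrite -cabsE normrM !cabsE rmorphM. Qed.

Lemma cabsD z w : cabs (z + w) <= cabs z + cabs w.
Proof. by rewrite -lecR rmorphD /= -!cabsE ler_normD. Qed.

Lemma cabsJ z : cabs z^* = cabs z.
Proof. by rewrite /cabs normcJ. Qed.

Lemma cabsR t : cabs t%:C = `|t|.
Proof. by rewrite /cabs normc_def /= expr0n addr0 sqrtr_sqr. Qed.

Lemma cabs_sqr z : cabs z ^+ 2 = Re z ^+ 2 + Im z ^+ 2.
Proof. by apply: complexI; rewrite add_Re2_Im2 cabsE rmorphXn. Qed.

Lemma cabs_eq0 z : cabs z = 0 -> z = 0.
Proof. by move=> h; apply/eqP; rewrite -normr_eq0 cabsE h. Qed.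

Lemma mulJ_cabs z : z^* * z = (cabs z ^+ 2)%:C.
Proof. by rewrite mulrC -sqr_normc cabsE rmorphXn. Qed.

Lemma Re_le_cabs z : Re z <= cabs z.
Proof.
have := cabs_sqr z; have := cabs_ge0 z; have := sqr_ge0 (Im z).
by move: (Re z) (Im z) (cabs z) => x y c ? ? ?; nra.
Qed.

Lemma Re_real_mul t z : Re (t%:C * z) = t * Re z.
Proof. by case: z => x y; rewrite /= mul0r subr0. Qed.

Lemma cabs0 : cabs 0 = 0.
Proof. by rewrite /cabs normr0. Qed.

Lemma conjR t : (t%:C)^* = t%:C.
Proof. exact: conjc_real. Qed.

Lemma conjM z w : (z * w)^* = z^* * w^*.
Proof. exact: rmorphM. Qed.

Lemma cabsN z : cabs (- z) = cabs z.
Proof. by rewrite /cabs normrN. Qed.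

Lemma Re_abs_le_cabs z : `|Re z| <= cabs z.
Proof.
rewrite -(ler_pXn2r (n := 2)) ?nnegrE ?cabs_ge0 // cabs_sqr real_normK ?num_real //.
by rewrite lerDl sqr_ge0.
Qed.

Lemma Im_abs_le_cabs z : `|Im z| <= cabs z.
Proof.
rewrite -(ler_pXn2r (n := 2)) ?nnegrE ?cabs_ge0 // cabs_sqr real_normK ?num_real //.
by rewrite lerDr sqr_ge0.
Qed.

Lemma cabs_le_ReIm z : cabs z <= `|Re z| + `|Im z|.
Proof.
rewrite -(ler_pXn2r (n := 2)) ?nnegrE ?cabs_ge0 ?addr_ge0 // cabs_sqr sqrrD.
by rewrite !real_normK ?num_real // addrAC lerDl mulrn_wge0 // mulr_ge0.
Qed.

Lemma conj_scale t w : (t%:C * w^*)^* = t%:C * w.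
Proof. by case: w => x y; simpc. Qed.

End ComplexModulus.

(** * Semidefinite sesquilinear forms *)

Section SemidefiniteForms.
Context {R : realType} {V : lmodType R[i]}.

Record psd_form (q : V -> V -> R[i]) : Prop := PsdForm {
  psdZD : forall x a y z, q x (a *: y + z) = a * q x y + q x z;
  psdC : forall x y, q x y = (q y x)^*;
  psd_ge0 : forall x, 0 <= Re (q x x) }.

Variables (q : V -> V -> R[i]) (hq : psd_form q).

Lemma psdD x y z : q x (y + z) = q x y + q x z.
Proof. by rewrite -[y]scale1r (psdZD hq) mul1r scale1r. Qed.

Lemma psd0 x : q x 0 = 0.
Proof. by apply: (addrI (q x 0)); rewrite -psdD !addr0. Qed.

Lemma psdZ x a y : q x (a *: y) = a * q x y.
Proof. by rewrite -[a *: y]addr0 (psdZD hq) psd0 addr0. Qed.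

Lemma psdDl x y z : q (x + y) z = q x z + q y z.
Proof. by rewrite !(psdC hq _ z) psdD rmorphD. Qed.

Lemma psdZl a x z : q (a *: x) z = a^* * q x z.
Proof. by rewrite (psdC hq) psdZ rmorphM /= -(psdC hq). Qed.

Lemma psd_real x : q x x = (Re (q x x))%:C.
Proof.
have /(congr1 (@Im _)) := psdC hq x x; case: (q x x) => a b /= h.
by congr Complex; lra.
Qed.

(** The form may be degenerate, so the value at x - t <x, y>^* y is kept as a polynomial in the real
    parameter t, and t is chosen according to whether the form vanishes at y. *)
Lemma psd_cauchy_schwarz x y :
  cabs (q x y) ^+ 2 <= Re (q x x) * Re (q y y).
Proof.
set a := Re (q x x); set d := Re (q y y); set n := cabs (q x y) ^+ 2.
have key (t : R) : 0 <= a - 2 * t * n + t ^+ 2 * n * d.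
  have := psd_ge0 hq (x + (- t)%:C * (q x y)^* *: y).
  rewrite psdD !psdDl !psdZ !psdZl.
  rewrite !conj_scale (psd_real x) (psd_real y).
  rewrite (psdC hq y x) -/a -/d.
  have -> : (- t)%:C * (q x y)^* * q x y = (- t * n)%:C.
    by rewrite -mulrA mulJ_cabs -rmorphM.
  have -> : (- t)%:C * q x y * (q x y)^* = (- t * n)%:C.
    by rewrite -mulrA [q x y * _]mulrC mulJ_cabs -rmorphM.
  have -> : (- t)%:C * (q x y)^* * ((- t)%:C * q x y * d%:C) =
            (t ^+ 2 * n * d)%:C.
    rewrite (_ : _ * _ = (-t)%:C * (-t)%:C * ((q x y)^* * q x y) * d%:C).
      by rewrite mulJ_cabs -!rmorphM /= mulrNN -expr2.
    by ring.
  by move=> /=; lra.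
have a0 : 0 <= a := psd_ge0 hq x.
have : 0 <= d := psd_ge0 hq y.
have n0 : 0 <= n by exact: sqr_ge0.
rewrite le_eqVlt => /orP[/eqP d0|d0].
  rewrite -d0 mulr0 leNgt; apply/negP => npos.
  (* For d = 0 the polynomial is a - 2 t n, and its value here is -1. *)
  have := key ((a + 1) / (2 * n)).
  have -> : 2 * ((a + 1) / (2 * n)) * n = a + 1 by field; lra.
  by rewrite -d0; lra.
have := key d^-1.
have -> : d^-1 ^+ 2 * n * d = d^-1 * n by field; lra.
rewrite -(ler_pM2r d0) mul0r.
have -> : (a - 2 * d^-1 * n + d^-1 * n) * d = a * d - n by field; lra.
by lra.
Qed.

End SemidefiniteForms.

(** * Inner products, norms and sequential completeness *)

Section Hilbert.
Context {R : realType} {H : hilbertType R}.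
Implicit Types (x y z : H) (a : R[i]).

Definition nrm x : R := Re `|x|.

Lemma nrmE x : `|x| = (nrm x)%:C.
Proof. by rewrite /nrm RRe_real // normr_real. Qed.

Lemma inner_psd : psd_form (@inner R H).
Proof.
split=> [x a y z|x y|x]; first by rewrite /inner linearDl linearZl_LR.
  by rewrite /inner hermC /= expr0 mul1r.
by rewrite /inner hdot_norm nrmE -rmorphXn /= sqr_ge0.
Qed.

Lemma inner_nrm x : inner x x = (nrm x ^+ 2)%:C.
Proof. by rewrite /inner hdot_norm nrmE rmorphXn. Qed.

Lemma innerC x y : inner x y = (inner y x)^*.
Proof. exact: psdC inner_psd x y. Qed.

Lemma innerDr x y z : inner x (y + z) = inner x y + inner x z.
Proof. exact: psdD inner_psd x y z. Qed.

Lemma innerDl x y z : inner (x + y) z = inner x z + inner y z.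
Proof. exact: psdDl inner_psd x y z. Qed.

Lemma innerZr x a y : inner x (a *: y) = a * inner x y.
Proof. exact: psdZ inner_psd x a y. Qed.

Lemma innerZl a x y : inner (a *: x) y = a^* * inner x y.
Proof. exact: psdZl inner_psd a x y. Qed.

Lemma inner0r x : inner x 0 = 0.
Proof. exact: psd0 inner_psd x. Qed.

Lemma innerNr x y : inner x (- y) = - inner x y.
Proof. by rewrite -scaleN1r innerZr mulN1r. Qed.

Lemma innerBr x y z : inner x (y - z) = inner x y - inner x z.
Proof. by rewrite innerDr innerNr. Qed.

Lemma inner0l x : inner 0 x = 0.
Proof. by rewrite innerC inner0r rmorph0. Qed.

Lemma innerNl x y : inner (- x) y = - inner x y.
Proof. by rewrite innerC innerNr rmorphN /= -innerC. Qed.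

Lemma innerBl x y z : inner (x - y) z = inner x z - inner y z.
Proof. by rewrite innerDl innerNl. Qed.

Lemma inner_sumr x n (f : 'I_n -> H) :
  inner x (\sum_i f i) = \sum_i inner x (f i).
Proof.
by apply: (big_morph (inner x)); [exact: innerDr | exact: inner0r].
Qed.

Lemma inner_suml x n (f : 'I_n -> H) :
  inner (\sum_i f i) x = \sum_i inner (f i) x.
Proof.
by apply: (big_morph (fun y => inner y x)); [move=> *; exact: innerDl | exact: inner0l].
Qed.

Lemma cauchy_schwarz x y : cabs (inner x y) <= nrm x * nrm y.
Proof.
have := psd_cauchy_schwarz inner_psd x y; rewrite !inner_nrm /= => h.
have n0 z : 0 <= nrm z by rewrite -lecR -nrmE normr_ge0.
by rewrite -(ler_pXn2r (n := 2)) ?nnegrE ?cabs_ge0 ?mulr_ge0 // exprMn.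
Qed.

Lemma nrm_ge0 x : 0 <= nrm x.
Proof. by rewrite -lecR -nrmE normr_ge0. Qed.

Lemma nrm0 : nrm 0 = 0.
Proof. by rewrite /nrm normr0. Qed.

Lemma nrm_eq0 x : nrm x = 0 -> x = 0.
Proof. by move=> h; apply/eqP; rewrite -normr_eq0 nrmE h. Qed.

Lemma nrmD x y : nrm (x + y) <= nrm x + nrm y.
Proof. by rewrite -lecR rmorphD /= -!nrmE ler_normD. Qed.

Lemma nrmN x : nrm (- x) = nrm x.
Proof. by rewrite /nrm normrN. Qed.

Lemma nrmB_sym x y : nrm (x - y) = nrm (y - x).
Proof. by rewrite -nrmN opprB. Qed.

Lemma nrmZ a x : nrm (a *: x) = cabs a * nrm x.
Proof. by rewrite /nrm normrZ nrmE cabsE -rmorphM. Qed.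

Lemma nrm_sqr x : nrm x ^+ 2 = Re (inner x x).
Proof. by rewrite inner_nrm. Qed.

Lemma nrm_sub_add x y z : nrm (x - z) <= nrm (x - y) + nrm (y - z).
Proof. by apply: le_trans (nrmD _ _); rewrite addrA subrK. Qed.

Lemma nrm_small x : (forall e, 0 < e -> nrm x <= e) -> x = 0.
Proof.
move=> h; apply: nrm_eq0; apply/eqP; rewrite eq_le nrm_ge0 andbT.
by apply/ler_addgt0Pl => e e0; rewrite addr0; exact: h.
Qed.

Lemma inner_ext x y : (forall z, inner z x = inner z y) -> x = y.
Proof.
move=> h; apply/subr0_eq/nrm_eq0/eqP; rewrite -sqrf_eq0 nrm_sqr.
by rewrite innerBr h subrr.
Qed.

Lemma parallelogram x y :
  nrm (x + y) ^+ 2 + nrm (x - y) ^+ 2 = 2 * nrm x ^+ 2 + 2 * nrm y ^+ 2.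
Proof.
rewrite !nrm_sqr !(innerDr, innerDl, innerNr, innerNl).
rewrite (innerC y x).
by case: (inner x x) (inner y y) (inner x y) => [? ?] [? ?] [? ?] /=; lra.
Qed.

Definition cauchy_sequence (u : nat -> H) := forall e : R, 0 < e ->
  exists N, forall m n, (N <= m)%N -> (N <= n)%N -> nrm (u m - u n) <= e.

Definition converges_to (u : nat -> H) (l : H) := forall e : R, 0 < e ->
  exists N, forall n, (N <= n)%N -> nrm (u n - l) <= e.

Lemma nbhs_nrmP x (A : set H) :
  nbhs x A <-> exists2 e : R, 0 < e & forall y, nrm (x - y) < e -> A y.
Proof.
split.
  move/nbhs_ballP => [e /= e0 h]; exists (Re e).
    by rewrite -ltcR RRe_real // gtr0_real.
  move=> y hy; apply: h; rewrite -ball_normE /ball_ /= nrmE.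
  by rewrite -[e]RRe_real ?gtr0_real // ltcR.
move=> [e e0 h]; apply/nbhs_ballP; exists e%:C => /=; first by rewrite ltcR.
by move=> y; rewrite -ball_normE /ball_ /= nrmE ltcR => /h.
Qed.

Lemma cauchy_converges u : cauchy_sequence u -> exists l, converges_to u l.
Proof.
move=> hu.
have /cauchy_cvg cu : cauchy (u @ \oo).
  apply: cauchy_exP => e e0.
  have e1 : 0 < Re e by rewrite -ltcR RRe_real // gtr0_real.
  have [N hN] := hu (Re e / 2) (divr_gt0 e1 (ltr0Sn _ 1)).
  exists (u N); exists N => // n /= Nn.
  rewrite -ball_normE /ball_ /= nrmE -[e]RRe_real ?gtr0_real // ltcR.
  by apply: le_lt_trans (hN _ _ (leqnn N) Nn) _; lra.
exists (lim (u @ \oo)) => e e0.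
have : nbhs (lim (u @ \oo)) [set y | nrm (lim (u @ \oo) - y) <= e].
  by apply/nbhs_nrmP; exists e => // y /ltW.
by move=> /cu [N _ hN]; exists N => n /hN; rewrite /= nrmB_sym.
Qed.

Lemma invSn_small (d : R) : 0 < d ->
  exists N, forall n, (N <= n)%N -> n.+1%:R^-1 <= d.
Proof.
move=> d0; exists (Num.trunc d^-1) => n Nn.
rewrite -[d]invrK lef_pV2 ?posrE ?invr_gt0 //.
apply/ltW/(lt_le_trans (truncnS_gt _)).
by rewrite ler_nat ltnS.
Qed.

(** The criterion suits sequences whose n-th term is chosen with error 1 / (n + 1). *)
Lemma harmonic_converges u :
  (forall e : R, 0 < e -> exists2 d : R, 0 < d & forall m n,
    m.+1%:R^-1 <= d -> n.+1%:R^-1 <= d -> nrm (u m - u n) <= e) ->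
  exists l, converges_to u l.
Proof.
move=> h; apply: cauchy_converges => e /h[d /invSn_small[N hN] hd].
by exists N => m n /hN ? /hN; exact: hd.
Qed.

End Hilbert.

Section RealSups.
Context {R : realType}.

(** The first-order condition at a minimum, in the form in which [riesz] uses it. *)
Lemma nonneg_quadratic_linear (c d : R) :
  (forall t, 0 <= t * c + t ^+ 2 * d) -> c = 0.
Proof.
move=> h; have d1 : 0 < `|d| + 1 by rewrite ltr_pwDr.
have := h (- c / (`|d| + 1)).
set e := `|d| + 1 in d1 *; rewrite (_ : _ + _ = (c / e) ^+ 2 * (d - e)); last first.
  by field; lra.
have : d - e < 0 by rewrite /e; have := ler_norm d; lra.
move=> de; rewrite nmulr_lge0 // => c0; apply/eqP.
have : (c / e) ^+ 2 == 0 by rewrite eq_le c0 sqr_ge0.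
by rewrite sqrf_eq0 mulf_eq0 invr_eq0 (gt_eqF d1) orbF.
Qed.

End RealSups.

(** * The Riesz representation and adjoints *)

Section Operators.
Context {R : realType}.
Implicit Types H K L : hilbertType R.

Lemma bop_ext H K (S T : 'L(H, K)) : (forall x, S x = T x) -> S = T.
Proof.
case: S T => [f lf cf] [g lg cg] /= /funext fg.
by rewrite fg in lf cf *; congr BOp; exact: Prop_irrelevance.
Qed.

Lemma bop_bounded H K (T : 'L(H, K)) :
  exists2 M : R, 0 <= M & forall x, nrm (T x) <= M * nrm x.
Proof.
have /continuous_linear_bounded/linear_boundedP : continuous_at 0 T.
  exact: bop_continuous.
move=> [M [Mr hM]]; exists (`|Re M| + 1); first by rewrite addr_ge0.
move=> x; have /hM : M < (`|Re M| + 1)%:C.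
  by rewrite -[M]RRe_real // ltcR /=; have := ler_norm (Re M); lra.
by move=> /(_ x); rewrite !nrmE -rmorphM lecR.
Qed.

Lemma mk_bop H K (f : H -> K) (M : R) : linear f ->
  (forall x, nrm (f x) <= M * nrm x) -> exists T : 'L(H, K), T =1 f.
Proof.
move=> lf hf.
pose F := GRing.isLinear.Build R[i] H K *:%R f lf.
pose g : {linear H -> K} := HB.pack f F.
have /bounded_linear_continuous cg : bounded_near g (nbhs 0).
  apply/linear_boundedP; exists (`|M|)%:C; split; first by rewrite realE lecR normr_ge0.
  move=> r Mr x; rewrite /g /= !nrmE.
  apply: (@le_trans _ _ (`|M|%:C * (nrm x)%:C)).
    by rewrite -rmorphM lecR (le_trans (hf x)) // ler_wpM2r ?nrm_ge0 ?ler_norm.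
  by rewrite -nrmE ler_wpM2r // ltW.
by exists (BOp lf cg).
Qed.

(* The Riesz vector minimises |x|^2 - 2 Re f(x). *)
Lemma riesz H (f : H -> R[i]) (M : R) :
  (forall a x y, f (a *: x + y) = a * f x + f y) ->
  (forall x, cabs (f x) <= M * nrm x) ->
  exists y, forall x, f x = inner y x.
Proof.
move=> lf hf.
have fD x y : f (x + y) = f x + f y by rewrite -[x]scale1r lf mul1r scale1r.
have f0 : f 0 = 0 by apply: (addrI (f 0)); rewrite -fD !addr0.
have fZ a x : f (a *: x) = a * f x by rewrite -[a *: x]addr0 lf f0 addr0.
pose J x := nrm x ^+ 2 - 2 * Re (f x).
have JM x : - M ^+ 2 <= J x.
  have : Re (f x) <= M * nrm x by apply: le_trans (Re_le_cabs _) (hf x).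
  by rewrite /J; have := sqr_ge0 (nrm x - M); rewrite sqrrB; nra.
pose A := [set - J x | x in setT].
have supA : has_sup A.
  split; first by exists (- J 0), 0.
  by exists (M ^+ 2) => _ [x _ <-]; rewrite lerNl.
pose m := - sup A.
have mJ x : m <= J x.
  by rewrite /m lerNl; apply: sup_upper_bound => //; exists x.
have /choice[u hu] n : exists x, J x <= m + n.+1%:R^-1.
  have n0 : 0 < n.+1%:R^-1 :> R by rewrite invr_gt0.
  have [_ [x _ <-] hx] := sup_adherent n0 supA.
  by exists x; rewrite /m; move: hx; move: (J x) (sup A) (n.+1%:R^-1) => ? ? ?; lra.
(* The parallelogram law, with J at the midpoint of x and y bounded below by m: minimising sequences
   are Cauchy. *)
have close x y d : J x <= m + d -> J y <= m + d -> nrm (x - y) ^+ 2 <= 4 * d.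
  move=> hx hy; have := mJ (2^-1%:C *: (x + y)).
  rewrite /J nrmZ cabsR fZ Re_real_mul fD raddfD /=.
  rewrite ger0_norm ?invr_ge0 // exprMn.
  have := parallelogram x y; move: hx hy; rewrite /J.
  move: (nrm _ ^+ 2) (nrm _ ^+ 2) (nrm _ ^+ 2) (nrm _ ^+ 2) => p q r s; lra.
have [l hl] : exists l, converges_to u l.
  apply: harmonic_converges => e e0; exists (e ^+ 2 / 4); first by rewrite divr_gt0 ?exprn_gt0.
  move=> p q hp hq; rewrite -(ler_pXn2r (n := 2)) ?nnegrE ?nrm_ge0 ?(ltW e0) //.
  have := close (u p) (u q) (e ^+ 2 / 4).
  rewrite (_ : 4 * (e ^+ 2 / 4) = e ^+ 2); last by field.
  apply.
    by apply: le_trans (hu p) _; rewrite lerD2l.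
  by apply: le_trans (hu q) _; rewrite lerD2l.
have M0 : 0 <= `|M| by [].
have Jl : J l <= m.
  apply/ler_addgt0Pr => e e0.
  (* If |u n - l| = d <= 1, then |l|^2 and |u n|^2 differ by at most d (2 |l| + 1), and 2 Re f
     changes by at most 2 |M| d; the last 1 is slack. *)
  pose c := 2 * nrm l + 1 + 2 * `|M| + 1.
  have c0 : 0 < c by rewrite /c; have := nrm_ge0 l; lra.
  have d0 : 0 < Num.min 1 (e / 2 / c) by rewrite lt_min ltr01 !divr_gt0.
  have [N1 h1] := hl _ d0.
  have [N2 h2] := invSn_small (divr_gt0 e0 (ltr0Sn _ 1)).
  pose n := maxn N1 N2; have := h1 n (leq_maxl _ _).
  rewrite [_ <= Num.min _ _]le_min ler_pdivlMr // => /andP[g1 g2].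
  have := h2 n (leq_maxr _ _); have := hu n; rewrite /J.
  have : nrm l <= nrm (u n) + nrm (u n - l).
    by rewrite nrmB_sym; apply: le_trans (nrmD _ _); rewrite addrC subrK.
  have : nrm (u n) <= nrm l + nrm (u n - l).
    by rewrite addrC; apply: le_trans (nrmD _ _); rewrite subrK.
  have := le_trans (Re_le_cabs _) (hf (u n - l)).
  have -> : f (u n - l) = f (u n) - f l by rewrite -scaleN1r fD fZ mulN1r.
  rewrite raddfB /=; move: g2; rewrite /c.
  have := nrm_ge0 (u n - l); have := nrm_ge0 l; have := nrm_ge0 (u n).
  have := ler_norm M; move: g1.
  move: (nrm (u n - l)) (nrm (u n)) (nrm l) (Re _) (Re _) (n.+1%:R^-1) `|M| => d p q r s t M'.
  move=> *; nra.
(* The derivative of J at its minimum l vanishes in the direction y. *)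
have stat y : Re (f y) = Re (inner l y).
  suff : 2 * (Re (inner l y) - Re (f y)) = 0 by lra.
  apply: (@nonneg_quadratic_linear _ _ (nrm y ^+ 2)) => t.
  have := le_trans Jl (mJ (l + t%:C *: y)); rewrite /J !nrm_sqr fD fZ.
  rewrite !(innerDr, innerDl, innerZr, innerZl) (innerC y l).
  case: (inner l y) (f y) (f l) (inner l l) (inner y y) => [a b] [c d] [? ?] [? ?] [? ?] /=.
  lra.
exists l => x.
(* The real part at i x is minus the imaginary part at x. *)
have h1 := stat x; have := stat ('i *: x); rewrite fZ innerZr.
by move: h1; case: (f x) (inner l x) => [a b] [c d] /= -> h; congr Complex; lra.
Qed.

(** The adjoint is a chosen operator and must first be shown to exist. Its values S z are Riesz
    vectors, and |S z|^2 = <z, T (S z)> gives both their norm estimate and the continuity of S. *)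
Lemma adj_inner H K (T : 'L(H, K)) x y : inner (T x) y = inner x (adj T y).
Proof.
rewrite /adj /the_bop; case: pselect => [h|]; first by case: (cid h) => S /=; exact.
case.
have [M M0 hM] := bop_bounded T.
have /choice[S hS] z : exists w, forall x, inner z (T x) = inner w x.
  apply: (@riesz _ _ (M * nrm z)) => [a u v|u]; first by rewrite linearP innerDr innerZr.
  apply: le_trans (cauchy_schwarz _ _) _.
  by rewrite mulrAC [nrm z * _]mulrC ler_wpM2r ?nrm_ge0.
have lS : linear S.
  move=> a u v; apply: inner_ext => w; rewrite innerC -hS innerDl innerZl.
  rewrite innerDr innerZr (innerC w (S u)) (innerC w (S v)) -!hS.
  by rewrite rmorphD rmorphM /= conjCK.
have bS z : nrm (S z) <= M * nrm z.
  have [->|/eqP n0] := eqVneq (nrm (S z)) 0; first by rewrite mulr_ge0 ?nrm_ge0.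
  have p0 : 0 < nrm (S z) by rewrite lt_neqAle nrm_ge0 andbT eq_sym; apply/eqP.
  rewrite -(ler_pM2r p0) -expr2 nrm_sqr -hS.
  apply: le_trans (Re_le_cabs _) _; apply: le_trans (cauchy_schwarz _ _) _.
  by rewrite mulrAC [nrm z * _]mulrC ler_wpM2r ?nrm_ge0.
have [S' SS'] := mk_bop lS bS.
by exists S' => u v; rewrite SS' innerC hS -innerC.
Qed.

Lemma inner_adj H K (T : 'L(H, K)) x y : inner x (T y) = inner (adj T x) y.
Proof. by rewrite innerC adj_inner -innerC. Qed.

Lemma adj_unique H K (T : 'L(H, K)) (S : 'L(K, H)) :
  (forall x y, inner (T x) y = inner x (S y)) -> adj T = S.
Proof.
by move=> h; apply: bop_ext => y; apply: inner_ext => x; rewrite -adj_inner h.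
Qed.

Lemma adjK H K (T : 'L(H, K)) : adj (adj T) = T.
Proof. by apply: adj_unique => x y; rewrite inner_adj. Qed.

Lemma adj_comp H K L (S : 'L(K, L)) (T : 'L(H, K)) :
  adj (S \ob T) = adj T \ob adj S.
Proof. by apply: adj_unique => x y /=; rewrite !adj_inner. Qed.

Lemma adj_bound H K (T : 'L(H, K)) (M : R) : 0 <= M ->
  (forall x, nrm (T x) <= M * nrm x) -> forall y, nrm (adj T y) <= M * nrm y.
Proof.
move=> M0 hM z; have [->|/eqP n0] := eqVneq (nrm (adj T z)) 0.
  by rewrite mulr_ge0 ?nrm_ge0.
have p0 : 0 < nrm (adj T z) by rewrite lt_neqAle nrm_ge0 andbT eq_sym; apply/eqP.
rewrite -(ler_pM2r p0) -expr2 nrm_sqr -adj_inner.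
apply: le_trans (Re_le_cabs _) _; apply: le_trans (cauchy_schwarz _ _) _.
by rewrite mulrAC ler_wpM2r ?nrm_ge0.
Qed.

End Operators.

(** * Closed linear spans *)

Section BopLmodule.
Context {R : realType} {H K : hilbertType R}.
Implicit Types S T U : 'L(H, K).

Lemma bopD S x y : S (x + y) = S x + S y.
Proof. by rewrite -[x]scale1r bop_linear !scale1r. Qed.

Lemma bopB S x y : S (x - y) = S x - S y.
Proof. by rewrite addrC -scaleN1r bop_linear scaleN1r addrC. Qed.

Lemma bop_lin_exists (a : R[i]) S T :
  exists U : 'L(H, K), U =1 (fun x => a *: S x + T x).
Proof.
have [M M0 hM] := bop_bounded S; have [N N0 hN] := bop_bounded T.
apply: (@mk_bop _ _ _ _ (cabs a * M + N)) => [c x y|x].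
  by rewrite !bop_linear !scalerDr !scalerA mulrC addrACA.
apply: le_trans (nrmD _ _) _; rewrite nrmZ mulrDl -mulrA.
by rewrite lerD // ler_wpM2l ?cabs_ge0.
Qed.

(** Sum, opposite and scalar multiple are all instances of this one operation, so that boundedness
    is checked once. *)
Definition bop_lin a S T : 'L(H, K) := projT1 (cid (bop_lin_exists a S T)).

Lemma bop_linE a S T x : bop_lin a S T x = a *: S x + T x.
Proof. by rewrite /bop_lin; case: cid. Qed.

Lemma bop_addA : associative (bop_lin 1).
Proof. by move=> S T U; apply: bop_ext => x; rewrite !bop_linE !scale1r addrA. Qed.

Lemma bop_addC : commutative (bop_lin 1).
Proof. by move=> S T; apply: bop_ext => x; rewrite !bop_linE !scale1r addrC. Qed.

Lemma bop_add0 : left_id (bop0 H K) (bop_lin 1).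
Proof. by move=> S; apply: bop_ext => x; rewrite bop_linE scaler0 add0r. Qed.

Lemma bop_addN : left_inverse (bop0 H K) (fun S => bop_lin (-1) S (bop0 H K)) (bop_lin 1).
Proof.
by move=> S; apply: bop_ext => x; rewrite !bop_linE /= scale1r addr0 scaleN1r addNr.
Qed.

HB.instance Definition _ := gen_eqMixin 'L(H, K).
HB.instance Definition _ := gen_choiceMixin 'L(H, K).
HB.instance Definition _ :=
  GRing.isZmodule.Build 'L(H, K) bop_addA bop_addC bop_add0 bop_addN.

Lemma bop_scaleA a b S :
  bop_lin a (bop_lin b S (bop0 H K)) (bop0 H K) = bop_lin (a * b) S (bop0 H K).
Proof. by apply: bop_ext => x; rewrite !bop_linE !addr0 scalerA. Qed.

Lemma bop_scale1 : left_id 1 (fun a S => bop_lin a S (bop0 H K)).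
Proof. by move=> S; apply: bop_ext => x; rewrite bop_linE addr0 scale1r. Qed.

Lemma bop_scaleDr :
  right_distributive (fun a S => bop_lin a S (bop0 H K)) +%R.
Proof.
move=> a S T; apply: bop_ext => x.
by rewrite /GRing.add /= !bop_linE !scale1r !addr0 scalerDr.
Qed.

Lemma bop_scaleDl S :
  {morph (fun a => bop_lin a S (bop0 H K)) : a b / a + b}.
Proof.
move=> a b; apply: bop_ext => x.
by rewrite {2}/GRing.add /= !bop_linE !scale1r !addr0 scalerDl.
Qed.

HB.instance Definition _ := GRing.Zmodule_isLmodule.Build R[i] 'L(H, K)
  bop_scaleA bop_scale1 bop_scaleDr bop_scaleDl.

Lemma bopZE a S x : (a *: S) x = a *: S x.
Proof. by rewrite {1}/GRing.scale /= bop_linE addr0. Qed.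

Lemma bopDE S T x : (S + T) x = S x + T x.
Proof. by rewrite {1}/GRing.add /= bop_linE scale1r. Qed.

Lemma bopNE S x : (- S) x = - S x.
Proof. by rewrite -scaleN1r bopZE scaleN1r. Qed.

Lemma bop0E x : (0 : 'L(H, K)) x = 0. Proof. by []. Qed.

Lemma bop_sumE n (S : 'I_n -> 'L(H, K)) x : (\sum_i S i) x = \sum_i S i x.
Proof. by apply: (big_morph (fun T : 'L(H, K) => T x)) => // T U; rewrite bopDE. Qed.

End BopLmodule.

(** * Closed subspaces with respect to an abstract norm *)

Section ClosedSpans.
Context {R : realType}.

(* [small e v] is the relation |v| <= e for a norm that need not be given as a
   function: the norm of H, or the operator norm. *)
Record smallness (V : lmodType R[i]) (small : R -> V -> Prop) : Prop := {
  smallD : forall d e x y, small d x -> small e y -> small (d + e) (x + y);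
  smallZ : forall e a x, small e x -> small (cabs a * e) (a *: x);
  small0 : small 0 0;
  small_le : forall d e x, d <= e -> small d x -> small e x }.

Definition lspan (V : lmodType R[i]) (Y : set V) : set V :=
  [set x | exists n (c : 'I_n -> R[i]) (y : 'I_n -> V),
    (forall i, Y (y i)) /\ x = \sum_i c i *: y i].

Definition cspan (V : lmodType R[i]) (small : R -> V -> Prop) (Y : set V) : set V :=
  [set x | forall e : R, 0 < e -> exists2 y, lspan Y y & small e (x - y)].

(** Closed subspaces. Closedness is expressed by approximation because [small] comes without a
    topology. *)
Record csub (V : lmodType R[i]) (small : R -> V -> Prop) (Z : set V) : Prop := {
  csub0 : Z 0;
  csubZD : forall a x y, Z x -> Z y -> Z (a *: x + y);
  csub_lim : forall x, (forall e, 0 < e -> exists2 y, Z y & small e (x - y)) -> Z x }.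

Variables (V W : lmodType R[i]) (small : R -> V -> Prop) (small' : R -> W -> Prop).
Hypotheses (hs : smallness small) (hs' : smallness small').

Lemma lspan0 (Y : set V) : lspan Y 0.
Proof. by exists 0, (fun=> 0), (fun=> 0); split => [[]//|]; rewrite big_ord0. Qed.

Lemma lspanZD (Y : set V) a x y : lspan Y x -> lspan Y y -> lspan Y (a *: x + y).
Proof.
move=> [m [c [u [hu ->]]]] [n [d [w [hw ->]]]].
exists (m + n),
  (fun i : 'I_(m + n) => match fintype.split i with inl j => a * c j | inr j => d j end),
  (fun i : 'I_(m + n) => match fintype.split i with inl j => u j | inr j => w j end); split.
  by move=> i; case: (fintype.split i).
rewrite big_split_ord /= scaler_sumr; congr (_ + _); apply: eq_bigr => i _.
  case: fintype.splitP => j /= ij; last by have := ltn_ord i; rewrite ij ltnNge leq_addr.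
  by rewrite scalerA (ord_inj ij).
case: fintype.splitP => j /= ij; first by have := ltn_ord j; rewrite -ij ltnNge leq_addr.
by move/addnI: ij => /ord_inj ->.
Qed.

Lemma sub_lspan (Y : set V) : Y `<=` lspan Y.
Proof.
move=> x Yx; exists 1, (fun=> 1), (fun=> x); split => //.
by rewrite big_ord1 scale1r.
Qed.

Lemma lspan_min (Y Z : set V) : Z 0 ->
  (forall a x y, Z x -> Z y -> Z (a *: x + y)) -> Y `<=` Z -> lspan Y `<=` Z.
Proof.
move=> Z0 ZZ YZ x [n [c [u [hu ->]]]].
elim: n c u hu => [|n IH] c u hu; first by rewrite big_ord0.
rewrite big_ord_recl; apply: ZZ; first exact/YZ.
by apply: IH => i; exact: hu.
Qed.

Lemma sub_cspan (Y : set V) : Y `<=` cspan small Y.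
Proof.
move=> x Yx e e0; exists x; first exact: sub_lspan.
by rewrite subrr; apply: (small_le hs (ltW e0)); exact: small0.
Qed.

Lemma cspan_csub (Y : set V) : csub small (cspan small Y).
Proof.
split=> [e e0|a x y hx hy e e0|x h e e0].
- exists 0; first exact: lspan0.
  by rewrite subr0; apply: (small_le hs (ltW e0)); exact: small0.
- have a0 := cabs_ge0 a.
  have a1 : 0 < cabs a + 1 by lra.
  have d0 : 0 < e / 2 / (cabs a + 1) by rewrite !divr_gt0.
  have [x' lx sx] := hx _ d0.
  have [y' ly sy] := hy _ (divr_gt0 e0 (ltr0Sn _ 1)).
  exists (a *: x' + y'); first exact: lspanZD.
  rewrite opprD addrACA -scalerBr.
  apply: (small_le hs _ (smallD hs (smallZ hs a sx) sy)).
  rewrite [leRHS](splitr e) lerD2r mulrC.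
  have e2 : 0 <= e / 2 by lra.
  by rewrite mulrAC ler_pdivrMr // ler_wpM2l //; lra.
have [y hy sy] := h _ (divr_gt0 e0 (ltr0Sn _ 1)).
have [z lz sz] := hy _ (divr_gt0 e0 (ltr0Sn _ 1)).
exists z => //; rewrite (splitr e) -(subrK y x) -addrA.
exact: smallD.
Qed.

Lemma cspan_min (Y Z : set V) : csub small Z -> Y `<=` Z -> cspan small Y `<=` Z.
Proof.
move=> hZ YZ x hx; apply: (csub_lim hZ) => e /hx[y ly sy]; exists y => //.
by apply: (lspan_min (csub0 hZ) (csubZD hZ) YZ).
Qed.

Lemma csub_cspan (Z : set V) : csub small Z -> cspan small Z = Z.
Proof.
by move=> hZ; apply/seteqP; split; [exact: cspan_min|exact: sub_cspan].
Qed.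

(** The map f has to be linear and bounded on E alone, since kets and [rho] behave linearly only on
    their modules. The twist s is the identity or, for antilinear f, the conjugation. *)
Lemma csub_preimage (E : set V) (Z : set W) (f : V -> W) (s : R[i] -> R[i]) (M : R) :
  csub small E -> csub small' Z -> s 1 = 1 -> 0 <= M ->
  (forall a x y, E x -> E y -> f (a *: x + y) = s a *: f x + f y) ->
  (forall e x, E x -> small e x -> small' (M * e) (f x)) ->
  csub small [set x | E x /\ Z (f x)].
Proof.
move=> hE hZ s1 M0 lf bf; have E0 := csub0 hE.
have f0 : f 0 = 0.
  apply: (addrI (f 0)); have := lf 1 0 0 E0 E0.
  by rewrite s1 !scale1r !addr0.
split=> [|a x y [Ex Zx] [Ey Zy]|x h].
- by split => //; rewrite f0; exact: (csub0 hZ).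
- split; first exact: (csubZD hE).
  by rewrite lf //; exact: (csubZD hZ).
have Ex : E x by apply: (csub_lim hE) => e /h[y [Ey _] sy]; exists y.
split => //; apply: (csub_lim hZ) => e e0.
have M1 : 0 < M + 1 by lra.
have [y [Ey Zy] sy] := h _ (divr_gt0 e0 M1); exists (f y) => //.
have -> : f x - f y = f (x - y).
  have {1}-> : x = 1 *: (x - y) + y by rewrite scale1r subrK.
  rewrite lf // ?s1 ?scale1r ?addrK //.
  by rewrite -scaleN1r addrC; exact: (csubZD hE).
apply: (small_le hs' _ (bf _ _ _ sy)).
  by rewrite mulrCA ler_piMr ?(ltW e0) // ler_pdivrMr // mul1r; lra.
by rewrite -scaleN1r addrC; exact: (csubZD hE).
Qed.

Lemma csub_setT : csub small setT.
Proof. by []. Qed.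

End ClosedSpans.

(** * Closed spans of vectors and operators, and extension by density *)

Section VectorSpans.
Context {R : realType}.
Implicit Types H K : hilbertType R.

Definition nrm_le H (e : R) (x : H) : Prop := nrm x <= e.

(** On the zero space the estimate alone would admit negative e. *)
Definition op_le H K (e : R) (T : 'L(H, K)) : Prop :=
  0 <= e /\ forall x, nrm (T x) <= e * nrm x.

Lemma nrm_le_smallness H : smallness (@nrm_le H).
Proof.
split=> [d e x y hx hy|e a x hx||d e x de hx]; rewrite /nrm_le.
- by apply: le_trans (nrmD _ _) _; exact: lerD.
- by rewrite nrmZ ler_wpM2l ?cabs_ge0.
- by rewrite nrm0.
- exact: le_trans hx de.
Qed.

Lemma op_le_smallness H K : smallness (@op_le H K).
Proof.
split=> [d e x y [d0 hx] [e0 hy]|e a x [e0 hx]||d e x de [d0 hx]]; rewrite /op_le.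
- split=> [|z]; first exact: addr_ge0.
  by rewrite bopDE mulrDl; apply: le_trans (nrmD _ _) _; exact: lerD.
- split=> [|z]; first by rewrite mulr_ge0 ?cabs_ge0.
  by rewrite bopZE nrmZ -mulrA ler_wpM2l ?cabs_ge0.
- by split => // z; rewrite bop0E nrm0 mul0r.
- split=> [|z]; first exact: le_trans d0 de.
  by apply: le_trans (hx z) _; rewrite ler_wpM2r ?nrm_ge0.
Qed.

Lemma gt0_realC (e : R[i]) : 0 < e -> exists2 d : R, 0 < d & e = d%:C.
Proof.
move=> e0; have eR : (Re e)%:C = e by rewrite RRe_real // gtr0_real.
by exists (Re e); rewrite ?eR // -ltcR eR.
Qed.

Lemma vspanE H (Z : set H) : vspan Z = cspan (@nrm_le H) Z.
Proof.
apply/seteqP; split=> x hx e e0.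
  have [|n [c [z [hz le]]]] := hx e%:C; first by rewrite ltcR.
  exists (\sum_i c i *: z i); first by exists n, c, z.
  by rewrite /nrm_le -lecR -nrmE.
have [d d0 ->] := gt0_realC e0.
have [y [n [c [z [hz ->]]]] le] := hx d d0.
by exists n, c, z; split => //; rewrite nrmE lecR.
Qed.

Lemma ospanE H K (Y : set 'L(H, K)) : ospan Y = cspan (@op_le H K) Y.
Proof.
apply/seteqP; split=> T hT e e0.
  have [|n [c [S [hS le]]]] := hT e%:C; first by rewrite ltcR.
  exists (\sum_i c i *: S i); first by exists n, c, S.
  split=> [|x]; first exact: ltW.
  rewrite -lecR rmorphM /= -!nrmE bopDE bopNE bop_sumE.
  by under eq_bigr do rewrite bopZE.
have [d d0 ->] := gt0_realC e0.
have [y [n [c [S [hS ->]]]] [_ le]] := hT d d0.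
exists n, c, S; split => // x; rewrite !nrmE -rmorphM lecR.
have := le x; rewrite bopDE bopNE bop_sumE.
by under eq_bigr do rewrite bopZE.
Qed.

Notation vsub := (csub (@nrm_le _)).
Notation osub := (csub (@op_le _ _)).

Lemma ospan_osub H K (Y : set 'L(H, K)) : osub (ospan Y).
Proof. by rewrite ospanE; exact: (cspan_csub (op_le_smallness H K) Y). Qed.

Lemma sub_ospan H K (Y : set 'L(H, K)) : Y `<=` ospan Y.
Proof. by rewrite ospanE; exact: (sub_cspan (op_le_smallness H K)). Qed.

Lemma ospan_min H K (Y Z : set 'L(H, K)) : osub Z -> Y `<=` Z -> ospan Y `<=` Z.
Proof. by rewrite ospanE; exact: cspan_min. Qed.

Lemma osub_ospan H K (Z : set 'L(H, K)) : osub Z -> ospan Z = Z.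
Proof. by rewrite ospanE; exact: (csub_cspan (op_le_smallness H K)). Qed.

Lemma ospanK H K (Y : set 'L(H, K)) : ospan (ospan Y) = ospan Y.
Proof. exact/osub_ospan/ospan_osub. Qed.

Lemma vsub_vspan H (Z : set H) : vsub (vspan Z).
Proof. by rewrite vspanE; exact: (cspan_csub (nrm_le_smallness H) Z). Qed.

Lemma vspan_min H (Y Z : set H) : vsub Z -> Y `<=` Z -> vspan Y `<=` Z.
Proof. by rewrite vspanE; exact: cspan_min. Qed.

Lemma sub_vspan H (Y : set H) : Y `<=` vspan Y.
Proof. by rewrite vspanE; exact: (sub_cspan (nrm_le_smallness H)). Qed.

Lemma op_le_exists H K (T : 'L(H, K)) : exists2 M, 0 <= M & op_le M T.
Proof. by have [M M0 hM] := bop_bounded T; exists M. Qed.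

Lemma op_le_comp H K L (S : 'L(K, L)) (T : 'L(H, K)) d e :
  op_le d S -> op_le e T -> op_le (d * e) (S \ob T).
Proof.
move=> [d0 hS] [e0 hT]; split=> [|x]; first exact: mulr_ge0.
by apply: le_trans (hS _) _; rewrite -mulrA ler_wpM2l.
Qed.

Lemma op_le_adj H K (T : 'L(H, K)) e : op_le e T -> op_le e (adj T).
Proof. by move=> [e0 hT]; split => //; exact: adj_bound. Qed.

Lemma adjZD H K a (S T : 'L(H, K)) : adj (a *: S + T) = a^* *: adj S + adj T.
Proof.
apply: adj_unique => x y.
by rewrite !bopDE !bopZE innerDl innerDr innerZl innerZr !adj_inner.
Qed.

Lemma bcompZDr H K L (S : 'L(K, L)) a (T U : 'L(H, K)) :
  S \ob (a *: T + U) = a *: (S \ob T) + S \ob U.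
Proof. by apply: bop_ext => x /=; rewrite !(bopDE, bopZE) /= bop_linear. Qed.

Lemma bcompZDl H K L (S : 'L(H, K)) a (T U : 'L(K, L)) :
  (a *: T + U) \ob S = a *: (T \ob S) + U \ob S.
Proof. by apply: bop_ext => x /=; rewrite !(bopDE, bopZE). Qed.

(** Induction on a closed span: through it, statements about generators pass to limits of their
    linear combinations. *)
Lemma ospan_map_in H K H' K' (E Y : set 'L(H, K)) (Z : set 'L(H', K'))
    (f : 'L(H, K) -> 'L(H', K')) (s : R[i] -> R[i]) (M : R) :
  osub E -> osub Z -> s 1 = 1 -> 0 <= M ->
  (forall a S T, E S -> E T -> f (a *: S + T) = s a *: f S + f T) ->
  (forall e T, E T -> op_le e T -> op_le (M * e) (f T)) ->
  Y `<=` E -> (forall T, Y T -> Z (f T)) -> forall T, ospan Y T -> Z (f T).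
Proof.
move=> hE hZ s1 M0 lf bf YE YZ T hT.
suff : ospan Y `<=` [set T | E T /\ Z (f T)] by move=> /(_ _ hT) [].
apply: ospan_min; last by move=> S YS; split; [exact: YE|exact: YZ].
exact: (csub_preimage (op_le_smallness H' K') hE hZ s1 M0 lf bf).
Qed.

Lemma ospan_compl H K L (S : 'L(K, L)) (Y : set 'L(H, K)) (Z : set 'L(H, L)) :
  osub Z -> (forall T, Y T -> Z (S \ob T)) -> forall T, ospan Y T -> Z (S \ob T).
Proof.
move=> hZ; have [M M0 hM] := op_le_exists S.
apply: (@ospan_map_in _ _ _ _ setT _ _ _ id M) => //.
  by move=> a x y _ _; rewrite bcompZDr.
by move=> e x _; exact: op_le_comp.
Qed.

Lemma ospan_compr H K L (S : 'L(H, K)) (Y : set 'L(K, L)) (Z : set 'L(H, L)) :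
  osub Z -> (forall T, Y T -> Z (T \ob S)) -> forall T, ospan Y T -> Z (T \ob S).
Proof.
move=> hZ; have [M M0 hM] := op_le_exists S.
apply: (@ospan_map_in _ _ _ _ setT _ _ _ id M) => //.
  by move=> a x y _ _; rewrite bcompZDl.
by move=> e x _ he; rewrite mulrC; exact: op_le_comp.
Qed.

Lemma ospan_adj H K (Y : set 'L(H, K)) (Z : set 'L(K, H)) :
  osub Z -> (forall T, Y T -> Z (adj T)) -> forall T, ospan Y T -> Z (adj T).
Proof.
move=> hZ; apply: (@ospan_map_in _ _ _ _ setT _ _ _ Num.conj 1) => //.
- exact: rmorph1.
- by move=> a x y _ _; exact: adjZD.
- by move=> e x _ he; rewrite mul1r; exact: op_le_adj.
Qed.

Lemma oadj_ospan H K (Y : set 'L(H, K)) : oadj (ospan Y) = ospan (oadj Y).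
Proof.
apply/seteqP; split.
  move=> _ [T hT <-]; move: T hT; apply: ospan_adj; first exact: ospan_osub.
  by move=> T YT; apply: sub_ospan; exists T.
move=> T hT; exists (adj T); last exact: adjK.
move: T hT; apply: ospan_adj; first exact: ospan_osub.
by move=> _ [T YT <-]; rewrite adjK; exact: sub_ospan.
Qed.

Lemma vsub_preimage H K (T : 'L(H, K)) (Z : set K) :
  vsub Z -> vsub [set x | Z (T x)].
Proof.
move=> hZ; have [M M0 hM] := bop_bounded T.
have := @csub_preimage _ _ _ _ _ (nrm_le_smallness K) setT Z T id M (csub_setT _) hZ erefl M0.
move=> h; have := h (@nrm_le H); case.
- by move=> a x y _ _; exact: bop_linear.
- by move=> e x _ he; apply: le_trans (hM x) _; rewrite ler_wpM2l.
- move=> h1 h2 h3; split=> [|a x y hx hy|x h'].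
  + by case: h1.
  + by case: (h2 a x y).
  + by case: (h3 x) => // e /h'[y hy sy]; exists y.
Qed.

Lemma vspan_image H K (T : 'L(H, K)) (Y : set H) (Z : set K) :
  vsub Z -> (forall x, Y x -> Z (T x)) -> forall x, vspan Y x -> Z (T x).
Proof. by move=> hZ hY; exact: (vspan_min (vsub_preimage T hZ)). Qed.

Lemma vsub_eq H K (S T : 'L(H, K)) : vsub [set x | S x = T x].
Proof.
split=> [|a x y /= hx hy|x h /=]; first by rewrite /= !linear0.
  by rewrite !bop_linear hx hy.
have [M M0 hM] := bop_bounded S; have [N N0 hN] := bop_bounded T.
apply/subr0_eq/nrm_small => e e0.
have d0 : 0 < M + N + 1 by lra.
have [y /= STy sy] := h _ (divr_gt0 e0 d0).
have -> : S x - T x = S (x - y) - T (x - y)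
  by rewrite !bopB STy opprD opprK addrACA addNr addr0.
apply: le_trans (nrmD _ _) _; rewrite nrmN.
apply: le_trans (lerD (hM _) (hN _)) _; rewrite -mulrDl.
apply: le_trans (ler_wpM2l (addr_ge0 M0 N0) sy) _.
by rewrite mulrCA ler_piMr ?(ltW e0) // ler_pdivrMr // mul1r; lra.
Qed.

Lemma bop_eq_total H K (S T : 'L(H, K)) (Y : set H) : vspan Y = setT ->
  (forall x, Y x -> S x = T x) -> S = T.
Proof.
move=> hY h; apply: bop_ext => x; have : vspan Y x by rewrite hY.
exact: (vspan_min (vsub_eq S T)).
Qed.

Lemma inner_total H (Y : set H) (x y : H) : vspan Y = setT ->
  (forall z, Y z -> inner z x = inner z y) -> x = y.
Proof.
move=> hY h; apply: inner_ext => z; have : vspan Y z by rewrite hY.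
apply: (@vspan_min _ _ [set z | inner z x = inner z y]) => //.
split=> [|a u v /= hu hv|u hu /=]; first by rewrite /= !inner0l.
  by rewrite !innerDl !innerZl hu hv.
apply/subr0_eq; rewrite -innerBr; apply: cabs_eq0; apply/eqP.
rewrite eq_le cabs_ge0 andbT; apply/ler_addgt0Pl => e e0; rewrite addr0.
have d0 : 0 < nrm (x - y) + 1 by rewrite ltr_wpDl ?nrm_ge0.
have [v /= hv sv] := hu _ (divr_gt0 e0 d0).
have -> : inner u (x - y) = inner (u - v) (x - y).
  by rewrite !innerBl !innerBr hv subrr subr0.
apply: le_trans (cauchy_schwarz _ _) _.
apply: le_trans (ler_wpM2r (nrm_ge0 _) sv) _.
by rewrite -mulrA ler_piMr ?(ltW e0) // mulrC ler_pdivrMr // mul1r; lra.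
Qed.

Definition pair_le H K (e : R) (z : H * K) : Prop := nrm_le e z.1 /\ nrm_le e z.2.

Lemma pair_le_smallness H K : smallness (@pair_le H K).
Proof.
have hH := nrm_le_smallness H; have hK := nrm_le_smallness K.
split=> [d e x y [x1 x2] [y1 y2]|e a x [x1 x2]||d e x de [x1 x2]]; split.
- exact: (smallD hH). - exact: (smallD hK).
- exact: (smallZ hH). - exact: (smallZ hK).
- exact: (small0 hH). - exact: (small0 hK).
- exact: (small_le hH de). - exact: (small_le hK de).
Qed.

(* The graph of T is the closure of the span of the pairs (g i, f i). *)
Lemma extension (I : Type) H K (g : I -> H) (f : I -> K) (M : R) : 0 <= M ->
  vspan (range g) = setT ->
  (forall n (c : 'I_n -> R[i]) (i : 'I_n -> I),
    nrm (\sum_k c k *: f (i k)) <= M * nrm (\sum_k c k *: g (i k))) ->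
  exists2 T : 'L(H, K), (forall i, T (g i) = f i) & forall x, nrm (T x) <= M * nrm x.
Proof.
move=> M0 hg hf.
pose P := lspan [set (g i, f i) | i in [set: I]].
have PM x y : P (x, y) -> nrm y <= M * nrm x.
  move=> [n [c [z [hz zE]]]].
  have /choice[i hi] k : exists i, z k = (g i, f i).
    by have [i _ <-] := hz k; exists i.
  have := hf n c i; move: zE.
  have -> : \sum_i c i *: z i = (\sum_k c k *: g (i k), \sum_k c k *: f (i k)).
    rewrite [LHS]surjective_pairing; congr pair.
      rewrite (big_morph fst (id1 := 0) (op1 := +%R)) //.
      by apply: eq_bigr => k _; rewrite hi.
    rewrite (big_morph snd (id1 := 0) (op1 := +%R)) //.
    by apply: eq_bigr => k _; rewrite hi.
  by move=> [-> ->].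
pose G := cspan (@pair_le H K) [set (g i, f i) | i in [set: I]].
have Gdense x e : 0 < e -> exists2 z, P z & nrm (x - z.1) <= e.
  move=> e0; have : vspan (range g) x by rewrite hg.
  rewrite vspanE => /(_ e e0)[y [n [c [z [hz ->]]]] le].
  have /choice[i hi] k : exists i, z k = g i.
    by have [i _ <-] := hz k; exists i.
  exists (\sum_k c k *: (g (i k), f (i k))).
    by exists n, c, (fun k => (g (i k), f (i k))); split => // k; exists (i k).
  rewrite (big_morph fst (id1 := 0) (op1 := +%R)) //=.
  by move: le; rewrite /nrm_le (eq_bigr (fun k => c k *: g (i k))) // => k _; rewrite hi.
(* By [PM], the second components of pairs in [P] whose first components tend to x form a Cauchy
   sequence; its limit is the value at x. *)
have Gex x : exists y, G (x, y).
  have /choice[u hu] n : exists z, P z /\ nrm (x - z.1) <= n.+1%:R^-1.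
    by have [|z] := Gdense x n.+1%:R^-1; [rewrite invr_gt0|exists z].
  have M1 : 0 < 2 * M + 1 by lra.
  have [l hl] : exists l, converges_to (fun n => (u n).2) l.
    apply: harmonic_converges => e e0; exists (e / (2 * M + 1)); first exact: divr_gt0.
    move=> m n hm hn.
    have := PM ((u m).1 - (u n).1) ((u m).2 - (u n).2).
    have -> : ((u m).1 - (u n).1, (u m).2 - (u n).2) = -1 *: u n + u m.
      by rewrite scaleN1r [RHS]addrC; case: (u m) (u n) => [? ?] [? ?].
    move=> /(_ (lspanZD _ (hu n).1 (hu m).1)) /le_trans; apply.
    have : nrm ((u m).1 - (u n).1) <= 2 * (e / (2 * M + 1)).
      apply: le_trans (nrm_sub_add _ x _) _; rewrite nrmB_sym mulr_natl mulr2n.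
      by rewrite lerD // ?(le_trans (hu _).2).
    move=> h; apply: le_trans (ler_wpM2l M0 h) _.
    by rewrite !mulrA ler_pdivrMr // mulrC ler_wpM2l ?(ltW e0) //; lra.
  exists l => e e0; have [N1 h1] := hl e e0; have [N2 h2] := invSn_small e0.
  exists (u (maxn N1 N2)); first by case: (hu (maxn N1 N2)).
  split; last by rewrite /nrm_le /= nrmB_sym; apply: h1; exact: leq_maxl.
  by apply: le_trans (hu _).2 _; apply: h2; exact: leq_maxr.
have GM x y : G (x, y) -> nrm y <= M * nrm x.
  move=> h; apply/ler_addgt0Pr => e e0; move: h.
  rewrite /G /cspan /= /pair_le /nrm_le /= => h.
  have M1 : 0 < M + 1 by lra.
  have [z Pz [z1 z2]] := h _ (divr_gt0 e0 M1).
  have := PM z.1 z.2; rewrite -surjective_pairing => /(_ Pz) hz.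
  have hy : nrm y <= nrm z.2 + e / (M + 1).
    by rewrite -[y](subrK z.2) addrC; apply: le_trans (nrmD _ _) _; rewrite lerD2l.
  have hx : nrm z.1 <= nrm x + e / (M + 1).
    rewrite -[z.1](subrK x) addrC; apply: le_trans (nrmD _ _) _.
    by rewrite lerD2l nrmB_sym.
  apply: le_trans hy _; apply: le_trans (lerD hz (lexx _)) _.
  apply: le_trans (lerD (ler_wpM2l M0 hx) (lexx _)) _.
  by rewrite mulrDr -addrA lerD2l -{2}[_ / _]mul1r -mulrDl mulrCA divff ?mulr1 // gt_eqF.
have /choice[T hT] := Gex.
have hG := cspan_csub (pair_le_smallness H K) [set (g i, f i) | i in [set: I]].
(* By [GM] at first component 0 the closure is still single-valued, which makes the chosen function
   linear. *)
have GT x y : G (x, y) -> y = T x.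
  move=> h; have := csubZD hG (-1) (hT x) h.
  rewrite scaleN1r addrC => /(GM (x - x) (y - T x)).
  rewrite subrr nrm0 mulr0 => h'; apply/subr0_eq/nrm_eq0/eqP.
  by rewrite eq_le nrm_ge0 andbT.
have lT : linear T.
  move=> a x y; apply/esym/GT; exact: (csubZD hG a (hT x) (hT y)).
have [U UT] := mk_bop lT (fun x => GM _ _ (hT x)).
exists U => [i|x]; rewrite UT; last exact: GM.
apply/esym/GT; apply: (sub_cspan (pair_le_smallness H K)).
by exists i.
Qed.

End VectorSpans.

Notation vsub := (csub (@nrm_le _ _)).
Notation osub := (csub (@op_le _ _ _)).

(** * Hilbert spaces from positive kernels *)

Section PowerTrick.
Context {R : realType}.

Lemma bernoulli (d : R) n : 0 <= d -> 1 + n%:R * d <= (1 + d) ^+ n.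
Proof.
move=> d0; elim: n => [|n IH]; first by rewrite mul0r addr0 expr0.
rewrite exprS -natr1; have : 0 <= n%:R :> R by [].
have := ler_wpM2l (addr_ge0 ler01 d0) IH.
move: (n%:R : R) ((1 + d) ^+ n) => x y; nra.
Qed.

(** Log-convexity makes the ratios t (n+1) / t n non-decreasing. If t 1 / t 0 exceeded N, then t
    would outgrow every C N^n. *)
Lemma power_trick (t : nat -> R) (C N : R) : 0 <= N ->
  (forall n, 0 <= t n) -> (forall n, t n.+1 ^+ 2 <= t n * t n.+2) ->
  (forall n, t n <= C * N ^+ n) -> t 1 <= N * t 0.
Proof.
move=> N0 t0 tc tb; rewrite leNgt; apply/negP => h.
have t00 : 0 < t 0.
  rewrite lt_neqAle t0 andbT; apply/eqP => e0.
  have := tc 0; rewrite -e0 mul0r => h1; move: h; rewrite -e0 mulr0.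
  by have := sqr_ge0 (t 1); have := t0 1; nra.
pose r := t 1 / t 0.
have rN : N < r by rewrite ltr_pdivlMr.
have r0 : 0 < r by apply: le_lt_trans N0 rN.
have step n : 0 < t n /\ r * t n <= t n.+1.
  elim: n => [|n [tn rn]]; first by rewrite /r divfK // gt_eqF.
  have tn1 : 0 < t n.+1 by apply: lt_le_trans rn; exact: mulr_gt0.
  split => //; rewrite -(ler_pM2l tn) mulrCA; apply: le_trans (tc n).
  by rewrite mulrA expr2 ler_pM2r.
have tr n : r ^+ n * t 0 <= t n.
  elim: n => [|n IH]; first by rewrite mul1r.
  rewrite exprS -mulrA; apply: le_trans (step n).2.
  by rewrite ler_pM2l.
(* N may be 0; the midpoint is positive and still below r, so that Bernoulli's inequality applies to
   the powers of r / N'. *)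
pose N' := (N + r) / 2.
have NN' : N <= N' by rewrite /N'; lra.
have N'0 : 0 < N' by rewrite /N'; lra.
pose d := r / N' - 1.
have d0 : 0 < d by rewrite /d subr_gt0 ltr_pdivlMr // mul1r /N'; lra.
have bd n : (1 + n%:R * d) * t 0 <= `|C|.
  apply: (@le_trans _ _ ((r / N') ^+ n * t 0)).
    by rewrite ler_pM2r // (_ : r / N' = 1 + d) ?bernoulli ?(ltW d0) // /d; lra.
  rewrite expr_div_n mulrAC ler_pdivrMr ?exprn_gt0 //.
  apply: le_trans (tr n) _; apply: le_trans (tb n) _.
  apply: (@le_trans _ _ (`|C| * N ^+ n)); first by rewrite ler_wpM2r ?exprn_ge0 ?ler_norm.
  by rewrite ler_wpM2l // lerXn2r // nnegrE // ltW.
have := bd (Num.trunc (`|C| / (d * t 0))).+1.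
have := truncnS_gt (`|C| / (d * t 0)); rewrite ltr_pdivrMr ?mulr_gt0 // mulrA.
by move: (_%:R) => x; nra.
Qed.

Section Forms.
Context {V : lmodType R[i]} (q n : V -> V -> R[i]).
Hypotheses (hq : psd_form q) (hn : psd_form n).

(* The constant C disappears on taking n-th roots: q (S^n x) (S^n x) is log-convex in
   n and grows at most like C N^n. *)
Lemma symmetric_bound (S : V -> V) (C N : R) : 0 <= N ->
  (forall x y, q (S x) y = q x (S y)) ->
  (forall x, Re (q x x) <= C * Re (n x x)) ->
  (forall x, Re (n (S x) (S x)) <= N * Re (n x x)) ->
  forall x, Re (q (S x) (S x)) <= N * Re (q x x).
Proof.
move=> N0 hS hqn hnS x.
have C0 y : 0 <= `|C| * Re (n y y) by rewrite mulr_ge0 // psd_ge0.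
pose t m := Re (q (iter m S x) (iter m S x)).
apply: (@power_trick t (`|C| * Re (n x x)) N) => // m; rewrite /t.
- exact: psd_ge0.
- have := psd_cauchy_schwarz hq (iter m S x) (iter m.+2 S x).
  rewrite [iter m.+2 S x]/= -hS -/(iter m.+1 S x) (psd_real hq (iter m.+1 S x)).
  by rewrite cabsR real_normK ?num_real.
apply: (@le_trans _ _ (`|C| * Re (n (iter m S x) (iter m S x)))).
  by apply: le_trans (hqn _) _; rewrite ler_wpM2r ?ler_norm ?psd_ge0.
rewrite -mulrA ler_wpM2l //; elim: m => [|m IH]; first by rewrite expr0 mulr1.
by rewrite exprS mulrCA; apply: le_trans (hnS _) _; rewrite ler_wpM2l.
Qed.

(* If p is dominated by n and P represents p with respect to n, then M - P is a
   contraction up to the factor M, for n and hence for q. *)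
Lemma positive_transfer (p : V -> V -> R[i]) (P : V -> V) (C M : R) : 0 <= M ->
  psd_form p ->
  (forall x y, q (P x) y = q x (P y)) ->
  (forall x y, n x (P y) = p x y) ->
  (forall x, Re (p x x) <= M * Re (n x x)) ->
  (forall x, Re (q x x) <= C * Re (n x x)) ->
  forall x, 0 <= Re (q x (P x)).
Proof.
move=> M0 hp hP np pn qn x.
(* Here n (P y) (P y) = p (P y) y. Cauchy-Schwarz for p bounds its square by p (P y) (P y) p y y, in
   which p (P y) (P y) <= M n (P y) (P y), and one factor n (P y) (P y) cancels. *)
have PP y : Re (n (P y) (P y)) <= M * Re (p y y).
  have := psd_cauchy_schwarz hp (P y) y; rewrite -np (psd_real hn) cabsR.
  rewrite real_normK ?num_real //= ; have := pn (P y).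
  have := psd_ge0 hn (P y); have := psd_ge0 hp y.
  move: (Re _) (Re _) (Re _) => b a c c0 a0 ba h.
  rewrite leNgt; apply/negP => h1.
  have a1 : 0 < a by apply: le_lt_trans h1; rewrite mulr_ge0.
  have : a * a <= M * c * a by have := ler_wpM2r c0 ba; lra.
  by rewrite ler_pM2r // leNgt h1.
pose S y := M%:C *: y + - 1 *: P y.
(* The left-hand side is M^2 n y y - 2 M p y y + n (P y) (P y), and its last term is at most M p y
   y. *)
have bS y : Re (n (S y) (S y)) <= M ^+ 2 * Re (n y y).
  rewrite /S !(psdD hn, psdDl hn, psdZ hn, psdZl hn) np.
  rewrite (psdC hn (P y) y) np (psd_real hp) (psd_real hn y) (psd_real hn (P y)).
  rewrite !conjR rmorphN rmorph1 /=.
  by have := PP y; have := psd_ge0 hp y; nra.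
have Ssym u v : q (S u) v = q u (S v).
  rewrite /S !(psdD hq, psdDl hq, psdZ hq, psdZl hq) hP.
  by rewrite conjR rmorphN rmorph1.
have := symmetric_bound (sqr_ge0 M) Ssym qn bS x.
have := psd_cauchy_schwarz hq x (S x).
have := Re_le_cabs (q x (S x)).
have -> : Re (q x (P x)) = M * Re (q x x) - Re (q x (S x)).
  rewrite /S (psdD hq) !(psdZ hq) raddfD /= Re_real_mul mulN1r raddfN /=.
  by rewrite opprD opprK addNKr.
have := cabs_ge0 (q x (S x)); have := psd_ge0 hq x.
move: (cabs _) (Re _) (Re _) (Re _) => c a b d a0 c0 dc h1 h2.
rewrite subr_ge0; apply: le_trans dc _.
rewrite -(ler_pXn2r (n := 2)) ?nnegrE ?mulr_ge0 //; apply: le_trans h1 _.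
by rewrite exprMn; have := ler_wpM2l a0 h2; lra.
Qed.

End Forms.
End PowerTrick.

(** * Inner products from the parallelogram law *)

Section JordanVonNeumann.
Context {R : realType}.

(** At n t the defect f t - t f 1 is multiplied by n, yet it equals the defect at the fractional
    part of n t, because the defect vanishes at integers. On [0, 1] it is bounded. *)
Lemma additive_bounded_linear (f : R -> R) (A B : R) :
  (forall s t, f (s + t) = f s + f t) ->
  (forall t, `|f t| <= A * t ^+ 2 + B) -> forall t, f t = t * f 1.
Proof.
move=> fD fb; have f0 : f 0 = 0 by apply: (addrI (f 0)); rewrite -fD !addr0.
have fN t : f (- t) = - f t by apply: (addrI (f t)); rewrite -fD !subrr.
have fn n t : f (n%:R * t) = n%:R * f t.
  elim: n => [|n IH]; first by rewrite !mul0r.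
  by rewrite -natr1 !mulrDl !mul1r fD IH.
have fm n : f n%:R = n%:R * f 1 by rewrite -fn mulr1.
have pos t : 0 <= t -> f t = t * f 1.
  move=> t0; apply/eqP; rewrite -subr_eq0 -normr_eq0 eq_le normr_ge0 andbT.
  set z := f t - t * f 1; set C := `|f 1| + `|A| + `|B|.
  have bd n : n%:R * `|z| <= C.
    have n0 : 0 <= n%:R :> R by [].
    pose m := Num.trunc (n%:R * t).
    have /andP[m1 m2] := truncn_itv (mulr_ge0 n0 t0).
    rewrite -natr1 -/m in m2; rewrite -/m in m1.
    have -> : n%:R * `|z| = `|f (n%:R * t - m%:R) - (n%:R * t - m%:R) * f 1|.
      rewrite fD fN fn fm -{1}(ger0_norm n0) -normrM /z.
      by congr (`|_|); ring.
    have := fb (n%:R * t - m%:R); move: m1 m2; set d := n%:R * t - m%:R.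
    move=> m1 m2 h.
    have d0 : 0 <= d by rewrite /d; lra.
    have d1 : d <= 1 by rewrite /d; lra.
    apply: le_trans (ler_normB _ _) _; rewrite normrM (ger0_norm d0).
    have : d * `|f 1| <= `|f 1| by rewrite ler_piMl.
    have : A * d ^+ 2 <= `|A|.
      apply: le_trans (ler_wpM2r (sqr_ge0 d) (ler_norm A)) _.
      by rewrite ler_piMr // expr2 mulr_ile1.
    have := ler_norm B; rewrite /C; lra.
  rewrite leNgt; apply/negP => z0.
  have := bd (Num.trunc (C / `|z|)).+1.
  by rewrite leNgt -ltr_pdivrMr // truncnS_gt.
move=> t; have [/pos //|/ltW t0] := leP 0 t.
by rewrite -[t]opprK fN pos ?mulNr // oppr_ge0.
Qed.

Variables (V : lmodType R[i]) (Q : V -> R).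
Hypothesis Q_ge0 : forall x, 0 <= Q x.
Hypothesis QZ : forall a x, Q (a *: x) = cabs a ^+ 2 * Q x.
Hypothesis Q_parallelogram :
  forall x y, Q (x + y) + Q (x - y) = 2 * Q x + 2 * Q y.

Definition rpolar x y : R := (Q (x + y) - Q (x - y)) / 4.

(** For a form linear in its second argument, the real part at ['i *: y] is minus the imaginary part
    at y. *)
Definition polar x y : R[i] := Complex (rpolar x y) (- rpolar x ('i *: y)).

Let QN x : Q (- x) = Q x.
Proof.
by rewrite -scaleN1r QZ -(rmorphN1 (real_complex R)) cabsR normrN1 expr1n mul1r.
Qed.

Let Qi x : Q ('i *: x) = Q x.
Proof. by rewrite QZ cabs_sqr /= expr0n expr1n add0r mul1r. Qed.

Let rpolarC x y : rpolar x y = rpolar y x.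
Proof. by rewrite /rpolar (addrC y x) -(QN (x - y)) opprB. Qed.

Let rpolar0 y : rpolar 0 y = 0.
Proof. by rewrite /rpolar add0r sub0r QN subrr mul0r. Qed.

Let rpolar_double x x' y : rpolar x y + rpolar x' y = rpolar (x + x') (2 *: y) / 2.
Proof.
have := Q_parallelogram (x + y) (x' + y).
have := Q_parallelogram (x - y) (x' - y).
have -> : 2 *: y = y + y by rewrite scaler_nat mulr2n.
rewrite /rpolar !opprD !opprK.
have -> : x - y + (x' - y) = x + x' - y - y by rewrite addrACA addrA.
have -> : x - y + (- x' + y) = x - x' by rewrite addrACA addNr addr0.
have -> : x + y + (x' + y) = x + x' + (y + y) by rewrite addrACA.
have -> : x + y + (- x' - y) = x - x' by rewrite addrACA subrr addr0.
rewrite !addrA.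
by move: (Q _) (Q _) (Q _) (Q _) (Q _) (Q _) (Q _) => *; lra.
Qed.

Let rpolarD x x' y : rpolar (x + x') y = rpolar x y + rpolar x' y.
Proof.
have h z : rpolar z y = rpolar z (2 *: y) / 2.
  by rewrite -{2}[z]addr0 -rpolar_double rpolar0 addr0.
by rewrite rpolar_double -h.
Qed.

Let rpolarZ t x y : rpolar (t%:C *: x) y = t * rpolar x y.
Proof.
rewrite (@additive_bounded_linear (fun t => rpolar (t%:C *: x) y) (Q x / 2) (Q y / 2)).
- by rewrite scale1r.
- by move=> s r; rewrite rmorphD scalerDl rpolarD.
move=> s; rewrite /rpolar normrM [`|_^-1|]ger0_norm ?invr_ge0 // ler_pdivrMr //.
apply: le_trans (ler_normB _ _) _; rewrite !ger0_norm // Q_parallelogram QZ cabsR.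
rewrite real_normK ?num_real //; lra.
Qed.

Let rpolarii x y : rpolar ('i *: x) ('i *: y) = rpolar x y.
Proof. by rewrite /rpolar -scalerDr -scalerBr !Qi. Qed.

Let scaleii x : 'i *: ('i *: x) = - x :> V.
Proof. by rewrite scalerA -expr2 sqrCi scaleN1r. Qed.

Let rpolarN x y : rpolar (- x) y = - rpolar x y.
Proof. by apply: (addrI (rpolar x y)); rewrite -rpolarD !subrr rpolar0. Qed.

Let rpolar_i x y : rpolar y ('i *: x) = - rpolar x ('i *: y).
Proof. by rewrite -(rpolarC ('i *: x)) -rpolarii scaleii rpolarN. Qed.

Lemma polar_diag x : polar x x = (Q x)%:C.
Proof.
rewrite /polar; have -> : rpolar x ('i *: x) = 0 by have := rpolar_i x x; lra.
rewrite oppr0; congr Complex; rewrite /rpolar subrr.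
have -> : Q 0 = 0 by rewrite -(scale0r x) QZ cabs0 expr0n mul0r.
have -> : x + x = 2 *: x by rewrite scaler_nat mulr2n.
rewrite QZ -(rmorph_nat (real_complex R)) cabsR normr_nat; lra.
Qed.

Lemma polar_psd : psd_form polar.
Proof.
split=> [x a y z|x y|x].
- have rD u v w : rpolar u (v + w) = rpolar u v + rpolar u w.
    by rewrite rpolarC rpolarD !(rpolarC u).
  have rZ t u v : rpolar u (t%:C *: v) = t * rpolar u v.
    by rewrite rpolarC rpolarZ (rpolarC u).
  have rN u v : rpolar u (- v) = - rpolar u v.
    by rewrite rpolarC rpolarN (rpolarC u).
  have pD u v w : polar u (v + w) = polar u v + polar u w.
    by rewrite /polar scalerDr !rD opprD.
  have pR t u v : polar u (t%:C *: v) = t%:C * polar u v.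
    rewrite /polar scalerA mulrC -scalerA !rZ; simpc.
    by [].
  have pi u v : polar u ('i *: v) = 'i * polar u v.
    rewrite /polar scaleii rN opprK -complexiE; simpc.
    by [].
  case: a => p q.
  have -> : Complex p q = p%:C + q%:C * 'i by rewrite -complexiE; simpc.
  by rewrite pD scalerDl pD -scalerA !pR pi mulrDl mulrA.
- apply/eqP; rewrite eq_complex /= rpolarC eqxx /=.
  by rewrite rpolar_i.
- by rewrite polar_diag /=.
Qed.

End JordanVonNeumann.

(** * The Hilbert space of a positive kernel *)

Section KernelSpace.
Context {R : realType}.

Record pkernel (S : Type) := PKernel {
  kf :> S -> S -> R[i];
  kfC : forall s t, kf s t = (kf t s)^*;
  kf_pos : forall u : seq (R[i] * S),
    0 <= Re (\sum_(x <- u) \sum_(y <- u) x.1^* * y.1 * kf x.2 y.2) }.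

Variables (S : Type) (k : pkernel S).
Implicit Types (u v w : seq (R[i] * S)).

(** A list u stands for the formal combination of the vectors e_s with the listed coefficients. Then
    [pair_with f u] is <u, f>, [kcomb u] is u seen as the function s |-> <e_s, u>, and [kq u] is
    |u|^2. *)
Definition pair_with (f : S -> R[i]) u : R[i] := \sum_(x <- u) x.1^* * f x.2.
Definition kcomb u : S -> R[i] := fun s => \sum_(x <- u) x.1 * k s x.2.
Definition kq u : R := Re (pair_with (kcomb u) u).
Definition sscale (a : R[i]) u := [seq (a * x.1, x.2) | x <- u].
Definition legendre (f : S -> R[i]) u : R := 2 * Re (pair_with f u) - kq u.

Lemma kq_ge0 u : 0 <= kq u.
Proof.
rewrite /kq /pair_with; have := kf_pos k u; congr (_ <= Re _).
by apply: eq_bigr => x _; rewrite mulr_sumr; apply: eq_bigr => y _; rewrite mulrA.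
Qed.

Lemma pair_cat f u v : pair_with f (u ++ v) = pair_with f u + pair_with f v.
Proof. exact: big_cat. Qed.

Lemma pair_sscale f a u : pair_with f (sscale a u) = a^* * pair_with f u.
Proof.
rewrite /pair_with big_map mulr_sumr; apply: eq_bigr => x _ /=.
by rewrite rmorphM /= mulrA.
Qed.

Lemma pair_lin a f g u :
  pair_with (fun s => a * f s + g s) u = a * pair_with f u + pair_with g u.
Proof.
rewrite /pair_with mulr_sumr -big_split /=; apply: eq_bigr => x _.
by rewrite mulrDr mulrCA.
Qed.

Lemma kcomb_cat u v : kcomb (u ++ v) = (fun s => 1 * kcomb u s + kcomb v s).
Proof. by apply/funext => s; rewrite mul1r; exact: big_cat. Qed.

Lemma kcomb_sscale a u : kcomb (sscale a u) = (fun s => a * kcomb u s + 0).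
Proof.
apply/funext => s; rewrite addr0 /kcomb big_map mulr_sumr.
by apply: eq_bigr => x _; rewrite mulrA.
Qed.

Lemma pair_cst0 u : pair_with (fun=> 0) u = 0.
Proof. by rewrite /pair_with big1 // => x _; rewrite mulr0. Qed.

Lemma kcombC u v : pair_with (kcomb u) v = (pair_with (kcomb v) u)^*.
Proof.
rewrite /pair_with rmorph_sum /=.
under eq_bigr do rewrite mulr_sumr.
under [RHS]eq_bigr do rewrite mulr_sumr rmorph_sum /=.
rewrite exchange_big /=; apply: eq_bigr => x _; apply: eq_bigr => y _.
by rewrite !rmorphM /= conjCK (kfC k y.2) mulrCA.
Qed.

Lemma kq_sscale a u : kq (sscale a u) = cabs a ^+ 2 * kq u.
Proof.
rewrite /kq kcomb_sscale pair_lin pair_cst0 addr0 pair_sscale mulrCA mulrA.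
by rewrite mulJ_cabs Re_real_mul.
Qed.

Lemma kq_cat u v : kq (u ++ v) = kq u + kq v + 2 * Re (pair_with (kcomb v) u).
Proof.
rewrite /kq kcomb_cat pair_lin mul1r !pair_cat (kcombC u v) !raddfD /=.
by case: (pair_with _ _) (pair_with _ _) (pair_with _ _) => [? ?] [? ?] [? ?] /=; lra.
Qed.

Lemma kq_parallelogram u v :
  kq (u ++ v) + kq (u ++ sscale (-1) v) = 2 * kq u + 2 * kq v.
Proof.
rewrite !kq_cat kq_sscale kcomb_sscale pair_lin pair_cst0 addr0 mulN1r raddfN /=.
have -> : cabs (-1 : R[i]) = 1 by rewrite -[-1](rmorphN1 (real_complex R)) cabsR normrN1.
by rewrite expr1n mul1r; lra.
Qed.

(* The completion of the span of the vectors e_s with Gram matrix k, realised as the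
   functions f s = <e_s, f>: those for which the Legendre transform
   sup_u (2 Re <u, f> - |u|^2), which is then |f|^2, is finite. *)
Record kspace := KSpace {
  kfun :> S -> R[i];
  kfunP : exists C, forall u, legendre kfun u <= C }.

Implicit Types f g : kspace.

Definition knq f : R := sup (range (legendre f)).

Lemma kspace_ext (f g : kspace) : f =1 g -> f = g.
Proof.
case: f g => [f hf] [g hg] /= /funext fg.
by rewrite fg in hf *; congr KSpace; exact: Prop_irrelevance.
Qed.

Lemma legendre_sup (f : kspace) : has_sup (range (legendre f)).
Proof.
split; first by exists (legendre f [::]), [::].
by have [C hC] := kfunP f; exists C => _ [u _ <-].
Qed.

Lemma legendre_le (f : kspace) u : legendre f u <= knq f.
Proof. by apply: sup_upper_bound; [exact: legendre_sup|exists u]. Qed.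

Lemma knq_le (f : kspace) (C : R) : (forall u, legendre f u <= C) -> knq f <= C.
Proof.
by move=> h; apply: ge_sup; [exists (legendre f [::]), [::]|move=> _ [u _ <-]].
Qed.

Lemma legendre_nil f : legendre f [::] = 0.
Proof. by rewrite /legendre /kq /pair_with !big_nil mulr0 subrr. Qed.

Lemma knq_ge0 (f : kspace) : 0 <= knq f.
Proof. by rewrite -(legendre_nil f) legendre_le. Qed.

Lemma legendre_sscale f a u :
  legendre f (sscale a u) = 2 * Re (a^* * pair_with f u) - cabs a ^+ 2 * kq u.
Proof. by rewrite /legendre pair_sscale kq_sscale. Qed.

Lemma knq_cauchy_schwarz (f : kspace) u : cabs (pair_with f u) ^+ 2 <= knq f * kq u.
Proof.
set n := cabs _ ^+ 2; have n0 : 0 <= n := sqr_ge0 _.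
have key t : 2 * t * n - t ^+ 2 * n * kq u <= knq f.
  apply: le_trans (legendre_le f (sscale (t%:C * pair_with f u) u)).
  rewrite legendre_sscale.
  have -> : (t%:C * pair_with f u)^* * pair_with f u = (t * n)%:C.
    by rewrite conjM conjR -mulrA mulJ_cabs -rmorphM.
  by rewrite cabsM cabsR exprMn -/n real_normK ?num_real //= ; lra.
have := kq_ge0 u; rewrite le_eqVlt => /orP[/eqP q0|q0].
  rewrite -q0 mulr0 leNgt; apply/negP => npos.
  have := key ((knq f + 1) / (2 * n)).
  have -> : 2 * ((knq f + 1) / (2 * n)) * n = knq f + 1 by field; lra.
  by rewrite -q0 mulr0; lra.
have := key (kq u)^-1; rewrite -(ler_pM2r q0).
have -> : (2 * (kq u)^-1 * n - (kq u)^-1 ^+ 2 * n * kq u) * kq u = n by field; lra.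
by [].
Qed.

Lemma amgm (x p r : R) : 0 <= p -> 0 <= r -> x ^+ 2 <= 4 * p * r -> x <= p + r.
Proof.
move=> p0 r0 h; rewrite leNgt; apply/negP => h'.
have : (p + r) ^+ 2 < x ^+ 2 by rewrite ltr_pXn2r // ?nnegrE; lra.
by have := sqr_ge0 (p - r); nra.
Qed.

Lemma kspace_lin_bounded a (f g : kspace) :
  exists C, forall u, legendre (fun s => a * f s + g s) u <= C.
Proof.
(* Each of the two pairings absorbs half of [kq u] by [amgm], which doubles the bound it
   contributes. *)
exists (2 * cabs a ^+ 2 * knq f + 2 * knq g) => u.
rewrite /legendre pair_lin raddfD /=.
have h1 := Re_le_cabs (a * pair_with f u); rewrite cabsM in h1.
have h2 := Re_le_cabs (pair_with g u).
have h3 := knq_cauchy_schwarz f u; have h4 := knq_cauchy_schwarz g u.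
have := kq_ge0 u; have := knq_ge0 f; have := knq_ge0 g.
move: h1 h2 h3 h4 (cabs_ge0 a) (cabs_ge0 (pair_with f u)) (cabs_ge0 (pair_with g u)).
move: (cabs a) (cabs (pair_with f u)) (cabs (pair_with g u)) (Re _) (Re _) (knq f) (knq g) (kq u).
move=> A x y r s F G q h1 h2 h3 h4 A0 x0 y0 G0 F0 q0.
have hf : 2 * A * x <= 2 * A ^+ 2 * F + q / 2.
  apply: amgm; [by rewrite !mulr_ge0 ?exprn_ge0|by rewrite divr_ge0|].
  have := ler_wpM2l (sqr_ge0 A) h3; lra.
have hg : 2 * y <= 2 * G + q / 2.
  by apply: amgm; lra.
by lra.
Qed.

Definition klin a (f g : kspace) : kspace := KSpace (kspace_lin_bounded a f g).

Lemma kzero_bounded : exists C, forall u, legendre (fun=> 0) u <= C.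
Proof.
exists 0 => u; rewrite /legendre pair_cst0 /= mulr0 add0r oppr_le0.
exact: kq_ge0.
Qed.

Definition kzero : kspace := KSpace kzero_bounded.

Lemma klin_addA : associative (klin 1).
Proof. by move=> f g h; apply: kspace_ext => s /=; rewrite !mul1r addrA. Qed.

Lemma klin_addC : commutative (klin 1).
Proof. by move=> f g; apply: kspace_ext => s /=; rewrite !mul1r addrC. Qed.

Lemma klin_add0 : left_id kzero (klin 1).
Proof. by move=> f; apply: kspace_ext => s /=; rewrite mul1r add0r. Qed.

Lemma klin_addN : left_inverse kzero (fun f => klin (-1) f kzero) (klin 1).
Proof.
by move=> f; apply: kspace_ext => s /=; rewrite mul1r mulN1r addr0 addNr.
Qed.

HB.instance Definition _ := gen_eqMixin kspace.
HB.instance Definition _ := gen_choiceMixin kspace.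
HB.instance Definition _ :=
  GRing.isZmodule.Build kspace klin_addA klin_addC klin_add0 klin_addN.

Lemma klin_scaleA a b f : klin a (klin b f kzero) kzero = klin (a * b) f kzero.
Proof. by apply: kspace_ext => s /=; rewrite !addr0 mulrA. Qed.

Lemma klin_scale1 : left_id 1 (fun a f => klin a f kzero).
Proof. by move=> f; apply: kspace_ext => s /=; rewrite addr0 mul1r. Qed.

Lemma klin_scaleDr : right_distributive (fun a f => klin a f kzero) +%R.
Proof.
move=> a f g; apply: kspace_ext => s.
by rewrite /GRing.add /= !mul1r !addr0 mulrDr.
Qed.

Lemma klin_scaleDl f : {morph (fun a => klin a f kzero) : a b / a + b}.
Proof. by move=> a b; apply: kspace_ext => s /=; rewrite !addr0 mul1r mulrDl. Qed.

HB.instance Definition _ := GRing.Zmodule_isLmodule.Build R[i] kspace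
  klin_scaleA klin_scale1 klin_scaleDr klin_scaleDl.

Lemma kspaceZ a (f : kspace) s : (a *: f) s = a * f s.
Proof. by rewrite {1}/GRing.scale /= addr0. Qed.

Lemma kspaceD (f g : kspace) s : (f + g) s = f s + g s.
Proof. by rewrite {1}/GRing.add /= mul1r. Qed.

Lemma kspaceB f g s : (f - g) s = f s - g s.
Proof. by rewrite kspaceD; congr (_ + _); rewrite -scaleN1r kspaceZ mulN1r. Qed.

Lemma pairZ a (f : kspace) u : pair_with (a *: f) u = a * pair_with f u.
Proof.
rewrite /pair_with mulr_sumr; apply: eq_bigr => x _.
by rewrite kspaceZ mulrCA.
Qed.

Lemma pairD (f g : kspace) u : pair_with (f + g) u = pair_with f u + pair_with g u.
Proof.
rewrite /pair_with -big_split /=; apply: eq_bigr => x _.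
by rewrite mul1r mulrDr.
Qed.

Lemma pairB (f g : kspace) u : pair_with (f - g) u = pair_with f u - pair_with g u.
Proof. by rewrite pairD -scaleN1r pairZ mulN1r. Qed.

Lemma knqZ a (f : kspace) : knq (a *: f) = cabs a ^+ 2 * knq f.
Proof.
(* This inequality for a and for its inverse gives equality. *)
have half (b : R[i]) (g : kspace) : b != 0 -> knq (b *: g) <= cabs b ^+ 2 * knq g.
  move=> b0; apply: knq_le => u; have b1 : 0 < cabs b.
    by rewrite lt_neqAle cabs_ge0 andbT eq_sym; apply: contra b0 => /eqP/cabs_eq0 ->.
  have := legendre_le g (sscale b^-1 u); rewrite legendre_sscale.
  rewrite -(ler_pM2l (exprn_gt0 2 b1)); apply: le_trans.
  rewrite /legendre pairZ mulrBr mulrCA -(Re_real_mul (cabs b ^+ 2)).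
  have -> : cabs b ^+ 2 * (cabs b^-1 ^+ 2 * kq u) = kq u.
    by rewrite mulrA -exprMn -cabsM divff // (cabsR 1) normr1 expr1n mul1r.
  by rewrite -mulJ_cabs mulrACA -conjM divff // rmorph1 mul1r.
have [->|a0] := eqVneq a 0.
  rewrite scale0r cabs0 expr0n mul0r; apply/eqP; rewrite eq_le knq_ge0 andbT.
  apply: knq_le => u; rewrite /legendre pair_cst0 /= mulr0 add0r oppr_le0.
  exact: kq_ge0.
apply/eqP; rewrite eq_le half //=.
have := half a^-1 (a *: f) (invr_neq0 a0); rewrite scalerA mulVf // scale1r.
have a1 : 0 < cabs a ^+ 2.
  rewrite exprn_gt0 // lt_neqAle cabs_ge0 andbT eq_sym.
  by apply: contra a0 => /eqP/cabs_eq0 ->.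
rewrite -(ler_pM2l a1) mulrA -exprMn -cabsM divff //.
by rewrite (cabsR 1) normr1 expr1n mul1r.
Qed.

(** If u tests f + g and v tests f - g, then (u + v) / 2 is used to test f and (u - v) / 2 to test
    g. The linear terms agree, and the parallelogram law of [kq] balances the quadratic ones. *)
Lemma knq_parallelogram_le (f g : kspace) :
  knq (f + g) + knq (f - g) <= 2 * knq f + 2 * knq g.
Proof.
rewrite -lerBrDr; apply: knq_le => u; rewrite lerBrDr addrC -lerBrDr.
apply: knq_le => v; rewrite lerBrDr.
have := legendre_le f (sscale 2^-1 (u ++ v)).
have := legendre_le g (sscale 2^-1 (u ++ sscale (-1) v)).
have i2 : (2^-1 : R[i]) = (2^-1)%:C by rewrite fmorphV rmorph_nat.
rewrite !legendre_sscale i2 cabsR conjR ger0_norm ?invr_ge0 // /legendre pairB pairD !pair_cat pair_sscale.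
have := kq_parallelogram u v.
rewrite !Re_real_mul rmorphN1 mulN1r !raddfD /= !raddfN /=.
move: (kq _) (kq _) (kq _) (kq _) => a b c d.
move: (Re _) (Re _) (Re _) (Re _) (knq _) (knq _) => *; lra.
Qed.

Lemma knq_parallelogram (f g : kspace) :
  knq (f + g) + knq (f - g) = 2 * knq f + 2 * knq g.
Proof.
apply/eqP; rewrite eq_le knq_parallelogram_le /=.
(* Applied to f + g and f - g, the inequality is its own converse. *)
have := knq_parallelogram_le (f + g) (f - g).
have -> : f + g + (f - g) = 2 *: f by rewrite addrACA subrr addr0 scaler_nat mulr2n.
have -> : f + g - (f - g) = 2 *: g
  by rewrite opprB [f + g]addrC -addrA [f + _]addrCA subrr addr0 scaler_nat mulr2n.
rewrite !knqZ; have -> : cabs (2 : R[i]) = 2 by rewrite -(rmorph_nat (real_complex R)) cabsR normr_nat.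
by rewrite expr2; lra.
Qed.

Definition knorm f : R := Num.sqrt (knq f).

Lemma knorm_ge0 f : 0 <= knorm f. Proof. exact: sqrtr_ge0. Qed.

Lemma knorm_sqr f : knorm f ^+ 2 = knq f.
Proof. by rewrite sqr_sqrtr // knq_ge0. Qed.

Definition kdot (f g : kspace) : R[i] := polar knq g f.

Lemma kdot_psd : psd_form (polar knq).
Proof. exact: polar_psd knq_ge0 knqZ knq_parallelogram. Qed.

Lemma kdot_diag f : kdot f f = (knq f)%:C.
Proof. exact: (polar_diag knqZ knq_parallelogram f). Qed.

Lemma knormD f g : knorm (f + g) <= knorm f + knorm g.
Proof.
rewrite -(ler_pXn2r (n := 2)) ?nnegrE ?addr_ge0 ?knorm_ge0 //.
rewrite knorm_sqr sqrrD !knorm_sqr.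
have -> : knq (f + g) = knq f + knq g + 2 * Re (polar knq f g).
  have h := kdot_diag (f + g); have hf := kdot_diag f; have hg := kdot_diag g.
  rewrite /kdot in h hf hg.
  rewrite (psdD kdot_psd) !(psdDl kdot_psd) (psdC kdot_psd g f) hf hg in h.
  have /= <- := congr1 (@complex.Re R) h.
  by case: (polar knq f g) => p q /=; lra.
have := psd_cauchy_schwarz kdot_psd f g; rewrite -!/(kdot _ _) !kdot_diag /=.
rewrite -!knorm_sqr -exprMn ler_pXn2r ?nnegrE ?cabs_ge0 ?mulr_ge0 ?knorm_ge0 // => h.
by have := le_trans (Re_le_cabs (kdot g f)) h; rewrite /kdot /=; lra.
Qed.

Lemma knorm_addC f g : (knorm (f + g))%:C <= (knorm f)%:C + (knorm g)%:C :> R[i].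
Proof. by rewrite -rmorphD lecR knormD. Qed.

Lemma knormZ (a : R[i]) f : (knorm (a *: f))%:C = `|a| * (knorm f)%:C.
Proof.
rewrite cabsE -rmorphM; congr real_complex_def.
by rewrite /knorm knqZ sqrtrM ?sqr_ge0 // sqrtr_sqr ger0_norm // cabs_ge0.
Qed.

Lemma kpoint f s : cabs (f s) <= knorm f * Num.sqrt (kq [:: (1, s)]).
Proof.
have := knq_cauchy_schwarz f [:: (1, s)].
rewrite /pair_with big_seq1 rmorph1 mul1r -knorm_sqr; set c := Num.sqrt _.
have <- : c ^+ 2 = kq [:: (1, s)] by rewrite sqr_sqrtr // kq_ge0.
by rewrite -exprMn ler_pXn2r ?nnegrE ?cabs_ge0 ?mulr_ge0 ?knorm_ge0 ?sqrtr_ge0.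
Qed.

Lemma knorm_eq0 f : (knorm f)%:C = 0 :> R[i] -> f = 0.
Proof.
move=> /complexI f0; apply: kspace_ext => s; apply: cabs_eq0; apply/eqP.
by rewrite eq_le cabs_ge0 andbT; apply: le_trans (kpoint f s) _; rewrite f0 mul0r.
Qed.

HB.instance Definition _ :=
  Lmodule_isNormed.Build R[i] kspace knorm_addC knormZ knorm_eq0.

Lemma knormE f : `|f| = (knorm f)%:C. Proof. by []. Qed.

Lemma real_cauchy (r : nat -> R) :
  (forall e : R, 0 < e -> exists N, forall m n, (N <= m)%N -> (N <= n)%N -> `|r m - r n| <= e) ->
  exists l, forall e : R, 0 < e -> exists N, forall n, (N <= n)%N -> `|r n - l| <= e.
Proof.
move=> h; have /R_complete cr : cauchy (r @ \oo).
  apply: cauchy_exP => e e0; have [N hN] := h (e / 2) (divr_gt0 e0 (ltr0Sn _ 1)).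
  exists (r N); exists N => // n /= Nn.
  by rewrite -ball_normE /ball_ /=; apply: le_lt_trans (hN _ _ (leqnn N) Nn) _; lra.
exists (lim (r @ \oo)) => e e0.
have : nbhs (lim (r @ \oo)) (ball (lim (r @ \oo)) e) by exact: nbhsx_ballx.
move=> /cr [N _ hN]; exists N => n /hN; rewrite /= -ball_normE /ball_ /= distrC.
exact: ltW.
Qed.

(** The limit l is formed pointwise. For fixed u the Legendre functional at u depends on finitely
    many values only, so the Cauchy estimate passes to l with a bound independent of u; this gives
    membership and norm convergence together. *)
Lemma kspace_complete (F : set_system kspace) : ProperFilter F -> cauchy F -> cvg F.
Proof.
move=> FF hF.
have /choice[f hf] n : exists f, F (ball f (n.+1%:R^-1)%:C).
  have n0 : 0 < (n.+1%:R^-1)%:C :> R[i] by rewrite ltcR invr_gt0.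
  by have /cauchyP := hF; exact.
have dist m n : knorm (f m - f n) <= m.+1%:R^-1 + n.+1%:R^-1.
  have [g []] := filter_ex (filterI (hf m) (hf n)).
  rewrite -!ball_normE /ball_ /= !knormE !ltcR => h1 h2.
  have -> : f m - f n = (f m - g) + - (f n - g) by rewrite opprB addrA subrK.
  apply: le_trans (knormD _ _) _; apply: lerD (ltW h1) _.
  by apply: le_trans (ltW h2); rewrite -lecR -!knormE normrN.
have dist2 m n : (n <= m)%N -> knorm (f m - f n) <= 2 * n.+1%:R^-1.
  move=> nm; apply: le_trans (dist m n) _; rewrite mulr_natl mulr2n lerD2r.
  by rewrite lef_pV2 ?posrE // ler_nat.
have point s : exists l, forall e : R, 0 < e -> exists N, forall n, (N <= n)%N ->
    cabs (f n s - l) <= e.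
  set c := Num.sqrt (kq [:: (1, s)]).
  have c0 : 0 <= c := sqrtr_ge0 _.
  have cau e : 0 < e -> exists N, forall m n, (N <= m)%N -> (N <= n)%N ->
      cabs (f m s - f n s) <= e.
    move=> e0; have c1 : 0 < 2 * (c + 1) by lra.
    have [N hN] := invSn_small (divr_gt0 e0 c1); exists N => m n /hN h1 /hN h2.
    have -> : f m s - f n s = (f m - f n) s by rewrite kspaceB.
    apply: le_trans (kpoint _ _) _; apply: le_trans (ler_wpM2r c0 (dist m n)) _.
    apply: le_trans (ler_wpM2r c0 (lerD h1 h2)) _.
    have : 0 <= e / (2 * (c + 1)) by rewrite divr_ge0 ?(ltW e0) ?(ltW c1).
    have : e / (2 * (c + 1)) * (2 * (c + 1)) = e by rewrite divfK // gt_eqF.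
    by move: (e / _) => w; lra.
  have [|x hx] := @real_cauchy (fun n => Re (f n s)).
    move=> e /cau[N hN]; exists N => m n h1 h2; apply: le_trans (hN m n h1 h2).
    by rewrite -raddfB Re_abs_le_cabs.
  have [|y hy] := @real_cauchy (fun n => Im (f n s)).
    move=> e /cau[N hN]; exists N => m n h1 h2; apply: le_trans (hN m n h1 h2).
    by rewrite -raddfB Im_abs_le_cabs.
  exists (Complex x y) => e e0; have e2 : 0 < e / 2 by lra.
  have [N1 h1] := hx _ e2; have [N2 h2] := hy _ e2.
  exists (maxn N1 N2) => n; rewrite geq_max => /andP[/h1 n1 /h2 n2].
  apply: le_trans (cabs_le_ReIm _) _; rewrite [leRHS]splitr; move: n1 n2.
  by case: (f n s) => a b /=; exact: lerD.
have /choice[l hl] := point.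
have lim_pair u e : 0 < e -> exists N, forall n, (N <= n)%N ->
    cabs (pair_with (f n) u - pair_with l u) <= e.
  elim: u e => [|x u IH] e e0.
    by exists 0 => n _; rewrite /pair_with !big_nil subrr cabs0 ltW.
  have e2 : 0 < e / 2 by lra.
  have [N1 h1] := IH _ e2.
  have c1 : 0 < cabs x.1 + 1 by have := cabs_ge0 x.1; lra.
  have [N2 h2] := hl x.2 _ (divr_gt0 e2 c1).
  exists (maxn N1 N2) => n; rewrite geq_max => /andP[n1 n2].
  rewrite /pair_with !big_cons opprD addrACA -mulrBr.
  rewrite [leRHS]splitr; apply: le_trans (cabsD _ _) (lerD _ (h1 n n1)).
  rewrite cabsM cabsJ; apply: le_trans (ler_wpM2l (cabs_ge0 _) (h2 n n2)) _.
  by rewrite mulrC mulrAC ler_pdivrMr // ler_wpM2l //; lra.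
have lim_leg n u : legendre (fun s => l s - f n s) u <= 4 * n.+1%:R^-1 ^+ 2.
  apply/ler_addgt0Pr => e e0; have e2 : 0 < e / 2 by lra.
  have [N hN] := lim_pair u _ e2.
  set m := maxn N n; have := hN m (leq_maxl _ _).
  have pB (g : S -> R[i]) : pair_with (fun s => g s - f n s) u = pair_with g u - pair_with (f n) u.
    rewrite /pair_with -sumrB; apply: eq_bigr => x _.
    by rewrite mulrBr.
  have := legendre_le (f m - f n) u; rewrite /legendre (pB l) pairB.
  have := dist2 m n (leq_maxr _ _); rewrite -(ler_pXn2r (n := 2)) ?nnegrE ?knorm_ge0 ?mulr_ge0 ?invr_ge0 //.
  rewrite knorm_sqr exprMn.
  have := Re_le_cabs (- (pair_with (f m) u - pair_with l u)); rewrite cabsN.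
  move: (cabs _) => w.
  case: (pair_with (f m) u) (pair_with (f n) u) (pair_with l u) => [? ?] [? ?] [? ?] /=.
  rewrite (_ : (2 : R) ^+ 2 = 4); last by ring.
  by move: (knq _) (_ ^+ 2) => *; lra.
have [C hC] : exists C, forall u, legendre (fun s => l s - f 0%N s) u <= C by eexists; exact: lim_leg.
(* Only l - f 0 is known to have a finite Legendre transform; adding the element f 0 gives l. *)
pose g : kspace := KSpace (ex_intro _ C hC) + f 0%N.
have gE s : g s = l s by rewrite /g kspaceD /= subrK.
have gf n : knorm (g - f n) <= 2 * n.+1%:R^-1.
  rewrite -(ler_pXn2r (n := 2)) ?nnegrE ?knorm_ge0 ?mulr_ge0 ?invr_ge0 //.
  rewrite knorm_sqr exprMn; apply: knq_le => u; have := lim_leg n u.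
  rewrite (_ : 2 ^+ 2 = 4 :> R); last by lra.
  congr (legendre _ u <= _); apply/funext => s.
  by rewrite kspaceB gE.
apply/cvg_ex; exists g; apply/cvg_ballP => e e0.
have [d d0 ->] : exists2 d : R, 0 < d & e = d%:C.
  have eR : (Re e)%:C = e by rewrite RRe_real // gtr0_real.
  by exists (Re e); rewrite ?eR // -ltcR eR.
(* The distance from g to f N is at most 2 / (N + 1) and that from f N to h is below 1 / (N + 1), in
   all at most three quarters of d. *)
have [N hN] := invSn_small (divr_gt0 d0 (ltr0Sn _ 3)).
apply: filterS (hf N) => h; rewrite -!ball_normE /ball_ /= !knormE !ltcR => hh.
have -> : g - h = (g - f N) + (f N - h) by rewrite addrA subrK.
have := hN N (leqnn _); have := gf N; have := knormD (g - f N) (f N - h); move: hh.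
move: (knorm _) (knorm _) (knorm _) (N.+1%:R^-1) => *; lra.
Qed.

HB.instance Definition _ := Uniform_isComplete.Build kspace kspace_complete.

Lemma kdot_bilinear : bilinear_for
  (GRing.Scale.Law.clone _ _ *%R _) (GRing.Scale.Law.clone _ _ (@Num.conj R[i] \; *%R) _)
  (kdot : kspace -> kspace -> R[i]).
Proof.
split=> [f a g h|f a g h]; first exact: (psdZD kdot_psd).
by rewrite /= /kdot (psdDl kdot_psd) (psdZl kdot_psd).
Qed.

HB.instance Definition _ := @bilinear_isBilinear.Build R[i] kspace kspace R[i]
  (GRing.Scale.Law.clone _ _ *%R _) (GRing.Scale.Law.clone _ _ (@Num.conj R[i] \; *%R) _)
  (kdot : kspace -> kspace -> R[i]) kdot_bilinear.

Lemma kdot_herm f g : kdot f g = (-1) ^+ false * Num.conj (kdot g f).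
Proof. by rewrite expr0 mul1r; exact: psdC kdot_psd g f. Qed.

HB.instance Definition _ :=
  isHermitianSesquilinear.Build R[i] kspace false (@Num.conj R[i]) kdot kdot_herm.

Lemma kdot_pos f : f != 0 -> 0 < kdot f f.
Proof.
move=> f0; rewrite kdot_diag ltcR lt_neqAle knq_ge0 andbT eq_sym.
apply: contra f0 => /eqP h; apply/eqP/knorm_eq0.
by rewrite /knorm h sqrtr0.
Qed.

HB.instance Definition _ := isDotProduct.Build R[i] kspace kdot kdot_pos.

Lemma kdot_norm f : kdot f f = `|f| ^+ 2.
Proof. by rewrite kdot_diag knormE -rmorphXn /= knorm_sqr. Qed.

HB.instance Definition _ := isHilbert.Build R kspace kdot_norm.

Lemma kcomb_bounded u : exists C, forall v, legendre (kcomb u) v <= C.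
Proof.
exists (kq u) => v; have := kq_ge0 (v ++ sscale (-1) u).
have := kq_parallelogram v u; rewrite kq_cat /legendre.
by lra.
Qed.

Definition kvec u : kspace := KSpace (kcomb_bounded u).

Lemma knq_kvec u : knq (kvec u) = kq u.
Proof.
apply/eqP; rewrite eq_le; apply/andP; split.
  apply: knq_le => v; have := kq_ge0 (v ++ sscale (-1) u).
  by have := kq_parallelogram v u; rewrite kq_cat /legendre /=; lra.
by apply: le_trans (legendre_le (kvec u) u); rewrite /legendre /= /kq; lra.
Qed.

Lemma kvec_cat a u v : kvec (u ++ sscale a v) = kvec u + a *: kvec v.
Proof.
apply: kspace_ext => s.
by rewrite kspaceD kspaceZ /= kcomb_cat kcomb_sscale mul1r addr0.
Qed.

Lemma inner_kvec s t : inner (kvec [:: (1, s)]) (kvec [:: (1, t)]) = k s t.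
Proof.
rewrite /inner /= /hdot /= /kdot.
have h a : knq (kvec [:: (1, s)] + a *: kvec [:: (1, t)]) =
    kq [:: (1, s)] + cabs a ^+ 2 * kq [:: (1, t)] + 2 * Re (a * k s t).
  rewrite -kvec_cat knq_kvec kq_cat kq_sscale kcomb_sscale pair_lin pair_cst0 addr0.
  by rewrite /pair_with big_seq1 rmorph1 mul1r /kcomb big_seq1 mul1r.
have key a : rpolar knq (kvec [:: (1, s)]) (a *: kvec [:: (1, t)]) = Re (a * k s t).
  rewrite /rpolar -scaleNr !h cabsN mulNr raddfN /=; lra.
rewrite /polar key -[X in rpolar knq _ X]scale1r key mul1r.
rewrite -complexiE; case: (k s t) => x y /=.
by rewrite mul0r mul1r sub0r opprK.
Qed.

(** The Legendre transform of f at v + u is its value at u plus that of f - u at v. Hence a u that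
    maximises it up to e^2 lies within e of f. *)
Lemma kvec_total : vspan (range (fun s => kvec [:: (1, s)])) = setT.
Proof.
apply/seteqP; split => // f _; rewrite vspanE => e e0.
have [_ [u _ <-] hu] := sup_adherent (exprn_gt0 2 e0) (legendre_sup f).
exists (kvec u).
  elim: u {hu} => [|x u IH].
    have -> : kvec [::] = 0 by apply: kspace_ext => s /=; exact: big_nil.
    exact: lspan0.
  have -> : kvec (x :: u) = x.1 *: kvec [:: (1, x.2)] + kvec u.
    apply: kspace_ext => s; rewrite kspaceD kspaceZ /= /kcomb big_cons big_seq1.
    by rewrite mul1r.
  by apply: lspanZD => //; apply: sub_lspan; exists x.2.
rewrite /nrm_le; have -> : nrm (f - kvec u) = knorm (f - kvec u) by [].
rewrite -(ler_pXn2r (n := 2)) ?nnegrE ?knorm_ge0 ?(ltW e0) // knorm_sqr.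
apply: knq_le => v; have := legendre_le f (v ++ u); move: hu; rewrite -/(knq f).
rewrite /legendre pairB pair_cat kq_cat /=.
case: (pair_with f u) (pair_with f v) (pair_with (kcomb u) v) => [? ?] [? ?] [? ?] /=.
by lra.
Qed.

End KernelSpace.

Lemma kernel_hilbert (R : realType) (S : Type) (k : @pkernel R S) :
  exists (T : hilbertType R) (e : S -> T),
    (forall s t, inner (e s) (e t) = k s t) /\ vspan (range e) = setT.
Proof.
exists (kspace k), (fun s => kvec k [:: (1, s)]); split; first exact: inner_kvec.
exact: kvec_total.
Qed.

(** * Relative tensor products *)

Section FormsOnFamilies.
Context {R : realType}.
Implicit Types H K L : hilbertType R.

Lemma bop_app H K (S T : 'L(H, K)) : S = T -> forall x, S x = T x.
Proof. by move=> ->. Qed.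

Lemma bopZ H K (S : 'L(H, K)) a x : S (a *: x) = a *: S x.
Proof. by rewrite -[a *: x]addr0 bop_linear linear0 addr0. Qed.

Lemma psd_pull (V : lmodType R[i]) H (f : V -> H) :
  (forall a x y, f (a *: x + y) = a *: f x + f y) ->
  psd_form (fun x y => inner (f x) (f y)).
Proof.
move=> lf; split=> [x a y z|x y|x]; first by rewrite lf innerDr innerZr.
  exact: innerC.
by rewrite inner_nrm /= sqr_ge0.
Qed.

Lemma psd_sum (V : lmodType R[i]) (I : finType) (q : I -> V -> V -> R[i]) :
  (forall i, psd_form (q i)) -> psd_form (fun x y => \sum_i q i x y).
Proof.
move=> h; split=> [x a y z|x y|x].
- by rewrite mulr_sumr -big_split /=; apply: eq_bigr => i _; rewrite (psdZD (h i)).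
- by rewrite rmorph_sum; apply: eq_bigr => i _; exact: psdC (h i) x y.
- by rewrite raddf_sum; apply: sumr_ge0 => i _; exact: psd_ge0 (h i) x.
Qed.

Lemma sum_op_bound H K m (x : 'I_m -> 'L(H, K)) :
  exists2 C, 0 <= C & forall z : 'I_m -> H,
    nrm (\sum_i x i (z i)) ^+ 2 <= C * \sum_i nrm (z i) ^+ 2.
Proof.
elim: m x => [|m IH] x.
  by exists 0 => // z; rewrite !big_ord0 nrm0 expr0n mulr0.
have [C C0 hC] := IH (fun i => x (lift ord0 i)); have [M M0 hM] := bop_bounded (x ord0).
exists (2 * M ^+ 2 + 2 * C); first by rewrite addr_ge0 // mulr_ge0 // sqr_ge0.
move=> z; rewrite !big_ord_recl.
have := hC (fun i => z (lift ord0 i)); have := hM (z ord0).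
have := nrmD (x ord0 (z ord0)) (\sum_(i < m) x (lift ord0 i) (z (lift ord0 i))).
have s0 : 0 <= \sum_(i < m) nrm (z (lift ord0 i)) ^+ 2.
  by apply: sumr_ge0 => i _; exact: sqr_ge0.
move: s0 (nrm_ge0 (x ord0 (z ord0) + \sum_(i < m) x (lift ord0 i) (z (lift ord0 i)))).
have := nrm_ge0 (x ord0 (z ord0)); have := nrm_ge0 (z ord0).
have := nrm_ge0 (\sum_(i < m) x (lift ord0 i) (z (lift ord0 i))).
move: (nrm _) (nrm _) (nrm _) (nrm _) (\sum_(i < m) _ ^+ 2) => b a t c s.
move=> c0 t0 a0 s0 b0 bac at_ cs.
have h1 : b ^+ 2 <= (a + c) ^+ 2 by rewrite ler_pXn2r ?nnegrE // addr_ge0.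
have h2 : a ^+ 2 <= (M * t) ^+ 2 by rewrite ler_pXn2r ?nnegrE // mulr_ge0.
have := sqr_ge0 (a - c); have := mulr_ge0 C0 (sqr_ge0 t).
have := mulr_ge0 (sqr_ge0 M) s0; nra.
Qed.

Lemma comp_linear H K (S : 'L(H, K)) m (i : 'I_m) (a : R[i]) (z w : {ffun 'I_m -> H}) :
  S ((a *: z + w) i) = a *: S (z i) + S (w i).
Proof. by rewrite !ffunE bop_linear. Qed.

Lemma sum_comp_linear H K m (x : 'I_m -> 'L(H, K)) (a : R[i]) (z w : {ffun 'I_m -> H}) :
  \sum_i x i ((a *: z + w) i) = a *: (\sum_i x i (z i)) + \sum_i x i (w i).
Proof.
by rewrite scaler_sumr -big_split /=; apply: eq_bigr => i _; rewrite comp_linear.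
Qed.

(* The forms |sum_i x_i z_i|^2 and sum_i |z_i|^2 on H^m are comparable only up to a
   constant depending on m, which [symmetric_bound] removes. *)
Lemma intertwiner_bound H H' K K' m (x : 'I_m -> 'L(H, K)) (x' : 'I_m -> 'L(H', K'))
    (S : 'L(H, H')) (M : R) : op_le M S ->
  (forall i j, adj (x' i) \ob x' j \ob S = S \ob (adj (x i) \ob x j)) ->
  forall z : 'I_m -> H,
    nrm (\sum_i x' i (S (z i))) <= M * nrm (\sum_i x i (z i)).
Proof.
move=> [M0 hM] hx z0; pose P := adj S \ob S.
have hxE i j k : adj (x' i) (x' j (S k)) = S (adj (x i) (x j k)).
  exact: (bop_app (hx i j) k).
(* P = S^* S commutes with the Gram operators of x, so that it acts symmetrically on H^m for the
   form [q]. *)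
have hP i j k : adj (x i) (x j (P k)) = P (adj (x i) (x j k)).
  rewrite /= -hxE; set u := S k.
  have := bop_app (congr1 (@adj R _ _) (hx j i)) u.
  by rewrite !adj_comp !adjK.
have Psym k l : inner (P k) l = inner k (P l) by rewrite /= -inner_adj adj_inner.
pose q (z w : {ffun 'I_m -> H}) := inner (\sum_i x i (z i)) (\sum_i x i (w i)).
have hq : psd_form q by apply: psd_pull => a z w; exact: sum_comp_linear.
pose n (z w : {ffun 'I_m -> H}) := \sum_i inner (z i) (w i).
have hn : psd_form n.
  apply: psd_sum => i; apply: (psd_pull (f := fun z : {ffun 'I_m -> H} => z i)).
  by move=> a z w; rewrite !ffunE.
pose PP (z : {ffun 'I_m -> H}) : {ffun 'I_m -> H} := [ffun i => P (z i)].
have PPE w i : PP w i = P (w i) by rewrite ffunE.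
have nE z : Re (n z z) = \sum_i nrm (z i) ^+ 2.
  by rewrite raddf_sum; apply: eq_bigr => i _; rewrite inner_nrm.
have [C C0 hC] := sum_op_bound x.
pose z : {ffun 'I_m -> H} := [ffun i => z0 i].
(* P is bounded by M^2 and [symmetric_bound] compares squares, whence the exponent 4. *)
have qP : Re (q (PP z) (PP z)) <= M ^+ 4 * Re (q z z).
  apply: (symmetric_bound hq hn (C := C)) => [|u v|u|u].
  - exact: exprn_ge0.
  - rewrite /q !inner_suml; under [RHS]eq_bigr do rewrite inner_sumr.
    apply: eq_bigr => i _; rewrite inner_sumr; apply: eq_bigr => j _; rewrite !ffunE.
    by rewrite (adj_inner (x i)) Psym -hP -(adj_inner (x i)).
  - by rewrite /q inner_nrm nE /=.
  - rewrite !nE mulr_sumr; apply: ler_sum => i _; rewrite ffunE /=.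
    rewrite -[4%N]/(2 * 2)%N exprM -exprMn ler_pXn2r ?nnegrE ?mulr_ge0 ?nrm_ge0 ?exprn_ge0 //.
    apply: le_trans (adj_bound M0 hM _) _.
    by rewrite expr2 -mulrA ler_wpM2l.
have key : nrm (\sum_i x' i (S (z i))) ^+ 2 = Re (q z (PP z)).
  rewrite nrm_sqr inner_suml /q; congr (Re _); rewrite inner_suml.
  apply: eq_bigr => i _; rewrite inner_sumr [RHS]inner_sumr.
  apply: eq_bigr => j _; rewrite PPE.
  by rewrite (adj_inner (x' i)) hxE (adj_inner S) -[adj S (S _)]/(P _) -hP -(adj_inner (x i)).
rewrite -(ler_pXn2r (n := 2)) ?nnegrE ?mulr_ge0 ?nrm_ge0 //.
have zE i : z i = z0 i by rewrite ffunE.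
have -> : nrm (\sum_i x' i (S (z0 i))) = nrm (\sum_i x' i (S (z i))).
  by congr (nrm _); apply: eq_bigr => i _; rewrite zE.
have -> : (M * nrm (\sum_i x i (z0 i))) ^+ 2 = M ^+ 2 * Re (q z z).
  rewrite exprMn /q inner_nrm /=; congr (_ * nrm _ ^+ 2).
  by apply: eq_bigr => i _; rewrite zE.
rewrite key; apply: le_trans (Re_le_cabs _) _.
have q0 := psd_ge0 hq z.
rewrite -(ler_pXn2r (n := 2)) ?nnegrE ?cabs_ge0 ?mulr_ge0 ?sqr_ge0 //.
apply: le_trans (psd_cauchy_schwarz hq _ _) _; have := ler_wpM2l q0 qP.
rewrite exprMn -exprM /=; lra.
Qed.

End FormsOnFamilies.

(** * Existence of the relative tensor product, of [rho] and of the kets *)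

Section RelativeTensor.
Context {R : realType} {KK : hilbertType R}.
Implicit Types H K L : hilbertType R.

(** All that the construction of the tensor product uses of modules over two commuting algebras. *)
Record compatible H K (be : set 'L(KK, H)) (ga : set 'L(KK, K)) : Prop := {
  comp_ndl : Defs.nondegenerate be;
  comp_ndr : Defs.nondegenerate ga;
  comp_comm : forall x x' y y', be x -> be x' -> ga y -> ga y' ->
    forall z, adj x (x' (adj y (y' z))) = adj y (y' (adj x (x' z))) }.

Lemma compatibleC H K (be : set 'L(KK, H)) (ga : set 'L(KK, K)) :
  compatible be ga -> compatible ga be.
Proof.
move=> [h1 h2 h3]; split=> // x x' y y' hx hx' hy hy' z.
by rewrite h3.
Qed.

Lemma pair_sum_op_bound H K m (x : 'I_m -> 'L(H, K)) :
  exists2 C, 0 <= C & forall z : 'I_m * 'I_m -> H,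
    \sum_k nrm (\sum_i x i (z (i, k))) ^+ 2 <= C * \sum_k \sum_i nrm (z (i, k)) ^+ 2.
Proof.
have [C C0 hC] := sum_op_bound x; exists C => // z.
rewrite mulr_sumr; apply: ler_sum => k _.
exact: (hC (fun i => z (i, k))).
Qed.

(** On the space of m x m arrays in KK, P applies the Gram matrix of the eta to the first index. It
    is symmetric for the form [q] built from the xi because the two Gram matrices commute, so
    [positive_transfer] gives 0 <= q z (P z). At the array with z0 on its diagonal, this is the
    claim. *)
Lemma rtensor_kernel_pos H K (be : set 'L(KK, H)) (ga : set 'L(KK, K)) m
    (xi : 'I_m -> 'L(KK, H)) (eta : 'I_m -> 'L(KK, K)) (z0 : 'I_m -> KK) :
  compatible be ga -> (forall i, be (xi i)) -> (forall i, ga (eta i)) ->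
  0 <= Re (\sum_i \sum_j inner (z0 i) (adj (xi i) (xi j (adj (eta i) (eta j (z0 j)))))).
Proof.
move=> hbg hxi heta; pose V := {ffun 'I_m * 'I_m -> KK}.
pose q (z w : V) := \sum_i inner (\sum_k xi k (z (i, k))) (\sum_k xi k (w (i, k))).
pose p (z w : V) := \sum_k inner (\sum_i eta i (z (i, k))) (\sum_i eta i (w (i, k))).
pose n (z w : V) := \sum_k \sum_i inner (z (i, k)) (w (i, k)).
have lin L (x : 'I_m -> 'L(KK, L)) (f : 'I_m -> 'I_m * 'I_m) a (z w : V) :
    \sum_i x i ((a *: z + w) (f i)) = a *: (\sum_i x i (z (f i))) + \sum_i x i (w (f i)).
  rewrite scaler_sumr -big_split /=; apply: eq_bigr => i _.
  by rewrite !ffunE bop_linear.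
have hq : psd_form q.
  by apply: psd_sum => i; apply: psd_pull => a z w; exact: (lin _ xi (fun k => (i, k))).
have hp : psd_form p.
  by apply: psd_sum => k; apply: psd_pull => a z w; exact: (lin _ eta (fun i => (i, k))).
have hn : psd_form n.
  apply: psd_sum => k; apply: psd_sum => i.
  by apply: (psd_pull (f := fun z : V => z (i, k))) => a z w; rewrite !ffunE.
have nE z : Re (n z z) = \sum_k \sum_i nrm (z (i, k)) ^+ 2.
  rewrite raddf_sum; apply: eq_bigr => k _; rewrite raddf_sum; apply: eq_bigr => i _.
  by rewrite inner_nrm.
pose P (z : V) : V := [ffun ik => \sum_j adj (eta ik.1) (eta j (z (j, ik.2)))].
have [M M0 hM] := pair_sum_op_bound eta; have [C C0 hC] := pair_sum_op_bound xi.
pose z : V := [ffun ik => if ik.1 == ik.2 then z0 ik.1 else 0].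
have op_sum L (T : 'L(L, KK)) (f : 'I_m -> L) : T (\sum_i f i) = \sum_i T (f i).
  by apply: (big_morph T); [exact: bopD|exact: linear0].
have op_sum' L (T : 'L(KK, L)) (f : 'I_m -> KK) : T (\sum_i f i) = \sum_i T (f i).
  by apply: (big_morph T); [exact: bopD|exact: linear0].
have := positive_transfer hq hn (C := C) M0 hp (P := P) _ _ _ _ z.
have hz i L (x : 'I_m -> 'L(KK, L)) : \sum_k x k (z (i, k)) = x i (z0 i).
  rewrite (bigD1 i) //= ffunE eqxx big1 ?addr0 // => k ki.
  by rewrite ffunE /= eq_sym (negbTE ki) linear0.
have -> : q z (P z) =
    \sum_i \sum_j inner (z0 i) (adj (xi i) (xi j (adj (eta i) (eta j (z0 j))))).
  apply: eq_bigr => i _; rewrite hz inner_sumr; apply: eq_bigr => j _.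
  rewrite adj_inner ffunE /= (bigD1 j) //= ffunE eqxx big1 ?addr0 // => k kj.
  by rewrite ffunE /= (negbTE kj) !linear0.
apply.
- move=> u v; rewrite /q.
  transitivity (\sum_i \sum_j \sum_k \sum_l
     inner (xi k (adj (eta i) (eta j (u (j, k))))) (xi l (v (i, l)))).
    apply: eq_bigr => i _; rewrite inner_suml exchange_big /=; apply: eq_bigr => k _.
    rewrite ffunE /= op_sum' inner_suml; apply: eq_bigr => j _.
    by rewrite inner_sumr.
  rewrite exchange_big /=; apply: eq_bigr => j _.
  rewrite inner_suml; under [RHS]eq_bigr do rewrite inner_sumr.
  rewrite exchange_big /=; apply: eq_bigr => k _.
  rewrite exchange_big /=; apply: eq_bigr => l _.
  rewrite ffunE /= op_sum' inner_sumr; apply: eq_bigr => i _.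
  rewrite (adj_inner (xi k)) -inner_adj (adj_inner (eta j)) [RHS]adj_inner.
  by rewrite (comp_comm hbg).
- move=> u v; rewrite /n /p; apply: eq_bigr => k _.
  rewrite inner_suml; apply: eq_bigr => i _; rewrite ffunE /= inner_sumr inner_sumr.
  by apply: eq_bigr => j _; rewrite adj_inner.
- by move=> u; rewrite nE /p raddf_sum /=; under eq_bigr do rewrite inner_nrm /=; exact: hM.
- move=> u; rewrite nE exchange_big /q raddf_sum /=; under eq_bigr do rewrite inner_nrm /=.
  have := hC (fun ki => u (ki.2, ki.1)); exact.
Qed.

Lemma rtensor_spec H K (be : set 'L(KK, H)) (ga : set 'L(KK, K)) :
  compatible be ga -> is_rtensor be ga (rtensor be ga) (rgen be ga).
Proof.
move=> hbg; rewrite /rgen /rtensor /rtensor_data; case: pselect => [h|]; first by case: (cid h).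
case.
pose S := {p : 'L(KK, H) * KK * 'L(KK, K) | be p.1.1 /\ ga p.2}.
pose k (s t : S) : R[i] := inner (sval s).1.2
  (adj (sval s).1.1 ((sval t).1.1 (adj (sval s).2 ((sval t).2 (sval t).1.2)))).
have kC s t : k s t = (k t s)^*.
  case: s t => [[[x z] y] [hx hy]] [[[x' z'] y'] [hx' hy']]; rewrite /k /= -innerC.
  rewrite -inner_adj (adj_inner x) -inner_adj (adj_inner y).
  by rewrite (comp_comm hbg).
have kpos (u : seq (R[i] * S)) :
    0 <= Re (\sum_(x <- u) \sum_(y <- u) x.1^* * y.1 * k x.2 y.2).
  pose v i := tnth (in_tuple u) i.
  have := rtensor_kernel_pos (xi := fun i => (sval (v i).2).1.1)
    (eta := fun i => (sval (v i).2).2) (fun i => (v i).1 *: (sval (v i).2).1.2) hbg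
    (fun i => (svalP (v i).2).1) (fun i => (svalP (v i).2).2).
  congr (_ <= Re _); rewrite [RHS]big_tnth; apply: eq_bigr => i _.
  rewrite [RHS]big_tnth; apply: eq_bigr => j _.
  by rewrite !bopZ innerZl innerZr mulrA.
have [T [e [he te]]] := kernel_hilbert (PKernel kC kpos).
(* Triples outside be and ga are no generators; 0 is a default value there. *)
pose t x z y := if pselect (be x /\ ga y) is left h then e (exist _ (x, z, y) h) else 0.
exists (existT _ T t) => /=; split.
  move=> x x' z z' y y' hx hx' hy hy'; rewrite /t.
  case: pselect => [h1|[]//]; case: pselect => [h2|[]//].
  by rewrite he.
apply/seteqP; split => // x _; have : vspan (range e) x by rewrite te.
apply: (vspan_min (vsub_vspan _)) => _ [[p hp] _ <-]; apply: sub_vspan.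
exists p => //; rewrite /t; case: pselect => // h; congr e.
by case: p hp h => -[x1 z] y hp h; congr exist; exact: Prop_irrelevance.
Qed.

Lemma the_bopP H K (P : set 'L(H, K)) : (exists T, P T) -> P (the_bop P).
Proof. by move=> h; rewrite /the_bop; case: pselect => // h'; case: (cid h'). Qed.

(** Scalars are absorbed into the vectors z. Linear combinations become plain sums of one vector for
    each chosen index, the form in which [intertwiner_bound] estimates them. *)
Lemma family_extension (I : Type) H K L (X : set I) (A : I -> 'L(H, K)) (f : I -> H -> L)
    (M : R) : 0 <= M ->
  vspan [set k | exists2 i, X i & exists z, k = A i z] = setT ->
  (forall i, X i -> forall a z, f i (a *: z) = a *: f i z) ->
  (forall m (i : 'I_m -> I) (z : 'I_m -> H), (forall k, X (i k)) ->
    nrm (\sum_k f (i k) (z k)) <= M * nrm (\sum_k A (i k) (z k))) ->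
  exists2 T : 'L(K, L), (forall i, X i -> forall z, T (A i z) = f i z) & op_le M T.
Proof.
move=> M0 hX fZ hf.
pose J := {p : I * H | X p.1}.
have [|m c i|T hT bT] := @extension R J K L (fun i => A (sval i).1 (sval i).2)
  (fun i => f (sval i).1 (sval i).2) M M0.
- apply/seteqP; split => // k _.
  have : vspan [set k | exists2 i, X i & exists z, k = A i z] k by rewrite hX.
  apply: (vspan_min (vsub_vspan _)) => _ [i Xi [z ->]]; apply: sub_vspan.
  by exists (exist _ (i, z) Xi).
- have := hf m (fun k => (sval (i k)).1) (fun k => c k *: (sval (i k)).2)
    (fun k => svalP (i k)).
  under eq_bigr => k _ do rewrite (fZ _ (svalP (i k))).
  by under [X in M * nrm X]eq_bigr do rewrite bopZ.
- exists T => // i Xi z; exact: (hT (exist _ (i, z) Xi)).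
Qed.

Lemma set_extension H K L (X : set 'L(H, K)) (f : 'L(H, K) -> H -> L) (M : R) :
  0 <= M -> Defs.nondegenerate X ->
  (forall x, X x -> forall a z, f x (a *: z) = a *: f x z) ->
  (forall m (x : 'I_m -> 'L(H, K)) (z : 'I_m -> H), (forall i, X (x i)) ->
    nrm (\sum_i f (x i) (z i)) <= M * nrm (\sum_i x i (z i))) ->
  exists2 T : 'L(K, L), (forall x, X x -> forall z, T (x z) = f x z) & op_le M T.
Proof. exact: (@family_extension _ _ _ _ X id f M). Qed.

Lemma nondegenerate_eq H K L (X : set 'L(H, K)) (S T : 'L(K, L)) :
  Defs.nondegenerate X -> (forall x, X x -> forall z, S (x z) = T (x z)) -> S = T.
Proof.
by move=> hX h; apply: (bop_eq_total hX) => _ [x Xx [z ->]]; exact: h.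
Qed.

(** What makes x z |-> x (T z) a well-defined bounded operator, as [rho_ex] shows. *)
Definition centralizes H (al : set 'L(KK, H)) (T : 'L(KK, KK)) : Prop :=
  forall x y, al x -> al y -> forall z, adj x (y (T z)) = T (adj x (y z)).

Lemma rho_ex H (al : set 'L(KK, H)) T M : Defs.nondegenerate al -> centralizes al T ->
  op_le M T ->
  exists2 S : 'L(H, H), (forall x, al x -> forall z, S (x z) = x (T z)) & op_le M S.
Proof.
move=> nd hT bT; apply: (@set_extension _ _ _ _ (fun x z => x (T z))) => //.
- by case: bT.
- by move=> x _ a z; rewrite !bopZ.
- move=> m x z hx; apply: intertwiner_bound bT _ z => i j.
  by apply: bop_ext => k /=; exact: hT.
Qed.

Section Rho.
Variables (H : hilbertType R) (al : set 'L(KK, H)).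
Hypothesis nd : Defs.nondegenerate al.

Lemma rhoE T x z : centralizes al T -> al x -> rho al T (x z) = x (T z).
Proof.
move=> hT ax; have [M _ bT] := op_le_exists T.
have [S hS _] := rho_ex nd hT bT.
have := @the_bopP _ _ [set S | forall x, al x -> forall z, S (x z) = x (T z)]
  (ex_intro _ S hS).
exact.
Qed.

Lemma rho_unique T (S : 'L(H, H)) :
  centralizes al T -> (forall x, al x -> forall z, S (x z) = x (T z)) ->
  rho al T = S.
Proof.
by move=> hT hS; apply: (nondegenerate_eq nd) => x ax z; rewrite rhoE // hS.
Qed.

Lemma rho_bound T M : centralizes al T -> op_le M T -> op_le M (rho al T).
Proof.
move=> hT bT; have [S hS bS] := rho_ex nd hT bT.
by rewrite (rho_unique hT hS).
Qed.

Lemma centralizes_adj T : centralizes al T -> centralizes al (adj T).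
Proof.
move=> hT x y ax ay z; apply: inner_ext => w.
rewrite -(adj_inner x) (inner_adj y) -!(adj_inner T) -hT // -(inner_adj y).
by rewrite (adj_inner x).
Qed.

Lemma rho_adj T : centralizes al T -> adj (rho al T) = rho al (adj T).
Proof.
move=> hT; apply/esym/(rho_unique (centralizes_adj hT)) => x ax z.
apply: (inner_total nd) => _ [y ay [w ->]].
rewrite -(adj_inner (rho al T)) rhoE // (adj_inner y) (adj_inner T) (adj_inner y).
by rewrite (centralizes_adj hT).
Qed.

End Rho.

Section Kets.
Variables (H K : hilbertType R) (be : set 'L(KK, H)) (ga : set 'L(KK, K)).
Hypothesis hbg : compatible be ga.

Lemma inner_rgen x x' z z' y y' : be x -> be x' -> ga y -> ga y' ->
  inner (rgen be ga x z y) (rgen be ga x' z' y') = inner z (adj x (x' (adj y (y' z')))).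
Proof. by move=> *; exact: (rtensor_spec hbg).1. Qed.

Lemma rgen_total : vspan [set rgen be ga p.1.1 p.1.2 p.2 | p in
  [set p : 'L(KK, H) * KK * 'L(KK, K) | be p.1.1 /\ ga p.2]] = setT.
Proof. exact: (rtensor_spec hbg).2. Qed.

(** [is_rtensor] prescribes inner products only; linearity in the middle argument is read off by
    pairing with the total set of generators. *)
Lemma rgenZD x a z z' y : be x -> ga y ->
  rgen be ga x (a *: z + z') y = a *: rgen be ga x z y + rgen be ga x z' y.
Proof.
move=> bx gy; apply: (inner_total rgen_total) => _ [[[x' w] y'] [/= bx' gy'] <-].
by rewrite innerDr innerZr !inner_rgen // !bop_linear innerDr innerZr.
Qed.

Lemma rgenZ x a z y : be x -> ga y -> rgen be ga x (a *: z) y = a *: rgen be ga x z y.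
Proof.
move=> bx gy; have := rgenZD a z 0 bx gy.
have -> : rgen be ga x 0 y = 0.
  apply: (inner_total rgen_total) => _ [[[x' w] y'] [/= bx' gy'] <-].
  by rewrite inner_rgen // !linear0 !inner0r.
by rewrite !addr0.
Qed.

Lemma compatible_centralizes x x' : be x -> be x' -> centralizes ga (adj x \ob x').
Proof. by move=> bx bx' y y' gy gy' z /=; rewrite (comp_comm hbg). Qed.

(** The square of |sum rgen x z_i y_i| is <sum y_i z_i, sum y_i (x^* x z_i)>. As x^* x commutes with
    the Gram operators of the y_i, [intertwiner_bound] applies to it with the bound M^2. *)
Lemma ket1_ex x M : be x -> op_le M x ->
  exists2 T : 'L(K, rtensor be ga), (forall y, ga y -> forall z, T (y z) = rgen be ga x z y) &
    op_le M T.
Proof.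
move=> bx [M0 hM]; apply: set_extension => //; first exact: comp_ndr hbg.
  by move=> y gy a z; exact: rgenZ.
move=> m y z hy.
have bS : op_le (M * M) (adj x \ob x) by apply: op_le_comp; [exact: op_le_adj|].
have := @intertwiner_bound R KK KK K K m y y (adj x \ob x) _ bS _ z.
have hS i j : adj (y i) \ob y j \ob (adj x \ob x) = (adj x \ob x) \ob (adj (y i) \ob y j).
  by apply: bop_ext => k /=; rewrite (comp_comm hbg).
move=> /(_ hS) h.
rewrite -(ler_pXn2r (n := 2)) ?nnegrE ?mulr_ge0 ?nrm_ge0 // nrm_sqr.
have -> : inner (\sum_i rgen be ga x (z i) (y i)) (\sum_i rgen be ga x (z i) (y i)) =
    inner (\sum_i y i (z i)) (\sum_i y i ((adj x \ob x) (z i))).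
  rewrite !inner_suml; apply: eq_bigr => i _; rewrite !inner_sumr; apply: eq_bigr => j _.
  by rewrite inner_rgen // (comp_comm hbg) // adj_inner.
apply: le_trans (Re_le_cabs _) _; apply: le_trans (cauchy_schwarz _ _) _.
apply: le_trans (ler_wpM2l (nrm_ge0 _) h) _.
by rewrite [leRHS](_ : _ = nrm (\sum_i y i (z i)) * (M * M * nrm (\sum_i y i (z i)))) //; ring.
Qed.

Lemma ket1E x y z : be x -> ga y -> ket1 be ga x (y z) = rgen be ga x z y.
Proof.
move=> bx gy; have [M _ bM] := op_le_exists x.
have [S hS _] := ket1_ex bx bM.
have := @the_bopP _ _ [set S | forall y, ga y -> forall z, S (y z) = rgen be ga x z y]
  (ex_intro _ S hS).
exact.
Qed.

Lemma ket2_ex y M : ga y -> op_le M y ->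
  exists2 T : 'L(H, rtensor be ga), (forall x, be x -> forall z, T (x z) = rgen be ga x z y) &
    op_le M T.
Proof.
move=> gy [M0 hM]; apply: set_extension => //; first exact: comp_ndl hbg.
  by move=> x bx a z; exact: rgenZ.
move=> m x z hx.
have bS : op_le (M * M) (adj y \ob y) by apply: op_le_comp; [exact: op_le_adj|].
have := @intertwiner_bound R KK KK H H m x x (adj y \ob y) _ bS _ z.
have hS i j : adj (x i) \ob x j \ob (adj y \ob y) = (adj y \ob y) \ob (adj (x i) \ob x j).
  by apply: bop_ext => k /=; rewrite (comp_comm hbg).
move=> /(_ hS) h.
rewrite -(ler_pXn2r (n := 2)) ?nnegrE ?mulr_ge0 ?nrm_ge0 // nrm_sqr.
have -> : inner (\sum_i rgen be ga (x i) (z i) y) (\sum_i rgen be ga (x i) (z i) y) =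
    inner (\sum_i x i (z i)) (\sum_i x i ((adj y \ob y) (z i))).
  rewrite !inner_suml; apply: eq_bigr => i _; rewrite !inner_sumr; apply: eq_bigr => j _.
  by rewrite inner_rgen // adj_inner.
apply: le_trans (Re_le_cabs _) _; apply: le_trans (cauchy_schwarz _ _) _.
apply: le_trans (ler_wpM2l (nrm_ge0 _) h) _.
by rewrite [leRHS](_ : _ = nrm (\sum_i x i (z i)) * (M * M * nrm (\sum_i x i (z i)))) //; ring.
Qed.

Lemma ket2E x y z : be x -> ga y -> ket2 be ga y (x z) = rgen be ga x z y.
Proof.
move=> bx gy; have [M _ bM] := op_le_exists y.
have [S hS _] := ket2_ex gy bM.
have := @the_bopP _ _ [set S | forall x, be x -> forall z, S (x z) = rgen be ga x z y]
  (ex_intro _ S hS).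
exact.
Qed.

Lemma ket2_unique y (S : 'L(H, rtensor be ga)) :
  ga y -> (forall x, be x -> forall z, S (x z) = rgen be ga x z y) ->
  ket2 be ga y = S.
Proof.
move=> gy hS; apply: (nondegenerate_eq (comp_ndl hbg)) => x bx z.
by rewrite ket2E // hS.
Qed.

Lemma ket2_bound y M : ga y -> op_le M y -> op_le M (ket2 be ga y).
Proof.
move=> gy bM; have [S hS bS] := ket2_ex gy bM.
by rewrite (ket2_unique gy hS).
Qed.

Lemma ket12 x y z : be x -> ga y -> ket1 be ga x (y z) = ket2 be ga y (x z).
Proof. by move=> bx gy; rewrite ket1E // ket2E. Qed.

(** The basic rule of calculation, with [ket2_ket2]: inner products of kets become actions of the
    base algebras. *)
Lemma ket1_ket1 x x' k : be x -> be x' ->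
  adj (ket1 be ga x) (ket1 be ga x' k) = rho ga (adj x \ob x') k.
Proof.
move=> bx bx'; have hc := compatible_centralizes bx bx'.
pose T := adj (ket1 be ga x) \ob ket1 be ga x'.
suff -> : rho ga (adj x \ob x') = T by [].
apply: (rho_unique (comp_ndr hbg) hc) => y gy z /=.
apply: (inner_total (comp_ndr hbg)) => _ [y' gy' [z' ->]].
by rewrite -adj_inner !ket1E // inner_rgen // adj_inner (comp_comm hbg).
Qed.

Lemma ket2_ket2 y y' h : ga y -> ga y' ->
  adj (ket2 be ga y) (ket2 be ga y' h) = rho be (adj y \ob y') h.
Proof.
move=> gy gy'.
have hc : centralizes be (adj y \ob y').
  by move=> x x' bx bx' z /=; rewrite (comp_comm hbg).
pose T := adj (ket2 be ga y) \ob ket2 be ga y'.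
suff -> : rho be (adj y \ob y') = T by [].
apply: (rho_unique (comp_ndl hbg) hc) => x bx z /=.
apply: (inner_total (comp_ndl hbg)) => _ [x' bx' [z' ->]].
by rewrite -adj_inner !ket2E // inner_rgen // adj_inner.
Qed.

Lemma ket1_total : vspan (Defs.oapp (kets1 be ga be)) = setT.
Proof.
apply/seteqP; split => // k _; have : vspan [set rgen be ga p.1.1 p.1.2 p.2 | p in
  [set p : 'L(KK, H) * KK * 'L(KK, K) | be p.1.1 /\ ga p.2]] k by rewrite rgen_total.
apply: (vspan_min (vsub_vspan _)) => _ [[[x z] y] [/= bx gy] <-]; apply: sub_vspan.
exists (ket1 be ga x); first by exists x.
by exists (y z); rewrite ket1E.
Qed.

Lemma ket2_total : vspan (Defs.oapp (kets2 be ga ga)) = setT.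
Proof.
apply/seteqP; split => // k _; have : vspan [set rgen be ga p.1.1 p.1.2 p.2 | p in
  [set p : 'L(KK, H) * KK * 'L(KK, K) | be p.1.1 /\ ga p.2]] k by rewrite rgen_total.
apply: (vspan_min (vsub_vspan _)) => _ [[[x z] y] [/= bx gy] <-]; apply: sub_vspan.
exists (ket2 be ga y); first by exists y.
by exists (x z); rewrite ket2E.
Qed.

Lemma eq_on_ket1 L (S T : 'L(rtensor be ga, L)) :
  (forall x, be x -> forall k, S (ket1 be ga x k) = T (ket1 be ga x k)) -> S = T.
Proof.
by move=> h; apply: (nondegenerate_eq ket1_total) => _ [x bx <-]; exact: h.
Qed.

Lemma eq_on_ket2 L (S T : 'L(rtensor be ga, L)) :
  (forall y, ga y -> forall h, S (ket2 be ga y h) = T (ket2 be ga y h)) -> S = T.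
Proof.
by move=> h; apply: (nondegenerate_eq ket2_total) => _ [y gy <-]; exact: h.
Qed.

Lemma inner_eq_ket1 (u v : rtensor be ga) :
  (forall x, be x -> forall k, inner (ket1 be ga x k) u = inner (ket1 be ga x k) v) -> u = v.
Proof.
by move=> h; apply: (inner_total ket1_total) => _ [_ [x bx <-] [k ->]]; exact: h.
Qed.

Lemma inner_eq_ket2 (u v : rtensor be ga) :
  (forall y, ga y -> forall k, inner (ket2 be ga y k) u = inner (ket2 be ga y k) v) -> u = v.
Proof.
by move=> h; apply: (inner_total ket2_total) => _ [_ [y gy <-] [k ->]]; exact: h.
Qed.

Lemma ket2ZD a y y' : ga y -> ga y' -> ga (a *: y + y') ->
  ket2 be ga (a *: y + y') = a *: ket2 be ga y + ket2 be ga y'.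
Proof.
move=> gy gy' gyy; apply: (nondegenerate_eq (comp_ndl hbg)) => x bx z.
by rewrite bopDE bopZE -!ket12 // bopDE bopZE bop_linear.
Qed.

End Kets.
End RelativeTensor.

(** * Isometries and unitaries from equal Gram matrices *)

Section Gram.
Context {R : realType}.
Implicit Types H K L : hilbertType R.

Definition total_family (I : Type) H K (X : set I) (A : I -> 'L(H, K)) : Prop :=
  vspan [set k | exists2 i, X i & exists z, k = A i z] = setT.

Lemma unitaryP H K (U : 'L(H, K)) : unitary U <->
  (forall h, adj U (U h) = h) /\ (forall k, U (adj U k) = k).
Proof.
split=> [[h1 h2]|[h1 h2]].
  by split=> h; [exact: (bop_app h1)|exact: (bop_app h2)].
by split; apply: bop_ext.
Qed.

Lemma eq_on_family (I : Type) H K L (X : set I) (A : I -> 'L(H, K)) (S T : 'L(K, L)) :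
  total_family X A -> (forall i, X i -> forall z, S (A i z) = T (A i z)) -> S = T.
Proof. by move=> hA h; apply: (bop_eq_total hA) => _ [i Xi [z ->]]; exact: h. Qed.

(** Families with equal Gram matrices differ by an isometry. The maps [flip], [assoc] and [flip23]
    are all obtained in this way. *)
Lemma gram_extension (I : Type) H K L (X : set I) (A : I -> 'L(H, K)) (B : I -> 'L(H, L)) :
  total_family X A ->
  (forall i j, X i -> X j -> forall z w, inner (A i z) (A j w) = inner (B i z) (B j w)) ->
  exists T : 'L(K, L), (forall i, X i -> forall z, T (A i z) = B i z) /\
    adj T \ob T = bop1 K.
Proof.
move=> hA hAB.
have [||T hT _] := @family_extension _ I H K L X A (fun i => B i) 1 ler01 hA.
- by move=> i _ a z; rewrite bopZ.
- move=> m i z hi; rewrite mul1r -(ler_pXn2r (n := 2)) ?nnegrE ?nrm_ge0 // !nrm_sqr.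
  have -> // : inner (\sum_k B (i k) (z k)) (\sum_k B (i k) (z k)) =
      inner (\sum_k A (i k) (z k)) (\sum_k A (i k) (z k)).
  rewrite !inner_suml; apply: eq_bigr => k _; rewrite !inner_sumr; apply: eq_bigr => l _.
  by rewrite hAB.
exists T; split=> //; apply: (eq_on_family hA) => i Xi z /=.
apply: (inner_total hA) => _ [j Xj [w ->]].
by rewrite -adj_inner !hT // hAB.
Qed.

Lemma gram_unitary (I : Type) H K L (X : set I) (A : I -> 'L(H, K)) (B : I -> 'L(H, L))
    (T : 'L(K, L)) : total_family X B ->
  (forall i, X i -> forall z, T (A i z) = B i z) -> adj T \ob T = bop1 K -> unitary T.
Proof.
move=> hB hT TT; split=> //; apply: (eq_on_family hB) => i Xi z /=.
by rewrite -hT //; congr (T _); exact: (bop_app TT).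
Qed.

End Gram.

(** * Modules and the maps between relative tensor products *)

Section Modules.
Context {R : realType} {KK : hilbertType R}.
Implicit Types H K L : hilbertType R.

(* What is used of the axioms of a C*-module; B1 and B2 below play the roles of
   the two algebras of the base. *)
Record smod (B : set 'L(KK, KK)) H (E : set 'L(KK, H)) : Prop := {
  smod_sub : osub E;
  smod_nd : Defs.nondegenerate E;
  smod_star : forall x y, E x -> E y -> B (adj x \ob y) }.

Definition acts_on (B : set 'L(KK, KK)) H (E F : set 'L(KK, H)) : Prop :=
  forall T, B T -> forall x, F x -> F (rho E T \ob x).

Definition commuting (B B' : set 'L(KK, KK)) : Prop :=
  forall S T, B S -> B' T -> forall z, S (T z) = T (S z).

Lemma commutingC B B' : commuting B B' -> commuting B' B.
Proof. by move=> h S T hS hT z; rewrite (h T S hT hS). Qed.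

Lemma smod_compatible B B' H K (be : set 'L(KK, H)) (ga : set 'L(KK, K)) :
  commuting B B' -> smod B be -> smod B' ga -> compatible be ga.
Proof.
move=> hB hb hg; split; [exact: smod_nd hb|exact: smod_nd hg|].
move=> x x' y y' bx bx' gy gy' z.
exact: hB (smod_star hb bx bx') (smod_star hg gy gy') z.
Qed.

Lemma smod_centralizes B B' H (E : set 'L(KK, H)) T :
  commuting B B' -> smod B E -> B' T -> centralizes E T.
Proof. by move=> hB hE hT x y Ex Ey z; exact: hB (smod_star hE Ex Ey) hT z. Qed.

(** On the vectors x z, [rho] acts by multiplying x by T from the right, which commutes with
    multiplying x by S from the left. *)
Lemma intertwines_rho H H' (E : set 'L(KK, H)) (E' : set 'L(KK, H')) (S : 'L(H, H')) T :
  Defs.nondegenerate E -> Defs.nondegenerate E' -> centralizes E T -> centralizes E' T ->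
  (forall x, E x -> E' (S \ob x)) -> forall h, rho E' T (S h) = S (rho E T h).
Proof.
move=> nd nd' hT hT' hS.
apply: bop_app (_ : rho E' T \ob S = S \ob rho E T).
apply: (nondegenerate_eq nd) => x Ex z /=.
by rewrite (rhoE nd) // (rhoE nd' z hT' (hS x Ex)).
Qed.

Lemma ket1_family H K (be : set 'L(KK, H)) (ga : set 'L(KK, K)) :
  compatible be ga -> total_family be (ket1 be ga).
Proof.
move=> hbg; have := ket1_total hbg; congr (vspan _ = _); apply/seteqP; split.
  by move=> _ [_ [y gy <-] [z ->]]; exists y => //; exists z.
by move=> _ [y gy [z ->]]; exists (ket1 be ga y); [exists y|exists z].
Qed.

Lemma ket2_family H K (be : set 'L(KK, H)) (ga : set 'L(KK, K)) :
  compatible be ga -> total_family ga (ket2 be ga).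
Proof.
move=> hbg; have := ket2_total hbg; congr (vspan _ = _); apply/seteqP; split.
  by move=> _ [_ [y gy <-] [z ->]]; exists y => //; exists z.
by move=> _ [y gy [z ->]]; exists (ket2 be ga y); [exists y|exists z].
Qed.

(** * The maps S (x) id and id (x) S *)

Section Tensl.
Variables (H H' K : hilbertType R) (be : set 'L(KK, H)) (be' : set 'L(KK, H')).
Variables (ga : set 'L(KK, K)) (S : 'L(H, H')).
Hypotheses (hbg : compatible be ga) (hbg' : compatible be' ga).
Hypothesis hS : forall y y', ga y -> ga y' -> forall h,
  rho be' (adj y \ob y') (S h) = S (rho be (adj y \ob y') h).

Lemma tensl_ex M : op_le M S -> exists2 T : 'L(rtensor be ga, rtensor be' ga),
  (forall y, ga y -> forall h, T (ket2 be ga y h) = ket2 be' ga y (S h)) & op_le M T.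
Proof.
move=> bS.
apply: (@family_extension _ _ _ _ _ ga (ket2 be ga) (fun y h => ket2 be' ga y (S h))).
- by case: bS.
- exact: ket2_family hbg.
- by move=> y _ a z; rewrite !bopZ.
move=> m y z hy; apply: intertwiner_bound bS _ z => i j.
by apply: bop_ext => h /=; rewrite !ket2_ket2 // hS.
Qed.

Lemma tenslE y h : ga y -> tensl be ga be' S (ket2 be ga y h) = ket2 be' ga y (S h).
Proof.
move=> gy; have [M _ bS] := op_le_exists S; have [T hT _] := tensl_ex bS.
have := @the_bopP _ _ _ [set T | forall y, ga y ->
  T \ob ket2 be ga y = ket2 be' ga y \ob S].
move=> h'; apply: (bop_app (h' _ y gy)).
by exists T => y' gy'; apply: bop_ext => k; exact: hT.
Qed.

End Tensl.

Section Tensr.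
Variables (H K K' : hilbertType R) (be : set 'L(KK, H)) (ga : set 'L(KK, K)).
Variables (ga' : set 'L(KK, K')) (S : 'L(K, K')).
Hypotheses (hbg : compatible be ga) (hbg' : compatible be ga').
Hypothesis hS : forall x x', be x -> be x' -> forall h,
  rho ga' (adj x \ob x') (S h) = S (rho ga (adj x \ob x') h).

Lemma tensr_ex M : op_le M S -> exists2 T : 'L(rtensor be ga, rtensor be ga'),
  (forall x, be x -> forall h, T (ket1 be ga x h) = ket1 be ga' x (S h)) & op_le M T.
Proof.
move=> bS.
apply: (@family_extension _ _ _ _ _ be (ket1 be ga) (fun y h => ket1 be ga' y (S h))).
- by case: bS.
- exact: ket1_family hbg.
- by move=> y _ a z; rewrite !bopZ.
move=> m y z hy; apply: intertwiner_bound bS _ z => i j.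
by apply: bop_ext => h /=; rewrite !ket1_ket1 // hS.
Qed.

Lemma tensrE x h : be x -> tensr be ga ga' S (ket1 be ga x h) = ket1 be ga' x (S h).
Proof.
move=> bx; have [M _ bS] := op_le_exists S; have [T hT _] := tensr_ex bS.
have := @the_bopP _ _ _ [set T | forall x, be x ->
  T \ob ket1 be ga x = ket1 be ga' x \ob S].
move=> h'; apply: (bop_app (h' _ x bx)).
by exists T => x' bx'; apply: bop_ext => k; exact: hT.
Qed.

Lemma tensr_bound M : op_le M S -> op_le M (tensr be ga ga' S).
Proof.
move=> bS; have [T hT bT] := tensr_ex bS.
suff -> : tensr be ga ga' S = T by [].
by apply: (eq_on_ket1 hbg) => y gy h; rewrite tensrE // hT.
Qed.

Lemma tensr_ket2 y k : ga y -> ga' (S \ob y) ->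
  tensr be ga ga' S (ket2 be ga y k) = ket2 be ga' (S \ob y) k.
Proof.
move=> gy gy'; apply: (bop_app (_ : tensr be ga ga' S \ob ket2 be ga y = ket2 be ga' (S \ob y))).
apply: (nondegenerate_eq (comp_ndl hbg)) => x bx z /=.
by rewrite -ket12 // tensrE // -(ket12 hbg' z bx gy').
Qed.

End Tensr.

(** * The flip *)

Section Flips.

Lemma flip_spec H K (be : set 'L(KK, H)) (ga : set 'L(KK, K)) :
  compatible be ga -> (forall x y, be x -> ga y -> forall z,
  flip be ga (rgen be ga x z y) = rgen ga be y z x) /\
  adj (flip be ga) \ob flip be ga = bop1 _.
Proof.
move=> hbg; have hgb := compatibleC hbg.
have [|T [hT TT]] := gram_extension (B := ket2 ga be) (ket1_family hbg).
  by move=> x x' bx bx' z w; rewrite adj_inner ket1_ket1 // [RHS]adj_inner ket2_ket2.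
have hT' : forall x y, be x -> ga y -> forall z, T (rgen be ga x z y) = rgen ga be y z x.
  by move=> x y bx gy z; rewrite -ket1E // hT // ket2E.
have hF := @the_bopP _ _ _ [set T | forall x y, be x -> ga y -> forall z,
  T (rgen be ga x z y) = rgen ga be y z x] (ex_intro _ T hT').
split=> //; suff -> : flip be ga = T by [].
apply: (bop_eq_total (rgen_total hbg)) => _ [[[x z] y] [/= bx gy] <-].
by rewrite hT' //; exact: hF.
Qed.

Lemma flip_ket1 H K (be : set 'L(KK, H)) (ga : set 'L(KK, K)) x k :
  compatible be ga -> be x -> flip be ga (ket1 be ga x k) = ket2 ga be x k.
Proof.
move=> hbg bx; have hgb := compatibleC hbg.
apply: (bop_app (_ : flip be ga \ob ket1 be ga x = ket2 ga be x)).
apply: (nondegenerate_eq (comp_ndr hbg)) => y gy z /=.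
by rewrite ket1E // (flip_spec hbg).1 // ket2E.
Qed.

Lemma flip_ket2 H K (be : set 'L(KK, H)) (ga : set 'L(KK, K)) y k :
  compatible be ga -> ga y -> flip be ga (ket2 be ga y k) = ket1 ga be y k.
Proof.
move=> hbg gy; have hgb := compatibleC hbg.
apply: (bop_app (_ : flip be ga \ob ket2 be ga y = ket1 ga be y)).
apply: (nondegenerate_eq (comp_ndl hbg)) => x bx z /=.
by rewrite ket2E // (flip_spec hbg).1 // ket1E.
Qed.

Lemma flipK H K (be : set 'L(KK, H)) (ga : set 'L(KK, K)) :
  compatible be ga -> forall u, flip ga be (flip be ga u) = u.
Proof.
move=> hbg; apply: (bop_app (_ : flip ga be \ob flip be ga = bop1 _)).
apply: (eq_on_ket1 hbg) => x bx k /=.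
by rewrite flip_ket1 // flip_ket2 //; exact: compatibleC.
Qed.

Lemma flip_adj H K (be : set 'L(KK, H)) (ga : set 'L(KK, K)) :
  compatible be ga -> adj (flip be ga) = flip ga be.
Proof.
move=> hbg; have hgb := compatibleC hbg; apply: bop_ext => v.
by rewrite -{1}(flipK hgb v); exact: (bop_app (flip_spec hbg).2).
Qed.

End Flips.

(** * Module structures on tensor products *)

Section TriModules.
Variables (B B' D : set 'L(KK, KK)).
Hypotheses (hBB : commuting B B') (D_sub : osub D).
Variables (H K : hilbertType R) (be : set 'L(KK, H)) (ga : set 'L(KK, K)).
Hypotheses (hb : smod B be) (hg : smod B' ga).

Let hbg : compatible be ga := smod_compatible hBB hb hg.

Lemma total_comp H1 H2 H3 (X : set 'L(H2, H3)) (Y : set 'L(H1, H2)) :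
  Defs.nondegenerate X -> Defs.nondegenerate Y -> Defs.nondegenerate (ospan (oprod X Y)).
Proof.
move=> hX hY; apply/seteqP; split => // k _.
have : vspan (Defs.oapp X) k by rewrite hX.
apply: (vspan_min (vsub_vspan _)) => _ [S XS [h ->]].
have : vspan (Defs.oapp Y) h by rewrite hY.
apply: (vspan_image (vsub_vspan _)) => _ [T YT [z ->]]; apply: sub_vspan.
exists (S \ob T); last by exists z.
by apply: sub_ospan; exists S => //; exists T.
Qed.

Lemma star_ospan H1 (Y : set 'L(KK, H1)) :
  (forall x y, Y x -> Y y -> D (adj x \ob y)) ->
  forall x y, ospan Y x -> ospan Y y -> D (adj x \ob y).
Proof.
move=> h x y hx hy; move: y hy; apply: ospan_compl => // y Yy.
have [M M0 bM] := op_le_exists y; move: x hx.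
apply: (@ospan_map_in _ _ _ _ _ setT Y D (fun x => adj x \ob y) Num.conj M) => //.
- exact: rmorph1.
- by move=> a x x' _ _; rewrite adjZD bcompZDl.
- by move=> e x _ ex; rewrite mulrC; apply: op_le_comp => //; exact: op_le_adj.
- by move=> x Yx; exact: h.
Qed.

(** On generators, the star product of |y>_2 a and |y'>_2 a' is a^* rho(y^* y') a'. It lies in D
    because rho(y^* y') leaves al invariant. The case of [rtri_smod] is symmetric. *)
Lemma ltri_smod (al : set 'L(KK, H)) : smod D al -> acts_on B' be al ->
  smod D (ltri be ga al).
Proof.
move=> ha hact; split; first exact: ospan_osub.
  by apply: total_comp; [exact: ket2_total|exact: smod_nd ha].
apply: star_ospan => _ _ [_ [y gy <-] [a aa ->]] [_ [y' gy' <-] [a' aa' ->]].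
have -> : adj (ket2 be ga y \ob a) \ob (ket2 be ga y' \ob a') =
    adj a \ob (rho be (adj y \ob y') \ob a').
  by rewrite adj_comp; apply: bop_ext => z /=; rewrite ket2_ket2.
by apply: (smod_star ha) => //; apply: hact => //; exact: (smod_star hg gy gy').
Qed.

Lemma rtri_smod (de : set 'L(KK, K)) : smod D de -> acts_on B ga de ->
  smod D (rtri be ga de).
Proof.
move=> ha hact; split; first exact: ospan_osub.
  by apply: total_comp; [exact: ket1_total|exact: smod_nd ha].
apply: star_ospan => _ _ [_ [y gy <-] [a aa ->]] [_ [y' gy' <-] [a' aa' ->]].
have -> : adj (ket1 be ga y \ob a) \ob (ket1 be ga y' \ob a') =
    adj a \ob (rho ga (adj y \ob y') \ob a').
  by rewrite adj_comp; apply: bop_ext => z /=; rewrite ket1_ket1.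
by apply: (smod_star ha) => //; apply: hact => //; exact: (smod_star hb gy gy').
Qed.

Lemma ltri_gen (al : set 'L(KK, H)) y a : ga y -> al a ->
  ltri be ga al (ket2 be ga y \ob a).
Proof. by move=> gy aa; apply: sub_ospan; exists (ket2 be ga y); [exists y|exists a]. Qed.

Lemma rtri_gen (de : set 'L(KK, K)) x d : be x -> de d ->
  rtri be ga de (ket1 be ga x \ob d).
Proof. by move=> bx dd; apply: sub_ospan; exists (ket1 be ga x); [exists x|exists d]. Qed.

Lemma rho_ltri (al : set 'L(KK, H)) T y h : smod D al -> acts_on B' be al ->
  centralizes al T -> centralizes (ltri be ga al) T -> ga y ->
  rho (ltri be ga al) T (ket2 be ga y h) = ket2 be ga y (rho al T h).
Proof.
move=> ha hact hT hT' gy; have nd := smod_nd (ltri_smod ha hact).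
apply: (bop_app (_ : rho (ltri be ga al) T \ob ket2 be ga y = ket2 be ga y \ob rho al T)).
apply: (nondegenerate_eq (smod_nd ha)) => a aa z /=.
by rewrite (rhoE nd z hT' (ltri_gen gy aa)) /= (rhoE (smod_nd ha)).
Qed.

Lemma rho_rtri (de : set 'L(KK, K)) T x k : smod D de -> acts_on B ga de ->
  centralizes de T -> centralizes (rtri be ga de) T -> be x ->
  rho (rtri be ga de) T (ket1 be ga x k) = ket1 be ga x (rho de T k).
Proof.
move=> ha hact hT hT' gy; have nd := smod_nd (rtri_smod ha hact).
apply: (bop_app (_ : rho (rtri be ga de) T \ob ket1 be ga x = ket1 be ga x \ob rho de T)).
apply: (nondegenerate_eq (smod_nd ha)) => a aa z /=.
by rewrite (rhoE nd z hT' (rtri_gen gy aa)) /= (rhoE (smod_nd ha)).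
Qed.

End TriModules.

Lemma rho_comm (B : set 'L(KK, KK)) H (E F : set 'L(KK, H)) S T h :
  Defs.nondegenerate F -> acts_on B E F -> B T -> centralizes F S ->
  rho E T (rho F S h) = rho F S (rho E T h).
Proof.
move=> nd hact BT hS.
apply: (bop_app (_ : rho E T \ob rho F S = rho F S \ob rho E T)).
apply: (nondegenerate_eq nd) => d Fd z /=.
by rewrite (rhoE nd) // -[RHS]/(rho F S ((rho E T \ob d) z)) (rhoE nd) //; exact: hact.
Qed.

Lemma total_comp2 (I J : Type) H1 H2 H3 (X : set I) (Y : set J)
    (A : I -> 'L(H2, H3)) (C : J -> 'L(H1, H2)) :
  total_family X A -> total_family Y C ->
  total_family [set p : I * J | X p.1 /\ Y p.2] (fun p => A p.1 \ob C p.2).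
Proof.
move=> hA hC; apply/seteqP; split => // k _.
have : vspan [set k | exists2 i, X i & exists z, k = A i z] k by rewrite hA.
apply: (vspan_min (vsub_vspan _)) => _ [i Xi [h ->]].
have : vspan [set k | exists2 i, Y i & exists z, k = C i z] h by rewrite hC.
apply: (vspan_image (vsub_vspan _)) => _ [j Yj [z ->]]; apply: sub_vspan.
by exists (i, j) => //; exists z.
Qed.

(** * Associativity and the exchange of the last two factors *)

Section Associativity.
Variables (B B' D D' : set 'L(KK, KK)).
Hypotheses (hBB : commuting B B') (hDD : commuting D D').
Hypotheses (sB : osub B) (sB' : osub B') (sD : osub D).

Section Assoc.
Variables (H K L : hilbertType R) (be : set 'L(KK, H)) (ga de : set 'L(KK, K)).
Variables (ep : set 'L(KK, L)).
Hypotheses (hb : smod B be) (hg : smod B' ga) (hd : smod D de) (he : smod D' ep).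
Hypotheses (act1 : acts_on B ga de) (act2 : acts_on D' de ga).

Let hbg : compatible be ga := smod_compatible hBB hb hg.
Let hde : compatible de ep := smod_compatible hDD hd he.
Let hr : smod D (rtri be ga de) := rtri_smod hBB sD hb hg hd act1.
Let hl : smod B' (ltri de ep ga) := ltri_smod hDD sB' hd he hg act2.
Let hre : compatible (rtri be ga de) ep := smod_compatible hDD hr he.
Let hbl : compatible be (ltri de ep ga) := smod_compatible hBB hb hl.

(** The Gram matrices of the two families of double kets are the products of rho(x^* x') and rho(y^*
    y') on K in opposite orders; by [rho_comm] they agree. *)
Lemma assoc_spec :
  (forall x y k, be x -> ep y ->
    assoc be ga de ep (ket2 (rtri be ga de) ep y (ket1 be ga x k)) =
    ket1 be (ltri de ep ga) x (ket2 de ep y k)) /\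
  unitary (assoc be ga de ep).
Proof.
have tA := total_comp2 (ket2_family hre) (ket1_family hbg).
have tB := total_comp2 (ket1_family hbl) (ket2_family hde).
pose X := [set p : 'L(KK, L) * 'L(KK, H) | ep p.1 /\ be p.2].
pose A (p : 'L(KK, L) * 'L(KK, H)) := ket2 (rtri be ga de) ep p.1 \ob ket1 be ga p.2.
pose C (p : 'L(KK, L) * 'L(KK, H)) := ket1 be (ltri de ep ga) p.2 \ob ket2 de ep p.1.
have tC : total_family X C.
  have := tB; congr (vspan _ = _); apply/seteqP; split.
    by move=> _ [[x y] [/= bx ey] [z ->]]; exists (y, x) => //; exists z.
  by move=> _ [[y x] [/= ey bx] [z ->]]; exists (x, y) => //; exists z.
have [|T [hT TT]] := @gram_extension _ _ _ _ _ X A C tA.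
  move=> [y x] [y' x'] [/= ey bx] [/= ey' bx'] z w.
  rewrite adj_inner (ket2_ket2 hre) // (rho_rtri hBB sD hb hg _ hd act1) //; last first.
    - by apply: smod_centralizes hDD hr _; exact: (smod_star he).
    - by apply: smod_centralizes hDD hd _; exact: (smod_star he).
  rewrite adj_inner (ket1_ket1 hbg) //.
  rewrite adj_inner (ket1_ket1 hbl) // (rho_ltri hDD sB' hd he _ hg act2) //; last first.
    - by apply: smod_centralizes (commutingC hBB) hl _; exact: (smod_star hb).
    - by apply: smod_centralizes (commutingC hBB) hg _; exact: (smod_star hb).
  rewrite adj_inner (ket2_ket2 hde) // (rho_comm _ (smod_nd hd) act1) //.
    exact: (smod_star hb).
  by apply: smod_centralizes hDD hd _; exact: (smod_star he).
have hP := @the_bopP _ _ _ [set T | forall x y, be x -> ep y ->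
    T \ob (ket2 (rtri be ga de) ep y \ob ket1 be ga x) =
    ket1 be (ltri de ep ga) x \ob ket2 de ep y].
have {}hP : forall x y, be x -> ep y ->
    assoc be ga de ep \ob (ket2 (rtri be ga de) ep y \ob ket1 be ga x) =
    ket1 be (ltri de ep ga) x \ob ket2 de ep y.
  apply: hP; exists T => x y bx ey; apply: bop_ext => z.
  exact: (hT (y, x)).
split=> [x y k bx ey|]; first exact: (bop_app (hP x y bx ey) k).
have -> : assoc be ga de ep = T.
  apply: (eq_on_family tA) => -[y x] [/= ey bx] z.
  rewrite (hT (y, x)) //; exact: (bop_app (hP x y bx ey) z).
exact: gram_unitary tC hT TT.
Qed.

End Assoc.

Section Flip23.
Variables (H K L : hilbertType R) (be de : set 'L(KK, H)) (ga : set 'L(KK, K)).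
Variables (ep : set 'L(KK, L)).
Hypotheses (hb : smod B be) (hg : smod B' ga) (hd : smod D de) (he : smod D' ep).
Hypotheses (act1 : acts_on B' be de) (act2 : acts_on D' de be).

Let hbg : compatible be ga := smod_compatible hBB hb hg.
Let hde : compatible de ep := smod_compatible hDD hd he.
Let hr : smod D (ltri be ga de) := ltri_smod hBB sD hb hg hd act1.
Let hl : smod B (ltri de ep be) := ltri_smod hDD sB hd he hb act2.
Let hre : compatible (ltri be ga de) ep := smod_compatible hDD hr he.
Let hbl : compatible (ltri de ep be) ga := smod_compatible hBB hl hg.

(** The argument of [assoc_spec], now with two commuting representations on H, the factor that stays
    in place. *)
Lemma flip23_spec :
  (forall x y k, ga x -> ep y ->
    flip23 be de ga ep (ket2 (ltri be ga de) ep y (ket2 be ga x k)) =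
    ket2 (ltri de ep be) ga x (ket2 de ep y k)) /\
  unitary (flip23 be de ga ep).
Proof.
have tA := total_comp2 (ket2_family hre) (ket2_family hbg).
have tB := total_comp2 (ket2_family hbl) (ket2_family hde).
pose X := [set p : 'L(KK, L) * 'L(KK, K) | ep p.1 /\ ga p.2].
pose A (p : 'L(KK, L) * 'L(KK, K)) := ket2 (ltri be ga de) ep p.1 \ob ket2 be ga p.2.
pose C (p : 'L(KK, L) * 'L(KK, K)) := ket2 (ltri de ep be) ga p.2 \ob ket2 de ep p.1.
have tC : total_family X C.
  have := tB; congr (vspan _ = _); apply/seteqP; split.
    by move=> _ [[x y] [/= bx ey] [z ->]]; exists (y, x) => //; exists z.
  by move=> _ [[y x] [/= ey bx] [z ->]]; exists (x, y) => //; exists z.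
have [|T [hT TT]] := @gram_extension _ _ _ _ _ X A C tA.
  move=> [y x] [y' x'] [/= ey bx] [/= ey' bx'] z w.
  rewrite adj_inner (ket2_ket2 hre) // (rho_ltri hBB sD hb hg _ hd act1) //; last first.
    - by apply: smod_centralizes hDD hr _; exact: (smod_star he).
    - by apply: smod_centralizes hDD hd _; exact: (smod_star he).
  rewrite adj_inner (ket2_ket2 hbg) //.
  rewrite adj_inner (ket2_ket2 hbl) // (rho_ltri hDD sB hd he _ hb act2) //; last first.
    - by apply: smod_centralizes hBB hl _; exact: (smod_star hg).
    - by apply: smod_centralizes hBB hb _; exact: (smod_star hg).
  rewrite adj_inner (ket2_ket2 hde) // (rho_comm _ (smod_nd hd) act1) //.
    exact: (smod_star hg).
  by apply: smod_centralizes hDD hd _; exact: (smod_star he).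
have hP := @the_bopP _ _ _ [set T | forall x y, ga x -> ep y ->
    T \ob (ket2 (ltri be ga de) ep y \ob ket2 be ga x) =
    ket2 (ltri de ep be) ga x \ob ket2 de ep y].
have {}hP : forall x y, ga x -> ep y ->
    flip23 be de ga ep \ob (ket2 (ltri be ga de) ep y \ob ket2 be ga x) =
    ket2 (ltri de ep be) ga x \ob ket2 de ep y.
  apply: hP; exists T => x y bx ey; apply: bop_ext => z.
  exact: (hT (y, x)).
split=> [x y k bx ey|]; first exact: (bop_app (hP x y bx ey) k).
have -> : flip23 be de ga ep = T.
  apply: (eq_on_family tA) => -[y x] [/= ey bx] z.
  rewrite (hT (y, x)) //; exact: (bop_app (hP x y bx ey) z).
exact: gram_unitary tC hT TT.
Qed.

End Flip23.
End Associativity.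

Section UnitaryTensors.
Variables (H H' K : hilbertType R) (be : set 'L(KK, H)) (be' : set 'L(KK, H')).
Variables (ga : set 'L(KK, K)) (S : 'L(H, H')).
Hypotheses (hbg : compatible be ga) (hbg' : compatible be' ga) (uS : unitary S).

Lemma tensl_unitary :
  (forall y y', ga y -> ga y' -> forall h,
    rho be' (adj y \ob y') (S h) = S (rho be (adj y \ob y') h)) ->
  unitary (tensl be ga be' S).
Proof.
move=> hS; have [S1 S2] := (unitaryP S).1 uS.
have hE y h : ga y -> tensl be ga be' S (ket2 be ga y h) = ket2 be' ga y (S h).
  by move=> gy; rewrite tenslE.
apply: (@gram_unitary _ _ _ _ _ ga (ket2 be ga) (fun y => ket2 be' ga y \ob S)) => //.
- have := ket2_family hbg'; congr (vspan _ = _); apply/seteqP; split.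
    by move=> _ [y gy [z ->]]; exists y => //; exists (adj S z); rewrite /= S2.
  by move=> _ [y gy [z ->]]; exists y => //; exists (S z).
- by move=> y gy z; exact: hE.
apply: (eq_on_ket2 hbg) => y gy h /=; apply: (inner_eq_ket2 hbg) => y' gy' h'.
rewrite -adj_inner !hE // adj_inner ket2_ket2 // hS // adj_inner S1.
by rewrite adj_inner ket2_ket2.
Qed.

End UnitaryTensors.

Section UnitaryTensors2.
Variables (H K K' : hilbertType R) (be : set 'L(KK, H)) (ga : set 'L(KK, K)).
Variables (ga' : set 'L(KK, K')) (S : 'L(K, K')).
Hypotheses (hbg : compatible be ga) (hbg' : compatible be ga') (uS : unitary S).

Lemma tensr_unitary :
  (forall x x', be x -> be x' -> forall h,
    rho ga' (adj x \ob x') (S h) = S (rho ga (adj x \ob x') h)) ->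
  unitary (tensr be ga ga' S).
Proof.
move=> hS; have [S1 S2] := (unitaryP S).1 uS.
have hE y h : be y -> tensr be ga ga' S (ket1 be ga y h) = ket1 be ga' y (S h).
  by move=> gy; rewrite tensrE.
apply: (@gram_unitary _ _ _ _ _ be (ket1 be ga) (fun y => ket1 be ga' y \ob S)) => //.
- have := ket1_family hbg'; congr (vspan _ = _); apply/seteqP; split.
    by move=> _ [y gy [z ->]]; exists y => //; exists (adj S z); rewrite /= S2.
  by move=> _ [y gy [z ->]]; exists y => //; exists (S z).
- by move=> y gy z; exact: hE.
apply: (eq_on_ket1 hbg) => y gy h /=; apply: (inner_eq_ket1 hbg) => y' gy' h'.
rewrite -adj_inner !hE // adj_inner ket1_ket1 // hS // adj_inner S1.
by rewrite adj_inner ket1_ket1.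
Qed.

End UnitaryTensors2.
End Modules.

(** * Slices of the pentagon equation *)

Section Core.
Context {R : realType} {KK : hilbertType R}.
Variables (B1 B2 : set 'L(KK, KK)).
Hypotheses (c12 : commuting B1 B2) (s1 : osub B1) (s2 : osub B2).
Let c21 : commuting B2 B1 := commutingC c12.

(** B1 and B2 stand for the algebras of b and of b^dag: this is what is used of a module over
    (b^dag, b, b^dag), and [duo] is what is used of one over (b, b^dag). *)
Record tri (H : hilbertType R) (bh al be : set 'L(KK, H)) : Prop := {
  tri_bh : smod B2 bh; tri_al : smod B1 al; tri_be : smod B2 be;
  act_bh_al : acts_on B1 bh al; act_bh_be : acts_on B1 bh be;
  act_al_bh : acts_on B2 al bh; act_al_be : acts_on B2 al be;
  act_be_bh : acts_on B1 be bh; act_be_al : acts_on B1 be al }.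

Record duo (K : hilbertType R) (ga dh : set 'L(KK, K)) : Prop := {
  duo_ga : smod B1 ga; duo_dh : smod B2 dh;
  act_ga_dh : acts_on B2 ga dh; act_dh_ga : acts_on B1 dh ga }.

Definition maps_to (H K : hilbertType R) (S : 'L(H, K)) (E : set 'L(KK, H))
  (F : set 'L(KK, K)) : Prop := forall x, E x -> F (S \ob x).

Section Statement.
Variables (H K : hilbertType R) (bh al be : set 'L(KK, H)) (ga dh : set 'L(KK, K)).
Variables (V : 'L(rtensor bh al, rtensor al be)) (X : 'L(rtensor dh al, rtensor ga be)).

Definition slice2 (b xi : 'L(KK, H)) : 'L(H, H) :=
  adj (ket2 al be b) \ob V \ob ket2 bh al xi.

(* The pentagon equation, cut by |xi>_3 and |a>_2 on the right and by <b|_3 on the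
   left: Th is 1 (x) <b|_2 V |xi>_2, and X \ob Lam is <b|_3 X_12 X_13. *)
Definition sliced_pentagon : Prop := forall b, be b ->
  exists Lam : 'L(rtensor dh (rtri al be al), rtensor dh al),
    (forall a a' k, al a -> al a' ->
      Lam (ket2 dh (rtri al be al) (ket1 al be a \ob a') k) =
      ket2 dh al a (adj (ket2 ga be b) (X (ket2 dh al a' k)))) /\
    (forall xi, al xi -> exists Th : 'L(rtensor ga be, rtensor ga be),
      (forall b' k, be b' -> Th (ket2 ga be b' k) = ket2 ga be (slice2 b xi \ob b') k) /\
      (forall a k, al a ->
        Th (X (ket2 dh al a k)) =
        X (Lam (ket2 dh (rtri al be al) (V \ob (ket2 bh al xi \ob a)) k)))).

End Statement.

Lemma assoc_ket22 (H K L : hilbertType R) (be : set 'L(KK, H)) (ga de : set 'L(KK, K))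
    (ep : set 'L(KK, L)) (y : 'L(KK, L)) (z : 'L(KK, K)) h :
  compatible be ga -> compatible be (ltri de ep ga) ->
  (forall x y k, be x -> ep y ->
    assoc be ga de ep (ket2 (rtri be ga de) ep y (ket1 be ga x k)) =
    ket1 be (ltri de ep ga) x (ket2 de ep y k)) ->
  ep y -> ga z ->
  assoc be ga de ep (ket2 (rtri be ga de) ep y (ket2 be ga z h)) =
  ket2 be (ltri de ep ga) (ket2 de ep y \ob z) h.
Proof.
move=> hbg hbl hA ey gz.
apply: (bop_app (_ : assoc be ga de ep \ob ket2 (rtri be ga de) ep y \ob ket2 be ga z =
  ket2 be (ltri de ep ga) (ket2 de ep y \ob z))).
apply: (nondegenerate_eq (comp_ndl hbg)) => x bx w /=.
rewrite -ket12 // hA // -(ket12 hbl) //.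
exact: ltri_gen.
Qed.

Lemma bra2_maps (H K : hilbertType R) (be al : set 'L(KK, H)) (ga : set 'L(KK, K)) B B' y :
  commuting B B' -> smod B be -> smod B' ga -> osub al -> acts_on B' be al -> ga y ->
  maps_to (adj (ket2 be ga y)) (ltri be ga al) al.
Proof.
move=> hBB hb hg ha hact gy; apply: ospan_compl => // _ [_ [y' gy' <-] [a aa ->]].
have -> : adj (ket2 be ga y) \ob (ket2 be ga y' \ob a) = rho be (adj y \ob y') \ob a.
  by apply: bop_ext => z /=; rewrite (ket2_ket2 (smod_compatible hBB hb hg)).
by apply: hact => //; exact: (smod_star hg).
Qed.

Lemma bra1_maps (H K : hilbertType R) (be : set 'L(KK, H)) (ga de : set 'L(KK, K)) B B' x :
  commuting B B' -> smod B be -> smod B' ga -> osub de -> acts_on B ga de -> be x ->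
  maps_to (adj (ket1 be ga x)) (rtri be ga de) de.
Proof.
move=> hBB hb hg ha hact gy; apply: ospan_compl => // _ [_ [y' gy' <-] [a aa ->]].
have -> : adj (ket1 be ga x) \ob (ket1 be ga y' \ob a) = rho ga (adj x \ob y') \ob a.
  by apply: bop_ext => z /=; rewrite (ket1_ket1 (smod_compatible hBB hb hg)).
by apply: hact => //; exact: (smod_star hb).
Qed.

Lemma intertwines_smod (H H' : hilbertType R) (E : set 'L(KK, H)) (E' : set 'L(KK, H'))
    (S : 'L(H, H')) B B' T :
  commuting B B' -> smod B E -> smod B E' -> maps_to S E E' -> B' T ->
  forall h, rho E' T (S h) = S (rho E T h).
Proof.
move=> hBB hE hE' hS hT; apply: (intertwines_rho (smod_nd hE) (smod_nd hE')) => //.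
  exact: (smod_centralizes hBB hE).
exact: (smod_centralizes hBB hE').
Qed.

Lemma flip_rtri (H K : hilbertType R) (be : set 'L(KK, H)) (ga de : set 'L(KK, K)) :
  compatible be ga -> maps_to (flip be ga) (rtri be ga de) (ltri ga be de).
Proof.
move=> hbg; apply: ospan_compl => [|_ [_ [x bx <-] [d dd ->]]]; first exact: ospan_osub.
have -> : flip be ga \ob (ket1 be ga x \ob d) = ket2 ga be x \ob d.
  by apply: bop_ext => z /=; rewrite flip_ket1.
exact: ltri_gen.
Qed.

Lemma flip_ltri (H K : hilbertType R) (be al : set 'L(KK, H)) (ga : set 'L(KK, K)) :
  compatible be ga -> maps_to (flip be ga) (ltri be ga al) (rtri ga be al).
Proof.
move=> hbg; apply: ospan_compl => [|_ [_ [x bx <-] [d dd ->]]]; first exact: ospan_osub.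
have -> : flip be ga \ob (ket2 be ga x \ob d) = ket1 ga be x \ob d.
  by apply: bop_ext => z /=; rewrite flip_ket2.
exact: rtri_gen.
Qed.

Lemma bra1_ket2 (H K : hilbertType R) (be : set 'L(KK, H)) (ga : set 'L(KK, K)) x y h :
  compatible be ga -> be x -> ga y -> adj (ket1 be ga x) (ket2 be ga y h) = y (adj x h).
Proof.
move=> hbg bx gy; apply: (bop_app (_ : adj (ket1 be ga x) \ob ket2 be ga y = y \ob adj x)).
apply: (nondegenerate_eq (comp_ndl hbg)) => x' bx' z /=.
rewrite -ket12 // ket1_ket1 // (rhoE (comp_ndr hbg)) //.
by move=> u v gu gv w; rewrite -(comp_comm hbg).
Qed.

(** * Slicing the pentagon equation of a representation *)

Section FromPentagon.
Variables (H K : hilbertType R) (bh al be : set 'L(KK, H)) (ga dh : set 'L(KK, K)).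
Variables (V : 'L(rtensor bh al, rtensor al be)) (X : 'L(rtensor dh al, rtensor ga be)).
Hypotheses (hH : tri bh al be) (hK : duo ga dh) (uX : unitary X).
Hypotheses (V_al : maps_to V (ltri bh al al) (rtri al be al))
  (V_be : maps_to V (ltri bh al be) (ltri al be be)).
Hypotheses (X_ga : maps_to X (ltri dh al ga) (rtri ga be al))
  (X_be : maps_to X (rtri dh al be) (ltri ga be dh))
  (X_bh : maps_to X (rtri dh al bh) (rtri ga be bh)).
Hypothesis pent : pentagon_lhs V X = pentagon_rhs V X.

Let hbh := tri_bh hH.
Let hal := tri_al hH.
Let hbe := tri_be hH.
Let hga := duo_ga hK.
Let hdh := duo_dh hK.
Let bh_al : compatible bh al := smod_compatible c21 hbh hal.
Let al_be : compatible al be := smod_compatible c12 hal hbe.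
Let dh_al : compatible dh al := smod_compatible c21 hdh hal.
Let ga_be : compatible ga be := smod_compatible c12 hga hbe.
Let be_al : compatible be al := smod_compatible c21 hbe hal.

Let m1 : smod B1 (ltri bh al al) := ltri_smod c21 s1 hbh hal hal (act_bh_al hH).
Let m2 : smod B2 (ltri bh al be) := ltri_smod c21 s2 hbh hal hbe (act_bh_be hH).
Let m3 : smod B1 (rtri al be al) := rtri_smod c12 s1 hal hbe hal (act_be_al hH).
Let m4 : smod B2 (ltri al be be) := ltri_smod c12 s2 hal hbe hbe (act_al_be hH).
Let m5 : smod B1 (ltri be al al) := ltri_smod c21 s1 hbe hal hal (act_be_al hH).
Let m6 : smod B2 (rtri dh al bh) := rtri_smod c21 s2 hdh hal hbh (act_al_bh hH).
Let m7 : smod B2 (rtri dh al be) := rtri_smod c21 s2 hdh hal hbe (act_al_be hH).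
Let m8 : smod B1 (ltri dh al ga) := ltri_smod c21 s1 hdh hal hga (act_dh_ga hK).
Let m9 : smod B1 (rtri ga be al) := rtri_smod c12 s1 hga hbe hal (act_be_al hH).
Let m10 : smod B2 (rtri ga be bh) := rtri_smod c12 s2 hga hbe hbh (act_be_bh hH).
Let m11 : smod B2 (ltri ga be dh) := ltri_smod c12 s2 hga hbe hdh (act_ga_dh hK).

Let ga_m2 : compatible ga (ltri bh al be) := smod_compatible c12 hga m2.
Let ga_m4 : compatible ga (ltri al be be) := smod_compatible c12 hga m4.
Let dh_m1 : compatible dh (ltri bh al al) := smod_compatible c21 hdh m1.
Let dh_m3 : compatible dh (rtri al be al) := smod_compatible c21 hdh m3.
Let dh_m5 : compatible dh (ltri be al al) := smod_compatible c21 hdh m5.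
Let m6_al : compatible (rtri dh al bh) al := smod_compatible c21 m6 hal.
Let m7_al : compatible (rtri dh al be) al := smod_compatible c21 m7 hal.
Let m8_be : compatible (ltri dh al ga) be := smod_compatible c12 m8 hbe.
Let m9_be : compatible (rtri ga be al) be := smod_compatible c12 m9 hbe.
Let m10_al : compatible (rtri ga be bh) al := smod_compatible c21 m10 hal.
Let m11_al : compatible (ltri ga be dh) al := smod_compatible c21 m11 hal.

Let as1 := assoc_spec c12 c21 s2 s2 hga hbe hbh hal (act_be_bh hH) (act_bh_be hH).
Let as2 := assoc_spec c12 c12 s2 s1 hga hbe hal hbe (act_be_al hH) (act_al_be hH).
Let as3 := assoc_spec c21 c21 s1 s2 hdh hal hbh hal (act_al_bh hH) (act_bh_al hH).
Let as4 := assoc_spec c21 c21 s1 s2 hdh hal hbe hal (act_al_be hH) (act_be_al hH).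
Let fl := flip23_spec c12 c21 s1 s2 hga hbe hdh hal (act_ga_dh hK) (act_dh_ga hK).

Let tV_be x x' : ga x -> ga x' -> forall h, rho (ltri al be be) (adj x \ob x') (V h) =
    V (rho (ltri bh al be) (adj x \ob x') h).
Proof. by move=> gx gx'; apply: (intertwines_smod c21 m2 m4 V_be); exact: (smod_star hga). Qed.
Let tV_al x x' : dh x -> dh x' -> forall h, rho (rtri al be al) (adj x \ob x') (V h) =
    V (rho (ltri bh al al) (adj x \ob x') h).
Proof. by move=> gx gx'; apply: (intertwines_smod c12 m1 m3 V_al); exact: (smod_star hdh). Qed.
Let tF x x' : dh x -> dh x' -> forall h, rho (ltri be al al) (adj x \ob x') (flip al be h) =
    flip al be (rho (rtri al be al) (adj x \ob x') h).
Proof.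
move=> gx gx'; apply: (intertwines_smod c12 m3 m5 (flip_rtri al_be)).
exact: (smod_star hdh).
Qed.
Let tX_be x x' : al x -> al x' -> forall h, rho (ltri ga be dh) (adj x \ob x') (X h) =
    X (rho (rtri dh al be) (adj x \ob x') h).
Proof. by move=> gx gx'; apply: (intertwines_smod c21 m7 m11 X_be); exact: (smod_star hal). Qed.
Let tX_bh x x' : al x -> al x' -> forall h, rho (rtri ga be bh) (adj x \ob x') (X h) =
    X (rho (rtri dh al bh) (adj x \ob x') h).
Proof. by move=> gx gx'; apply: (intertwines_smod c21 m6 m10 X_bh); exact: (smod_star hal). Qed.
Let tX_ga x x' : be x -> be x' -> forall h, rho (rtri ga be al) (adj x \ob x') (X h) =
    X (rho (ltri dh al ga) (adj x \ob x') h).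
Proof. by move=> gx gx'; apply: (intertwines_smod c12 m8 m9 X_ga); exact: (smod_star hbe). Qed.

(** X_13 does not see the second leg and X_12 does not see the third, so <b|_3 X_12 X_13 |a>_2
    |a'>_3 = X |a>_2 <b|_2 X |a'>_2. Hence [Lam] is this slice multiplied by X^* from the left. The
    formula for [Th] X is the pentagon equation itself. *)
Lemma sliced_of_pentagon : sliced_pentagon V X.
Proof.
move=> b bb; have [X1 X2] := (unitaryP X).1 uX.
pose W := adj (ket2 (rtri ga be al) be b) \ob tensl (ltri dh al ga) be (rtri ga be al) X \ob
  leg13 X.
exists (adj X \ob W); split.
  move=> a a' k aa aa'; rewrite /= /leg13 /=.
  have ea := rtri_gen be aa aa'.
  have fa := flip_rtri al_be ea.
  rewrite (tensr_ket2 dh_m3 dh_m5 tF) //.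
  have -> : flip al be \ob (ket1 al be a \ob a') = ket2 be al a \ob a'.
    by apply: bop_ext => z /=; rewrite flip_ket1.
  rewrite -(assoc_ket22 k dh_al dh_m5 as4.1) // ((unitaryP _).1 as4.2).1.
  rewrite (tenslE m7_al m11_al tX_be) //.
  (* X |a'>_2 k enters only as a vector of the tensor product of K and H over ga and be, so the
     identity may be tested on the vectors |b'>_2 k instead. *)
  move: (X _) => w; apply: (bop_app (_ : adj X \ob (adj (ket2 (rtri ga be al) be b) \ob
    tensl (ltri dh al ga) be (rtri ga be al) X \ob flip23 ga dh be al \ob
    ket2 (ltri ga be dh) al a) = ket2 dh al a \ob adj (ket2 ga be b))).
  apply: (eq_on_ket2 ga_be) => b' bb' {}k /=.
  rewrite fl.1 // (tenslE m8_be m9_be tX_ga) // (ket2_ket2 m9_be) // tX_ga // X1.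
  rewrite (ket2_ket2 ga_be) // (rho_ltri c21 s1 hdh hal k hga (act_dh_ga hK)) //.
    by apply: smod_centralizes c12 hga _; exact: (smod_star hbe).
  by apply: smod_centralizes c12 m8 _; exact: (smod_star hbe).
move=> xi axi; have [A2 A2'] := (unitaryP _).1 as2.2.
have hVx b' : be b' -> ltri al be be (V \ob (ket2 bh al xi \ob b')).
  by move=> bb'; apply: V_be; exact: ltri_gen.
have hsl b' : be b' -> be (slice2 V b xi \ob b').
  move=> bb'; have -> : slice2 V b xi \ob b' =
      adj (ket2 al be b) \ob (V \ob (ket2 bh al xi \ob b')) by exact: bop_ext.
  by apply: (bra2_maps c12 hal hbe (smod_sub hbe) (act_al_be hH) bb); exact: hVx.
(* This is <b|_3 V_23 |xi>_3. *)
exists (adj (ket2 (rtri ga be al) be b) \ob adj (assoc ga be al be) \ob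
  tensr ga (ltri bh al be) (ltri al be be) V \ob assoc ga be bh al \ob
  ket2 (rtri ga be bh) al xi); split.
  move=> b' k bb' /=; have gb' := ltri_gen bh axi bb'.
  rewrite (assoc_ket22 _ ga_be ga_m2 as1.1) // (tensr_ket2 ga_m2 ga_m4 tV_be) //; last exact: hVx.
  apply: (inner_eq_ket1 ga_be) => c gc h.
  rewrite -!adj_inner as2.1 // adj_inner (bra1_ket2 _ ga_m4 gc) //; last exact: hVx.
  by rewrite [RHS]adj_inner (bra1_ket2 _ ga_be gc) /= ?adj_inner //; exact: hsl.
move=> a k aa /=.
have ga' := ltri_gen bh axi aa.
rewrite -(tenslE m6_al m10_al tX_bh) //.
have := bop_app pent (ket2 (rtri dh al bh) al xi (ket2 dh al a k)).
rewrite /pentagon_lhs /pentagon_rhs /= => ->.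
rewrite (assoc_ket22 _ dh_al dh_m1 as3.1) // (tensr_ket2 dh_m1 dh_m3 tV_al) ?X2 //.
exact: V_al.
Qed.

End FromPentagon.

(** * The opposite unitary and its sliced pentagon equation *)

Lemma assoc_ket11 (H K L : hilbertType R) (be : set 'L(KK, H)) (ga de : set 'L(KK, K))
    (ep : set 'L(KK, L)) x d l :
  compatible (rtri be ga de) ep -> compatible de ep ->
  (forall x y k, be x -> ep y ->
    assoc be ga de ep (ket2 (rtri be ga de) ep y (ket1 be ga x k)) =
    ket1 be (ltri de ep ga) x (ket2 de ep y k)) ->
  be x -> de d ->
  assoc be ga de ep (ket1 (rtri be ga de) ep (ket1 be ga x \ob d) l) =
  ket1 be (ltri de ep ga) x (ket1 de ep d l).
Proof.
move=> hre hde hA bx dd.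
apply: (bop_app (_ : assoc be ga de ep \ob ket1 (rtri be ga de) ep (ket1 be ga x \ob d) =
  ket1 be (ltri de ep ga) x \ob ket1 de ep d)).
apply: (nondegenerate_eq (comp_ndr hre)) => y ey w /=.
rewrite (ket12 hre) //; last exact: rtri_gen.
by rewrite hA // ket12.
Qed.

Lemma flip23_ket21 (H K L : hilbertType R) (be de : set 'L(KK, H)) (ga : set 'L(KK, K))
    (ep : set 'L(KK, L)) x y k :
  compatible be ga -> compatible (ltri de ep be) ga ->
  (forall x y k, ga x -> ep y ->
    flip23 be de ga ep (ket2 (ltri be ga de) ep y (ket2 be ga x k)) =
    ket2 (ltri de ep be) ga x (ket2 de ep y k)) ->
  be x -> ep y ->
  flip23 be de ga ep (ket2 (ltri be ga de) ep y (ket1 be ga x k)) =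
  ket1 (ltri de ep be) ga (ket2 de ep y \ob x) k.
Proof.
move=> hbg hlg hA bx ey.
apply: (bop_app (_ : flip23 be de ga ep \ob ket2 (ltri be ga de) ep y \ob ket1 be ga x =
  ket1 (ltri de ep be) ga (ket2 de ep y \ob x))).
apply: (nondegenerate_eq (comp_ndr hbg)) => z gz w /=.
by rewrite ket12 // hA // (ket12 hlg) //; exact: ltri_gen.
Qed.

Lemma tensl_ket1 (H H' K : hilbertType R) (be : set 'L(KK, H)) (be' : set 'L(KK, H'))
    (ga : set 'L(KK, K)) (S : 'L(H, H')) x k :
  compatible be ga -> compatible be' ga ->
  (forall y y', ga y -> ga y' -> forall h,
    rho be' (adj y \ob y') (S h) = S (rho be (adj y \ob y') h)) ->
  be x -> be' (S \ob x) ->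
  tensl be ga be' S (ket1 be ga x k) = ket1 be' ga (S \ob x) k.
Proof.
move=> hbg hbg' hS bx bx'.
apply: (bop_app (_ : tensl be ga be' S \ob ket1 be ga x = ket1 be' ga (S \ob x))).
apply: (nondegenerate_eq (comp_ndr hbg)) => z gz w /=.
by rewrite ket12 // tenslE // (ket12 hbg').
Qed.

Lemma unitary_adj (H K : hilbertType R) (U : 'L(H, K)) x y :
  unitary U -> U x = y -> adj U y = x.
Proof. by move=> /unitaryP [h _] <-. Qed.

Lemma maps_oimage (H K : hilbertType R) (U : 'L(H, K)) E F :
  oimage U E = F -> maps_to U E F.
Proof. by move=> <- x Ex; exists x. Qed.

Lemma adj_maps_oimage (H K : hilbertType R) (U : 'L(H, K)) E F :
  unitary U -> oimage U E = F -> maps_to (adj U) F E.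
Proof.
move=> /unitaryP [h _] <- _ [x Ex <-]; suff -> : adj U \ob (U \ob x) = x by [].
by apply: bop_ext => z /=; rewrite h.
Qed.

(* With bh and be exchanged, this is the opposite of V. *)
Definition oppu (H : hilbertType R) (bh al be : set 'L(KK, H))
    (V : 'L(rtensor bh al, rtensor al be)) : 'L(rtensor be al, rtensor al bh) :=
  flip bh al \ob adj V \ob flip be al.

Section Opposite.
Variables (H : hilbertType R) (bh al be : set 'L(KK, H)).
Variables (V : 'L(rtensor bh al, rtensor al be)).
Hypotheses (hH : tri bh al be) (uV : unitary V).
Hypotheses (V_al : oimage V (ltri bh al al) = rtri al be al)
  (V_be : oimage V (ltri bh al be) = ltri al be be)
  (V_bh : oimage V (rtri bh al bh) = rtri al be bh)
  (V_bh_be : oimage V (rtri bh al be) = ltri al be bh).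
Hypothesis pent : pentagon_lhs V V = pentagon_rhs V V.

Let V1 := (unitaryP V).1 uV.
Let hbh := tri_bh hH.
Let hal := tri_al hH.
Let hbe := tri_be hH.
Let bh_al : compatible bh al := smod_compatible c21 hbh hal.
Let al_bh : compatible al bh := smod_compatible c12 hal hbh.
Let al_be : compatible al be := smod_compatible c12 hal hbe.
Let be_al : compatible be al := smod_compatible c21 hbe hal.

Let m1 : smod B1 (ltri bh al al) := ltri_smod c21 s1 hbh hal hal (act_bh_al hH).
Let m2 : smod B2 (ltri bh al be) := ltri_smod c21 s2 hbh hal hbe (act_bh_be hH).
Let m3 : smod B1 (rtri al be al) := rtri_smod c12 s1 hal hbe hal (act_be_al hH).
Let m3' : smod B1 (rtri al bh al) := rtri_smod c12 s1 hal hbh hal (act_bh_al hH).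
Let m4 : smod B2 (ltri al be be) := ltri_smod c12 s2 hal hbe hbe (act_al_be hH).
Let m5 : smod B1 (ltri be al al) := ltri_smod c21 s1 hbe hal hal (act_be_al hH).
Let m6 : smod B2 (rtri bh al bh) := rtri_smod c21 s2 hbh hal hbh (act_al_bh hH).
Let m7 : smod B2 (rtri bh al be) := rtri_smod c21 s2 hbh hal hbe (act_al_be hH).
Let m10 : smod B2 (rtri al be bh) := rtri_smod c12 s2 hal hbe hbh (act_be_bh hH).
Let m11 : smod B2 (ltri al be bh) := ltri_smod c12 s2 hal hbe hbh (act_al_bh hH).

Let al_m2 : compatible al (ltri bh al be) := smod_compatible c12 hal m2.
Let al_m4 : compatible al (ltri al be be) := smod_compatible c12 hal m4.
Let bh_m1 : compatible bh (ltri bh al al) := smod_compatible c21 hbh m1.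
Let bh_m3 : compatible bh (rtri al be al) := smod_compatible c21 hbh m3.
Let bh_m5 : compatible bh (ltri be al al) := smod_compatible c21 hbh m5.
Let m6_al : compatible (rtri bh al bh) al := smod_compatible c21 m6 hal.
Let m7_al : compatible (rtri bh al be) al := smod_compatible c21 m7 hal.
Let m1_be : compatible (ltri bh al al) be := smod_compatible c12 m1 hbe.
Let be_m1 : compatible be (ltri bh al al) := smod_compatible c21 hbe m1.
Let be_m3' : compatible be (rtri al bh al) := smod_compatible c21 hbe m3'.
Let m3_be : compatible (rtri al be al) be := smod_compatible c12 m3 hbe.
Let m10_al : compatible (rtri al be bh) al := smod_compatible c21 m10 hal.
Let m11_al : compatible (ltri al be bh) al := smod_compatible c21 m11 hal.

Let as1 := assoc_spec c12 c21 s2 s2 hal hbe hbh hal (act_be_bh hH) (act_bh_be hH).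
Let as2 := assoc_spec c12 c12 s2 s1 hal hbe hal hbe (act_be_al hH) (act_al_be hH).
Let as3 := assoc_spec c21 c21 s1 s2 hbh hal hbh hal (act_al_bh hH) (act_bh_al hH).
Let as4 := assoc_spec c21 c21 s1 s2 hbh hal hbe hal (act_al_be hH) (act_be_al hH).
Let fl := flip23_spec c12 c21 s1 s2 hal hbe hbh hal (act_al_bh hH) (act_bh_al hH).

Let iw1 T : B2 T -> forall h, rho (rtri al be al) T (V h) = V (rho (ltri bh al al) T h).
Proof. exact: (intertwines_smod c12 m1 m3 (maps_oimage V_al)). Qed.
Let iw2 T : B1 T -> forall h, rho (ltri al be be) T (V h) = V (rho (ltri bh al be) T h).
Proof. exact: (intertwines_smod c21 m2 m4 (maps_oimage V_be)). Qed.
Let iw3 T : B1 T -> forall h, rho (rtri al be bh) T (V h) = V (rho (rtri bh al bh) T h).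
Proof. exact: (intertwines_smod c21 m6 m10 (maps_oimage V_bh)). Qed.
Let iw4 T : B1 T -> forall h, rho (ltri al be bh) T (V h) = V (rho (rtri bh al be) T h).
Proof. exact: (intertwines_smod c21 m7 m11 (maps_oimage V_bh_be)). Qed.
Let iw5 T : B2 T -> forall h, rho (ltri be al al) T (flip al be h) =
  flip al be (rho (rtri al be al) T h).
Proof. exact: (intertwines_smod c12 m3 m5 (flip_rtri al_be)). Qed.
Let iw6 T : B2 T -> forall h, rho (ltri bh al al) T (flip al bh h) =
  flip al bh (rho (rtri al bh al) T h).
Proof. exact: (intertwines_smod c12 m3' m1 (flip_rtri al_bh)). Qed.

Let tensr_V h x : bh x -> adj (tensr bh (ltri bh al al) (rtri al be al) V)
  (ket1 bh (rtri al be al) x h) = ket1 bh (ltri bh al al) x (adj V h).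
Proof.
have sp x1 x2 (h1 : bh x1) (h2 : bh x2) := iw1 (smod_star hbh h1 h2).
move=> bx; apply: unitary_adj; first exact: (tensr_unitary bh_m1 bh_m3 uV sp).
by rewrite (tensrE bh_m1 bh_m3 sp) // V1.2.
Qed.

Let tensr_V' h x : al x -> adj (tensr al (ltri bh al be) (ltri al be be) V)
  (ket1 al (ltri al be be) x h) = ket1 al (ltri bh al be) x (adj V h).
Proof.
have sp x1 x2 (h1 : al x1) (h2 : al x2) := iw2 (smod_star hal h1 h2).
move=> bx; apply: unitary_adj; first exact: (tensr_unitary al_m2 al_m4 uV sp).
by rewrite (tensrE al_m2 al_m4 sp) // V1.2.
Qed.

Let tensr_F h x : bh x -> adj (tensr bh (rtri al be al) (ltri be al al) (flip al be))
  (ket1 bh (ltri be al al) x h) = ket1 bh (rtri al be al) x (flip be al h).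
Proof.
have sp x1 x2 (h1 : bh x1) (h2 : bh x2) := iw5 (smod_star hbh h1 h2).
have uF : unitary (flip al be) by apply/unitaryP; split=> u; rewrite flip_adj ?flipK.
move=> bx; apply: unitary_adj; first exact: (tensr_unitary bh_m3 bh_m5 uF sp).
by rewrite (tensrE bh_m3 bh_m5 sp) // flipK.
Qed.

Let tensl_V h y : al y -> adj (tensl (rtri bh al bh) al (rtri al be bh) V)
  (ket2 (rtri al be bh) al y h) = ket2 (rtri bh al bh) al y (adj V h).
Proof.
have sp x1 x2 (h1 : al x1) (h2 : al x2) := iw3 (smod_star hal h1 h2).
move=> bx; apply: unitary_adj; first exact: (tensl_unitary m6_al m10_al uV sp).
by rewrite (tenslE m6_al m10_al sp) // V1.2.
Qed.

Let tensl_V' h y : al y -> adj (tensl (rtri bh al be) al (ltri al be bh) V)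
  (ket2 (ltri al be bh) al y h) = ket2 (rtri bh al be) al y (adj V h).
Proof.
have sp x1 x2 (h1 : al x1) (h2 : al x2) := iw4 (smod_star hal h1 h2).
move=> bx; apply: unitary_adj; first exact: (tensl_unitary m7_al m11_al uV sp).
by rewrite (tenslE m7_al m11_al sp) // V1.2.
Qed.

Let tensl_V1 h z : rtri al be al z -> adj (tensl (ltri bh al al) be (rtri al be al) V)
  (ket1 (rtri al be al) be z h) = ket1 (ltri bh al al) be (adj V \ob z) h.
Proof.
have sp x1 x2 (h1 : be x1) (h2 : be x2) := iw1 (smod_star hbe h1 h2).
move=> bx; apply: unitary_adj; first exact: (tensl_unitary m1_be m3_be uV sp).
have e : V \ob (adj V \ob z) = z by apply: bop_ext => w /=; rewrite V1.2.
by rewrite (tensl_ket1 h m1_be m3_be sp) ?e //; exact: (adj_maps_oimage uV V_al).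
Qed.

(* The adjoint of the pentagon equation, contracted with |xi>_1 and |a>_2 on the right
   and with <c|_1 on the left. *)
Lemma sliced_op : sliced_pentagon (oppu V) (oppu V).
Proof.
move=> c bc.
have bra_c u : adj (ket2 al bh c) (flip bh al u) = adj (ket1 bh al c) u.
  rewrite -(flip_adj al_bh) -[LHS]/((adj _ \ob adj _) u) -adj_comp.
  congr (adj _ _); apply: bop_ext => h /=; exact: flip_ket2.
(* N is <c|_1 V_23^* V_13^*. V_13^* does not see the second leg a, and V_23^* does not see <c|_1,
   whence the first formula. In the second one, V_12^* completes the adjoint of the right-hand side
   of the pentagon equation. *)
have [N N1 N2] : exists2 N : 'L(rtensor (ltri bh al al) be, rtensor bh al),
    (forall a a' k, al a -> al a' -> N (ket1 (ltri bh al al) be (ket2 bh al a \ob a') k) =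
      adj V (ket1 al be a (adj (ket1 bh al c) (adj V (ket1 al be a' k))))) &
    (forall z k, rtri al be al z -> N (ket1 (ltri bh al al) be (adj V \ob z) k) =
      adj (ket1 bh (ltri bh al al) c) (assoc bh al bh al
        (adj (pentagon_rhs V V) (ket1 (rtri al be al) be z k)))).
  exists (adj (ket1 bh (ltri bh al al) c) \ob
    adj (tensr bh (ltri bh al al) (rtri al be al) V) \ob
    adj (tensr bh (rtri al be al) (ltri be al al) (flip al be)) \ob assoc bh al be al \ob
    adj (tensl (rtri bh al be) al (ltri al be bh) V) \ob adj (flip23 al bh be al)); last first.
    move=> z k rz; rewrite /pentagon_rhs /leg13 !adj_comp adjK /= ((unitaryP _).1 as3.2).2.
    by rewrite tensl_V1.
move=> a a' k aa aa' /=.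
  rewrite (unitary_adj fl.2 (flip23_ket21 k al_be m1_be fl.1 aa' aa)) tensl_V' //.
  move: (adj V _) => v; apply: (bop_app (_ : adj (ket1 bh (ltri bh al al) c) \ob
    adj (tensr bh (ltri bh al al) (rtri al be al) V) \ob
    adj (tensr bh (rtri al be al) (ltri be al al) (flip al be)) \ob assoc bh al be al \ob
    ket2 (rtri bh al be) al a = adj V \ob ket1 al be a \ob adj (ket1 bh al c))).
  apply: (eq_on_ket1 bh_al) => x bx {}k /=.
  rewrite as4.1 // tensr_F // tensr_V // flip_ket2 // (ket1_ket1 bh_m1) //.
  rewrite (ket1_ket1 bh_al) //.
  apply: esym; apply: unitary_adj uV _; rewrite -iw1 ?V1.2; last exact: (smod_star hbh).
  rewrite (rho_rtri c12 s1 hal hbe k hal (act_be_al hH)) //.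
    by apply: smod_centralizes c12 hal _; exact: (smod_star hbh).
  by apply: smod_centralizes c12 m3 _; exact: (smod_star hbh).
have spF x1 x2 (h1 : be x1) (h2 : be x2) := iw6 (smod_star hbe h1 h2).
(* The flips reverse the order of the three legs, and V cancels the V^* which [N] produces. *)
exists (flip al be \ob V \ob N \ob flip be (ltri bh al al) \ob
  tensr be (rtri al bh al) (ltri bh al al) (flip al bh)); split.
  move=> a a' k aa aa' /=; have ea := rtri_gen bh aa aa'.
  have fa := flip_rtri al_bh ea.
  rewrite (tensr_ket2 be_m3' be_m1 spF) // flip_ket2 //.
  have -> : flip al bh \ob (ket1 al bh a \ob a') = ket2 bh al a \ob a'.
    by apply: bop_ext => z /=; rewrite flip_ket1.
  by rewrite N1 // V1.2 flip_ket1 // bra_c flip_ket2.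
move=> xi axi.
pose s := adj (ket1 bh al c) \ob adj V \ob ket1 al be xi.
have sE : slice2 (oppu V) c xi = s.
  by apply: bop_ext => h; rewrite /slice2 /oppu /= flip_ket2 // bra_c.
rewrite sE.
(* This [Th] is <c|_1 V_12^* |xi>_1. Since V_23^* |xi>_1 = |xi>_1 V^*, its product with V^* is a
   slice of the adjoint of V_23 V_12. *)
have [Th Th2 Th3] : exists2 Th : 'L(rtensor bh al, rtensor bh al),
    (forall y k, al y -> Th (ket2 bh al y k) = ket2 bh al y (s k)) &
    (forall a k, al a -> Th (adj V (ket1 al be a k)) =
      adj (ket1 bh (ltri bh al al) c) (assoc bh al bh al
        (adj (pentagon_lhs V V) (ket1 (rtri al be al) be (ket1 al be xi \ob a) k)))).
  exists (adj (ket1 bh (ltri bh al al) c) \ob assoc bh al bh al \ob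
    adj (tensl (rtri bh al bh) al (rtri al be bh) V) \ob adj (assoc al be bh al) \ob
    ket1 al (ltri bh al be) xi); last first.
    move=> a k aa; rewrite /pentagon_lhs !adj_comp adjK /=.
    by rewrite (assoc_ket11 k m3_be al_be as2.1) // tensr_V'.
  move=> y k ay; rewrite /= (unitary_adj as1.2 (as1.1 _ _ _ axi ay)) tensl_V //.
  rewrite /s /=; move: (adj V _) => v.
  apply: (bop_app (_ : adj (ket1 bh (ltri bh al al) c) \ob assoc bh al bh al \ob
    ket2 (rtri bh al bh) al y = ket2 bh al y \ob adj (ket1 bh al c))).
  apply: (eq_on_ket1 bh_al) => x bx {}k /=.
  rewrite as3.1 // (ket1_ket1 bh_m1) // (ket1_ket1 bh_al) //.
  rewrite (rho_ltri c21 s1 hbh hal k hal (act_bh_al hH)) //.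
    by apply: smod_centralizes c12 hal _; exact: (smod_star hbh).
  by apply: smod_centralizes c12 m1 _; exact: (smod_star hbh).
have hs b : bh b -> bh (s \ob b).
  move=> bb; have -> : s \ob b = adj (ket1 bh al c) \ob (adj V \ob (ket1 al be xi \ob b)).
    exact: bop_ext.
  apply: (bra1_maps c21 hbh hal (smod_sub hbh) (act_al_bh hH) bc).
  by apply: (adj_maps_oimage uV V_bh); exact: rtri_gen.
exists (flip bh al \ob Th \ob flip al bh); split.
  move=> b k bb; rewrite /= flip_ket2 //.
  suff -> : Th (ket1 bh al b k) = ket1 bh al (s \ob b) k.
    by rewrite flip_ket1 //; exact: hs.
  apply: (bop_app (_ : Th \ob ket1 bh al b = ket1 bh al (s \ob b))).
  apply: (nondegenerate_eq (comp_ndr bh_al)) => y ay z.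
  rewrite -[LHS]/(Th (ket1 bh al b (y z))) ket12 // Th2 // -[RHS]/(ket1 _ _ _ (y z)).
  by rewrite (ket12 bh_al) //; exact: hs.
move=> a k aa.
have za := rtri_gen be axi aa; have wa := adj_maps_oimage uV V_al za.
have e2 : oppu V \ob (ket2 be al xi \ob a) =
    flip bh al \ob (adj V \ob (ket1 al be xi \ob a)).
  by apply: bop_ext => z; rewrite /oppu /= flip_ket2.
have e3 : flip al bh \ob (flip bh al \ob (adj V \ob (ket1 al be xi \ob a))) =
    adj V \ob (ket1 al be xi \ob a) by apply: bop_ext => z; rewrite /= flipK.
rewrite e2; have ra := flip_ltri bh_al wa.
rewrite /= (tensr_ket2 be_m3' be_m1 spF) ?e3 //.
rewrite (flip_ket2 _ be_m1) // /oppu /= flip_ket2 // flipK // flipK // V1.1; congr (flip _ _ _).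
by rewrite Th3 // N2 // pent.
Qed.

End Opposite.
End Core.

(** * The algebra of a representation *)

Section SlicedAlgebra.
Context {R : realType} {KK : hilbertType R}.
Variables (B1 B2 : set 'L(KK, KK)).
Hypotheses (c12 : commuting B1 B2) (s1 : osub B1) (s2 : osub B2).
Let c21 : commuting B2 B1 := commutingC c12.
Variables (H K : hilbertType R) (bh al be : set 'L(KK, H)) (ga dh : set 'L(KK, K)).
Variables (V : 'L(rtensor bh al, rtensor al be)) (X : 'L(rtensor dh al, rtensor ga be)).
Hypotheses (hH : tri B1 B2 bh al be) (hK : duo B1 B2 ga dh).
Hypotheses (uX : unitary X) (uV : unitary V).
Hypotheses (V_al : oimage V (ltri bh al al) = rtri al be al)
  (V_be : oimage V (ltri bh al be) = ltri al be be).
Hypothesis (X_be : oimage X (rtri dh al be) = ltri ga be dh).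
Hypothesis sliced : sliced_pentagon V X.
Hypotheses (al_right : forall a T, al a -> B1 T -> al (a \ob T))
  (be_right : forall b T, be b -> B2 T -> be (b \ob T)).
Hypotheses (star1 : forall T, B1 T -> B1 (adj T)) (star2 : forall T, B2 T -> B2 (adj T)).
Hypothesis full : B2 `<=` ospan (oprod (oadj be) be).
Hypothesis rho_be : be `<=` ospan (oprod (rho al @` B2) be).
Hypothesis C_star : cpmu V = oadj (cpmu V).

Let hbh := tri_bh hH.
Let hal := tri_al hH.
Let hbe := tri_be hH.
Let hga := duo_ga hK.
Let hdh := duo_dh hK.
Let bh_al : compatible bh al := smod_compatible c21 hbh hal.
Let al_be : compatible al be := smod_compatible c12 hal hbe.
Let dh_al : compatible dh al := smod_compatible c21 hdh hal.
Let ga_be : compatible ga be := smod_compatible c12 hga hbe.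
Let m3 : smod B1 (rtri al be al) := rtri_smod c12 s1 hal hbe hal (act_be_al hH).
Let dh_m3 : compatible dh (rtri al be al) := smod_compatible c21 hdh m3.
Let m7 : smod B2 (rtri dh al be) := rtri_smod c21 s2 hdh hal hbe (act_al_be hH).
Let m11 : smod B2 (ltri ga be dh) := ltri_smod c12 s2 hga hbe hdh (act_ga_dh hK).

Let V1 := (unitaryP V).1 uV.
Let X1 := (unitaryP X).1 uX.
Let A : set 'L(K, K) := ahat X.
Let gen b a : 'L(K, K) := adj (ket2 ga be b) \ob (X \ob ket2 dh al a).

Let A_sub : osub A. Proof. exact: ospan_osub. Qed.

Let gen_in b a : be b -> al a -> A (gen b a).
Proof.
move=> bb aa; apply: sub_ospan; exists (adj (ket2 ga be b)).
  by exists (ket2 ga be b) => //; exists b.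
by exists (X \ob ket2 dh al a) => //; exists (ket2 dh al a) => //; exists a.
Qed.

Let A_ind (Z : set 'L(K, K)) : osub Z -> (forall b a, be b -> al a -> Z (gen b a)) ->
  forall T, A T -> Z T.
Proof.
move=> hZ h; apply: ospan_min => // _ [_ [_ [b bb <-] <-] [_ [_ [a aa <-] <-] ->]].
exact: h.
Qed.

Let slice_be b xi b' : be b -> al xi -> be b' -> be (slice2 V b xi \ob b').
Proof.
move=> bb axi bb'; have -> : slice2 V b xi \ob b' =
    adj (ket2 al be b) \ob (V \ob (ket2 bh al xi \ob b')) by exact: bop_ext.
apply: (bra2_maps c12 hal hbe (smod_sub hbe) (act_al_be hH) bb).
by apply: (maps_oimage V_be); exact: ltri_gen.
Qed.

Let slice_adj_be b xi b' : be b -> al xi -> be b' -> be (adj (slice2 V b xi) \ob b').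
Proof.
move=> bb axi bb'; have -> : adj (slice2 V b xi) \ob b' =
    adj (ket2 bh al xi) \ob (adj V \ob (ket2 al be b \ob b')).
  by rewrite /slice2 !adj_comp adjK; exact: bop_ext.
apply: (bra2_maps c21 hbh hal (smod_sub hbe) (act_bh_be hH) axi).
by apply: (adj_maps_oimage uV V_be); exact: ltri_gen.
Qed.

(** The ket of y is linear in y only within al |> al, so the passage to the closed span has to take
    place inside this module. *)
Let ospan_ket2 (K' : hilbertType R) (Y : set 'L(KK, rtensor al be))
    (L : 'L(rtensor dh (rtri al be al), K')) (Z : set 'L(K, K')) :
  osub Z -> Y `<=` rtri al be al -> (forall y, Y y -> Z (L \ob ket2 dh (rtri al be al) y)) ->
  forall y, ospan Y y -> Z (L \ob ket2 dh (rtri al be al) y).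
Proof.
move=> hZ hY h; have [M M0 bM] := op_le_exists L.
apply: (@ospan_map_in _ _ _ _ _ (rtri al be al) Y Z _ id M (smod_sub m3)) => //.
- move=> a S T hS hT; rewrite (ket2ZD dh_m3) ?bcompZDr //.
  exact: (csubZD (smod_sub m3)).
- by move=> e T hT eT; apply: op_le_comp => //; exact: (ket2_bound dh_m3).
Qed.

(* The product is the value at z = |a1>_1 a2 of z |-> <b1|_2 X Lam |z>_2, and this z
   lies in V (al <| al), where the second half of [sliced] applies. *)
Let gen_gen b1 a1 b2 a2 : be b1 -> al a1 -> be b2 -> al a2 -> A (gen b1 a1 \ob gen b2 a2).
Proof.
move=> bb1 aa1 bb2 aa2; have [Lam [L1 L2]] := sliced bb2.
have -> : gen b1 a1 \ob gen b2 a2 =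
    (adj (ket2 ga be b1) \ob X \ob Lam) \ob ket2 dh (rtri al be al) (ket1 al be a1 \ob a2).
  by apply: bop_ext => k /=; rewrite L1.
have [y hy <-] : oimage V (ltri bh al al) (ket1 al be a1 \ob a2).
  by rewrite V_al; exact: rtri_gen.
have {hy} : ospan (oimage V (oprod (kets2 bh al al) al)) (V \ob y).
  by apply: ospan_compl hy => [|T hT]; [exact: ospan_osub|apply: sub_ospan; exists T].
move: (V \ob y) => z; apply: ospan_ket2 => //.
  move=> _ [_ [_ [xi axi <-] [a aa ->]] <-].
  by apply: (maps_oimage V_al); exact: ltri_gen.
move=> _ [_ [_ [xi axi <-] [a aa ->]] <-]; have [Th [T1 T2]] := L2 xi axi.
(* [Th] is 1 (x) T for the slice T = <b2|_2 V |xi>_2, so that <b1|_2 [Th] is the bra of T^* b1, and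
   the product becomes a single slice. *)
suff -> : adj (ket2 ga be b1) \ob X \ob Lam \ob
    ket2 dh (rtri al be al) (V \ob (ket2 bh al xi \ob a)) =
    gen (adj (slice2 V b2 xi) \ob b1) a by apply: gen_in => //; exact: slice_adj_be.
apply: bop_ext => k /=; rewrite -T2 //; move: (X _) => w.
apply: (bop_app (_ : adj (ket2 ga be b1) \ob Th = adj (ket2 ga be (adj (slice2 V b2 xi) \ob b1)))).
apply: (eq_on_ket2 ga_be) => b' bb' {}k /=.
rewrite T1 // (ket2_ket2 ga_be k bb1 (slice_be bb2 axi bb')).
rewrite (ket2_ket2 ga_be k (slice_adj_be bb2 axi bb1) bb') adj_comp adjK.
by congr (rho ga _ k); exact: bop_ext.
Qed.

Lemma sliced_prod : oprod A A `<=` A.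
Proof.
move=> _ [S AS [T AT ->]]; move: S AS; apply: ospan_compr => //.
move=> _ [_ [_ [b bb <-] <-] [_ [_ [a aa <-] <-] ->]].
apply: (ospan_compl A_sub _ AT) => _ [_ [_ [b' bb' <-] <-] [_ [_ [a' aa' <-] <-] ->]].
exact: gen_gen.
Qed.

Let C_gen eta xi : al eta -> al xi ->
  cpmu V (adj (ket1 al be eta) \ob (V \ob ket2 bh al xi)).
Proof.
move=> aeta axi; apply: sub_ospan; exists (adj (ket1 al be eta)).
  by exists (ket1 al be eta) => //; exists eta.
by exists (V \ob ket2 bh al xi) => //; exists (ket2 bh al xi) => //; exists xi.
Qed.

(** For c = <eta|_1 V |xi>_2, the product c a lies in <eta|_1 V (al <| al) = <eta|_1 (al |> al),
    hence in al. Therefore C_V commutes with the representation attached to al, and 1 (x) c makes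
    sense for c in C_V. *)
Let C_al c : cpmu V c -> forall a, al a -> al (c \ob a).
Proof.
move=> hc a aa; move: c hc; apply: ospan_compr; first exact: (smod_sub hal).
move=> _ [_ [_ [eta aeta <-] <-] [_ [_ [xi axi <-] <-] ->]].
have -> : adj (ket1 al be eta) \ob (V \ob ket2 bh al xi) \ob a =
  adj (ket1 al be eta) \ob (V \ob (ket2 bh al xi \ob a)) by exact: bop_ext.
apply: (bra1_maps c12 hal hbe (smod_sub hal) (act_be_al hH) aeta).
by apply: (maps_oimage V_al); exact: ltri_gen.
Qed.

Let C_rho c : cpmu V c -> forall x x', dh x -> dh x' -> forall h,
  rho al (adj x \ob x') (c h) = c (rho al (adj x \ob x') h).
Proof.
move=> hc x x' dx dx'; apply: (intertwines_smod c12 hal hal (C_al hc)).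
exact: (smod_star hdh).
Qed.

Let Om c : 'L(rtensor dh al, rtensor dh al) := tensr dh al al c.

(** As C_V is self-adjoint, 1 (x) c and 1 (x) c^* both make sense. *)
Let Om_adj c : cpmu V c -> adj (Om c) = Om (adj c).
Proof.
move=> hc; have hc' : cpmu V (adj c) by rewrite C_star; exists c.
apply: (eq_on_ket1 dh_al) => x dx k; apply: (inner_eq_ket1 dh_al) => x' dx' k'.
rewrite -adj_inner !(tensrE dh_al dh_al) //; try exact: C_rho.
by rewrite !adj_inner !(ket1_ket1 dh_al) // C_rho.
Qed.

Let D b' c b : 'L(K, K) := adj (ket2 ga be b') \ob X \ob Om c \ob adj X \ob ket2 ga be b.

Let D_adj b' c b : cpmu V c -> adj (D b' c b) = D b (adj c) b'.
Proof.
move=> hc; rewrite /D !adj_comp !adjK Om_adj //; exact: bop_ext.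
Qed.

(** The vectors |d>_1 |a>_1 a' z are total, and each is the vector of the hypothesis with k = d
    z. *)
Let eq_on_ket21 (L : hilbertType R) (S T : 'L(rtensor dh (rtri al be al), L)) :
  (forall a a' k, al a -> al a' -> S (ket2 dh (rtri al be al) (ket1 al be a \ob a') k) =
    T (ket2 dh (rtri al be al) (ket1 al be a \ob a') k)) -> S = T.
Proof.
move=> h; apply: (eq_on_ket1 dh_m3) => d dd.
apply: (bop_app (_ : S \ob ket1 dh (rtri al be al) d = T \ob ket1 dh (rtri al be al) d)).
apply: (eq_on_ket1 al_be) => a aa.
apply: (bop_app (_ : S \ob ket1 dh (rtri al be al) d \ob ket1 al be a =
  T \ob ket1 dh (rtri al be al) d \ob ket1 al be a)).
apply: (nondegenerate_eq (smod_nd hal)) => a' aa' z.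
have e := ket12 dh_m3 z dd (rtri_gen be aa aa').
have := h a a' (d z) aa aa'; by rewrite -e.
Qed.

Let rho_ket2 T a k : B1 T -> al a ->
  rho (rtri dh al be) T (ket2 dh al a k) = ket2 dh al (rho be T \ob a) k.
Proof.
move=> hT aa; apply: (bop_app (_ : rho (rtri dh al be) T \ob ket2 dh al a =
  ket2 dh al (rho be T \ob a))).
apply: (nondegenerate_eq (comp_ndl dh_al)) => d dd z /=.
rewrite -!(ket12 dh_al) //; last exact: act_be_al hH T hT a aa.
rewrite (rho_rtri c21 s2 hdh hal (a z) hbe (act_al_be hH)) //.
  exact: smod_centralizes c21 hbe hT.
exact: smod_centralizes c21 m7 hT.
Qed.

(** The adjoint of the formula [rho_ltri], with T replaced by its adjoint. *)
Let bra2_rho T b u : B1 T -> be b ->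
  adj (ket2 ga be b) (rho (ltri ga be dh) T u) = rho dh T (adj (ket2 ga be b) u).
Proof.
move=> hT bb; have cT := smod_centralizes c21 hdh hT.
have cT' := smod_centralizes c21 m11 hT.
apply: inner_ext => h; rewrite -(adj_inner (ket2 _ _ _)).
rewrite inner_adj [in RHS]inner_adj (rho_adj (smod_nd m11)) // (rho_adj (smod_nd hdh)) //.
rewrite (rho_ltri c12 s2 hga hbe h hdh (act_ga_dh hK)) ?adj_inner //; exact: centralizes_adj.
Qed.

(* For c = <eta|_1 V |xi>_2, the pentagon equation makes D b' c b the adjoint of a
   generator, whereas [D_adj] exchanges c with its adjoint. *)
Let D_gen b' xi eta b : be b' -> al xi -> al eta -> be b ->
  D b' (adj (ket1 al be eta) \ob (V \ob ket2 bh al xi)) b =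
  adj (gen (slice2 V b' xi \ob b) eta).
Proof.
move=> bb' axi aeta bb; have [Lam [L1 L2]] := sliced bb'; have [Th [T1 T2]] := L2 xi axi.
(* At z = |a>_1 a' the left-hand side is rho(eta^* a) <b'|_2 X |a'>_2, and on the right rho(eta^* a)
   is applied to a'. It passes from one place to the other since X intertwines the
   representations. *)
have key z : rtri al be al z -> adj (ket2 dh al eta) \ob Lam \ob ket2 dh (rtri al be al) z =
    adj (ket2 ga be b') \ob (X \ob ket2 dh al (adj (ket1 al be eta) \ob z)).
  move=> rz; have mp := bra1_maps c12 hal hbe (smod_sub hal) (act_be_al hH) aeta.
  have sp x x' (dx : dh x) (dx' : dh x') :=
    intertwines_smod c12 m3 hal mp (smod_star hdh dx dx').
  suff e : adj (ket2 dh al eta) \ob Lam =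
      adj (ket2 ga be b') \ob X \ob tensr dh (rtri al be al) al (adj (ket1 al be eta)).
    by apply: bop_ext => k; rewrite e /= (tensr_ket2 dh_m3 dh_al sp) //; exact: mp.
  apply: eq_on_ket21 => a a' k aa aa' /=; have ra := rtri_gen be aa aa'.
  rewrite (tensr_ket2 dh_m3 dh_al sp) //; last exact: mp.
  have hT : B1 (adj eta \ob a) by exact: (smod_star hal).
  rewrite L1 // (ket2_ket2 dh_al) //.
  have -> : adj (ket1 al be eta) \ob (ket1 al be a \ob a') = rho be (adj eta \ob a) \ob a'.
    by apply: bop_ext => w /=; rewrite (ket1_ket1 al_be).
  have iX := intertwines_smod c21 m7 m11 (maps_oimage X_be) hT.
  by rewrite -rho_ket2 // -iX bra2_rho.
rewrite /D /gen !adj_comp !adjK.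
set c := _ \ob (V \ob _).
have hc : cpmu V c by exact: C_gen.
(* This is [key] at z = V |xi>_2 a. Composed with X^* |b>_2 it leaves <eta|_2 X^* [Th] |b>_2, where
   [Th] acts on |b>_2 through the slice <b'|_2 V |xi>_2. *)
have e : adj (ket2 ga be b') \ob X \ob Om c = adj (ket2 dh al eta) \ob adj X \ob Th \ob X.
  apply: (eq_on_ket2 dh_al) => a aa k /=.
  rewrite T2 // X1.1 (tensr_ket2 dh_al dh_al (C_rho hc)) //; last exact: C_al.
  have rz : rtri al be al (V \ob (ket2 bh al xi \ob a)).
    by apply: (maps_oimage V_al); exact: ltri_gen.
  have -> : c \ob a = adj (ket1 al be eta) \ob (V \ob (ket2 bh al xi \ob a)) by exact: bop_ext.
  by have /= -> := bop_app (key _ rz) k.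
by rewrite e; apply: bop_ext => k /=; rewrite X1.2 T1.
Qed.

(** The products T b span <be|_2 V (be <| al) = <be|_2 (be <| be), which contains rho(be^* be) be.
    Here be^* be spans B2 by [full], and rho(B2) be spans be by [rho_be]. *)
Let be_span : be `<=` ospan [set x | exists b' b xi,
  [/\ be b', be b, al xi & x = slice2 V b' xi \ob b]].
Proof.
set Y := [set x | _].
have h1 b' w : be b' -> ltri al be be w -> ospan Y (adj (ket2 al be b') \ob w).
  rewrite -V_be => bb' [y hy <-].
  have -> : adj (ket2 al be b') \ob (V \ob y) = (adj (ket2 al be b') \ob V) \ob y by exact: bop_ext.
  move: y hy; apply: ospan_compl; first exact: ospan_osub.
  move=> _ [_ [xi axi <-] [b bb ->]]; apply: sub_ospan; exists b', b, xi; split=> //.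
  exact: bop_ext.
have h2 T b : B2 T -> be b -> ospan Y (rho al T \ob b).
  move=> hT bb; have {hT} := full hT; move: T.
  have [M M0 bM] := op_le_exists b.
  apply: (@ospan_map_in _ _ _ _ _ B2 _ (ospan Y) (fun T => rho al T \ob b) id M) => //.
  - exact: ospan_osub.
  - move=> a S T hS hT; rewrite -bcompZDl; congr (_ \ob _).
    have cS := smod_centralizes c12 hal hS; have cT := smod_centralizes c12 hal hT.
    have cST := smod_centralizes c12 hal (csubZD s2 a hS hT).
    apply: (rho_unique (smod_nd hal) cST) => x ax z.
    by rewrite !bopDE !bopZE !(rhoE (smod_nd hal)) // bop_linear.
  - move=> e T hT eT; rewrite mulrC; apply: op_le_comp bM.
    by apply: (rho_bound (smod_nd hal)) => //; exact: smod_centralizes c12 hal hT.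
  - by move=> _ [_ [x bx <-] [y be_y ->]]; exact: (smod_star hbe).
  move=> _ [_ [x bx <-] [y be_y ->]].
  have -> : rho al (adj x \ob y) \ob b = adj (ket2 al be x) \ob (ket2 al be y \ob b).
    by apply: bop_ext => z /=; rewrite (ket2_ket2 al_be).
  by apply: h1 => //; exact: ltri_gen.
move=> b bb; have := rho_be bb; apply: ospan_min; first exact: ospan_osub.
by move=> _ [_ [T hT <-] [b' bb' ->]]; exact: h2.
Qed.

Let oadj_A_sub : osub (oadj A).
Proof. by rewrite /A /ahat oadj_ospan; exact: ospan_osub. Qed.

Let D_oadj b' c b : be b' -> cpmu V c -> be b -> oadj A (D b' c b).
Proof.
move=> bb' + bb; move: c.
have [M M0 bM] := op_le_exists (adj (ket2 ga be b') \ob X).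
have [N N0 bN] := op_le_exists (adj X \ob ket2 ga be b).
have E c : D b' c b = (adj (ket2 ga be b') \ob X) \ob Om c \ob (adj X \ob ket2 ga be b).
  exact: bop_ext.
apply: (@ospan_map_in _ _ _ _ _ (cpmu V) _ (oadj A) (fun c => D b' c b) id (M * N)) => //.
- exact: ospan_osub.
- exact: mulr_ge0.
- move=> a S T hS hT; have hST := csubZD (ospan_osub _) a hS hT.
  rewrite !E -bcompZDl -bcompZDr; congr (_ \ob _ \ob _).
  apply: (eq_on_ket1 dh_al) => x dx k.
  rewrite bopDE bopZE !(tensrE dh_al dh_al) // ?bopDE ?bopZE ?bop_linear //; exact: C_rho.
- move=> e c hc ec; rewrite E mulrAC; apply: op_le_comp => //; apply: op_le_comp => //.
  exact: (tensr_bound dh_al dh_al (C_rho hc)).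
- exact: sub_ospan.
move=> _ [_ [_ [eta aeta <-] <-] [_ [_ [xi axi <-] <-] ->]].
rewrite D_gen //; exists (gen (slice2 V b' xi \ob b) eta) => //.
by apply: gen_in => //; exact: slice_be.
Qed.

Let gen_oadj b a : be b -> al a -> oadj A (gen b a).
Proof.
move=> bb aa; have := be_span bb; move: b {bb}.
have [M M0 bM] := op_le_exists (X \ob ket2 dh al a).
(* b |-> <b|_2 is antilinear, hence the conjugation. *)
apply: (@ospan_map_in _ _ _ _ _ be _ (oadj A) (fun b => gen b a) Num.conj M) => //.
- exact: (smod_sub hbe).
- exact: rmorph1.
- move=> t S T hS hT; rewrite /gen (ket2ZD ga_be) ?adjZD ?bcompZDl //.
  exact: (csubZD (smod_sub hbe)).
- move=> e T hT eT; rewrite mulrC; apply: op_le_comp => //; apply: op_le_adj.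
  exact: (ket2_bound ga_be).
- by move=> _ [b' [b [xi [bb' bb axi ->]]]]; exact: slice_be.
move=> _ [b' [b [xi [bb' bb axi ->]]]].
rewrite -[gen _ _]adjK -D_gen // D_adj.
  by apply: D_oadj => //; rewrite C_star; apply: imageP; exact: C_gen.
exact: C_gen.
Qed.

Lemma sliced_star : oadj A = A.
Proof.
have h : A `<=` oadj A by apply: A_ind => //; exact: gen_oadj.
apply/seteqP; split=> // T [S AS <-]; have [S' AS' <-] := h S AS.
by rewrite adjK.
Qed.

Let ket2_rho b T k : be b -> B2 T -> ket2 ga be b (rho ga T k) = ket2 ga be (b \ob T) k.
Proof.
move=> bb hT; have cT := smod_centralizes c12 hga hT.
apply: (bop_app (_ : ket2 ga be b \ob rho ga T = ket2 ga be (b \ob T))).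
apply: (nondegenerate_eq (comp_ndl ga_be)) => x gx z.
by rewrite /= (rhoE (smod_nd hga)) // -!(ket12 ga_be) //; exact: be_right.
Qed.

Let ket2_rho' a T k : al a -> B1 T -> ket2 dh al a (rho dh T k) = ket2 dh al (a \ob T) k.
Proof.
move=> aa hT; have cT := smod_centralizes c21 hdh hT.
apply: (bop_app (_ : ket2 dh al a \ob rho dh T = ket2 dh al (a \ob T))).
apply: (nondegenerate_eq (comp_ndl dh_al)) => x gx z.
by rewrite /= (rhoE (smod_nd hdh)) // -!(ket12 dh_al) //; exact: al_right.
Qed.

(** The action is absorbed by the bra: rho T <b|_2 is the bra of b T^*, which lies in be again. *)
Lemma sliced_rho_ga : oprod (rho ga @` B2) A `<=` A.
Proof.
move=> _ [_ [T hT <-] [S AS ->]]; have cT := smod_centralizes c12 hga hT.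
move: S AS; apply: ospan_compl => // _ [_ [_ [b bb <-] <-] [_ [_ [a aa <-] <-] ->]].
suff -> : rho ga T \ob (adj (ket2 ga be b) \ob (X \ob ket2 dh al a)) = gen (b \ob adj T) a.
  by apply: gen_in => //; apply: be_right => //; exact: star2.
rewrite /gen; have -> : ket2 ga be (b \ob adj T) = ket2 ga be b \ob rho ga (adj T).
  by apply: bop_ext => k /=; rewrite ket2_rho //; exact: star2.
by rewrite adj_comp -(rho_adj (smod_nd hga)) // adjK; exact: bop_ext.
Qed.

(** This action is absorbed naturally on the other side, by |a>_2 rho T = |a T>_2. Self-adjointness
    of the algebra turns the right multiplication into a left one. *)
Lemma sliced_rho_dh : oprod (rho dh @` B1) A `<=` A.
Proof.
move=> _ [_ [T hT <-] [S AS ->]]; have cT := smod_centralizes c21 hdh hT.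
rewrite -sliced_star; exists (adj S \ob adj (rho dh T)); last by rewrite adj_comp !adjK.
have : A (adj S) by rewrite -sliced_star; exists S.
rewrite (rho_adj (smod_nd hdh)) //; move: (adj S) => U.
apply: ospan_compr => // _ [_ [_ [b bb <-] <-] [_ [_ [a aa <-] <-] ->]].
have -> : adj (ket2 ga be b) \ob (X \ob ket2 dh al a) \ob rho dh (adj T) =
    gen b (a \ob adj T).
  apply: bop_ext => k /=; rewrite ket2_rho' //; exact: star1.
by apply: gen_in => //; apply: al_right => //; exact: star1.
Qed.

Lemma sliced_algebra : [/\ cstar_algebra (ahat X),
  oprod (rho ga @` B2) (ahat X) `<=` ahat X & oprod (rho dh @` B1) (ahat X) `<=` ahat X].
Proof.
split; [split; [exact: ospanK|exact: sliced_prod|exact: sliced_star]| |].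
  exact: sliced_rho_ga.
exact: sliced_rho_dh.
Qed.

End SlicedAlgebra.

(** * C*-modules as instances of the weaker notions *)

Section CstarModules.
Context {R : realType}.
Implicit Types (b : cstar_base R) (H : hilbertType R).

Lemma cstar_module_smod b H (a : set 'L(bspace b, H)) :
  cstar_module b a -> smod (balg b) a.
Proof.
move=> [h1 h2 _ h4]; split=> // [|x y ax ay].
  by rewrite -h1; exact: ospan_osub.
by rewrite -h4; apply: sub_ospan; exists (adj x); [exists x|exists y].
Qed.

Lemma cstar_module_right b H (a : set 'L(bspace b, H)) x T :
  cstar_module b a -> a x -> balg b T -> a (x \ob T).
Proof.
by move=> [_ _ h _] ax bT; rewrite -h; apply: sub_ospan; exists x => //; exists T.
Qed.

Lemma rho_dag_acts b b' H (a : set 'L(bspace b, H)) (a' : set 'L(bspace b', H)) T x :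
  ospan (oprod (rho_dag b a) a') = a' -> bdag b T -> a' x -> a' (rho a T \ob x).
Proof.
move=> h bT ax; rewrite -[X in X _]h; apply: sub_ospan; exists (rho a T); first by exists T.
by exists x.
Qed.

Lemma balg_osub b : osub (balg b).
Proof. by have [<- _ _] := balg_cstar b; exact: ospan_osub. Qed.

Lemma balg_adj b T : balg b T -> balg b (adj T).
Proof. by have [_ _ {2}<-] := balg_cstar b => bT; exists T. Qed.

Lemma balg_commuting b : commuting (balg b) (bdag b).
Proof. by move=> S T hS hT z; exact: (bop_app (base_commute hS hT)). Qed.

Lemma cstar_module2C b b' H (a : set 'L(bspace b, H)) (a' : set 'L(bspace b', H)) :
  cstar_module2 b b' a a' -> cstar_module2 b' b a' a.
Proof. by case. Qed.

Lemma cstar_module2_duo b H (ga dh : set 'L(bspace b, H)) :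
  cstar_module2 b (dag_base b) ga dh -> duo (balg b) (bdag b) ga dh.
Proof.
move=> [hg hd h1 h2]; split; [exact: cstar_module_smod hg|exact: (cstar_module_smod hd)| |].
- by move=> T hT x hx; exact: rho_dag_acts h1 hT hx.
- by move=> T hT x hx; exact: rho_dag_acts h2 hT hx.
Qed.

Lemma cstar_module3_tri b H (bh al be : set 'L(bspace b, H)) :
  cstar_module3 (dag_base b) b (dag_base b) bh al be -> tri (balg b) (bdag b) bh al be.
Proof.
move=> [[h1 h2 e1 e2] [_ h3 e3 e4] [_ _ e5 e6]].
split; [exact: (cstar_module_smod h1)|exact: (cstar_module_smod h2)|
  exact: (cstar_module_smod h3)|..].
- by move=> T hT x hx; exact: rho_dag_acts e1 hT hx.
- by move=> T hT x hx; exact: rho_dag_acts e3 hT hx.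
- by move=> T hT x hx; exact: rho_dag_acts e2 hT hx.
- by move=> T hT x hx; exact: rho_dag_acts e5 hT hx.
- by move=> T hT x hx; exact: rho_dag_acts e4 hT hx.
- by move=> T hT x hx; exact: rho_dag_acts e6 hT hx.
Qed.

Lemma pmu_representation b H (bh al be : set 'L(bspace b, H))
    (V : 'L(rtensor bh al, rtensor al be)) : is_pmu V -> is_representation V V.
Proof.
by case=> -[/cstar_module2C ? _ _] uV e1 e2 e3 _ p; split.
Qed.

Lemma oimage_inv H K L (S : 'L(H, K)) (T : 'L(K, H)) (E : set 'L(L, H)) (F : set 'L(L, K)) :
  maps_to S E F -> maps_to T F E -> (forall y, S (T y) = y) -> oimage S E = F.
Proof.
move=> hS hT h; apply/seteqP; split=> [_ [x Ex <-]|y Fy]; first exact: hS.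
by exists (T \ob y); [exact: hT|apply: bop_ext => z /=; rewrite h].
Qed.
End CstarModules.

(** * The algebras and relations of the opposite unitary *)

Section Opposite.
Context {R : realType} {KK H : hilbertType R} (bh al be : set 'L(KK, H)).
Variable (V : 'L(rtensor bh al, rtensor al be)).
Hypotheses (bh_al : compatible bh al) (al_be : compatible al be) (uV : unitary V).
Let al_bh := compatibleC bh_al.
Let be_al := compatibleC al_be.
Let V1 := (unitaryP V).1 uV.

Lemma oppu_adj : adj (oppu V) = flip al be \ob V \ob flip al bh.
Proof. by rewrite /oppu !adj_comp adjK !flip_adj //; exact: bop_ext. Qed.

Lemma oppu_unitary : unitary (oppu V).
Proof.
by apply/unitaryP; split=> u; rewrite oppu_adj /oppu /= !flipK ?V1.2 ?V1.1 ?flipK.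
Qed.

Lemma bra2_oppu_ket2 c a : bh c -> al a ->
  adj (ket2 al bh c) \ob (oppu V \ob ket2 be al a) =
  adj (adj (ket1 al be a) \ob (V \ob ket1 bh al c)).
Proof.
move=> bc aa; have e : flip al bh \ob ket2 al bh c = ket1 bh al c.
  by apply: bop_ext => h /=; rewrite flip_ket2.
rewrite -e !adj_comp adjK (flip_adj al_bh); apply: bop_ext => h /=.
by rewrite flip_ket2.
Qed.

Lemma bra1_oppu_ket2 a xi : al a -> al xi ->
  adj (ket1 al bh a) \ob (oppu V \ob ket2 be al xi) =
  adj (adj (ket1 al be xi) \ob (V \ob ket2 bh al a)).
Proof.
move=> bc aa; have e : flip al bh \ob ket1 al bh a = ket2 bh al a.
  by apply: bop_ext => h /=; rewrite flip_ket1.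
rewrite -e !adj_comp adjK (flip_adj al_bh); apply: bop_ext => h /=.
by rewrite flip_ket2.
Qed.

Lemma ahat_oppu : ahat (oppu V) = oadj (apmu V).
Proof.
rewrite /ahat /apmu oadj_ospan; congr (ospan _); apply/seteqP; split.
  move=> _ [_ [_ [c bc <-] <-] [_ [_ [a aa <-] <-] ->]]; rewrite bra2_oppu_ket2 //.
  apply: imageP; exists (adj (ket1 al be a)); first by exists (ket1 al be a) => //; exists a.
  by exists (V \ob ket1 bh al c) => //; exists (ket1 bh al c) => //; exists c.
move=> _ [_ [_ [_ [a aa <-] <-] [_ [_ [c bc <-] <-] ->]] <-]; rewrite -bra2_oppu_ket2 //.
exists (adj (ket2 al bh c)); first by exists (ket2 al bh c) => //; exists c.
by exists (oppu V \ob ket2 be al a) => //; exists (ket2 be al a) => //; exists a.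
Qed.

Lemma cpmu_oppu : cpmu (oppu V) = oadj (cpmu V).
Proof.
rewrite /cpmu oadj_ospan; congr (ospan _); apply/seteqP; split.
  move=> _ [_ [_ [c bc <-] <-] [_ [_ [a aa <-] <-] ->]]; rewrite bra1_oppu_ket2 //.
  apply: imageP; exists (adj (ket1 al be a)); first by exists (ket1 al be a) => //; exists a.
  by exists (V \ob ket2 bh al c) => //; exists (ket2 bh al c) => //; exists c.
move=> _ [_ [_ [_ [a aa <-] <-] [_ [_ [c bc <-] <-] ->]] <-]; rewrite -bra1_oppu_ket2 //.
exists (adj (ket1 al bh c)); first by exists (ket1 al bh c) => //; exists c.
by exists (oppu V \ob ket2 be al a) => //; exists (ket2 be al a) => //; exists a.
Qed.

Lemma maps_comp (H1 H2 H3 : hilbertType R) (S : 'L(H1, H2)) (T : 'L(H2, H3)) E F G :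
  maps_to T F G -> maps_to S E F -> @maps_to R KK H1 H3 (T \ob S) E G.
Proof.
move=> hT hS x Ex; have -> : T \ob S \ob x = T \ob (S \ob x) by exact: bop_ext.
exact/hT/hS.
Qed.

Lemma oppu_oimage (E : set 'L(KK, rtensor bh al)) (E' : set 'L(KK, rtensor be al))
    (F : set 'L(KK, rtensor al be)) (F' : set 'L(KK, rtensor al bh)) :
  maps_to (flip be al) E' F -> maps_to (flip al be) F E' ->
  maps_to (flip bh al) E F' -> maps_to (flip al bh) F' E ->
  oimage V E = F -> oimage (oppu V) E' = F'.
Proof.
move=> h1 h2 h3 h4 hV; apply: (oimage_inv (T := adj (oppu V))).
- apply: maps_comp h1; apply: maps_comp h3 _; exact: adj_maps_oimage uV hV.
- rewrite oppu_adj; apply: maps_comp h4; apply: maps_comp h2 _; exact: maps_oimage hV.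
by move=> y; rewrite ((unitaryP _).1 oppu_unitary).2.
Qed.

End Opposite.

(** * The C*-algebras of representations and of V *)

(** Stated for a sliced pentagon, so that it covers the opposite of V as well as the representations
    of V. *)
Lemma ahat_cstar_algebra (R : realType) (b : cstar_base R) (H K : hilbertType R)
    (bh al be : set 'L(bspace b, H)) (ga dh : set 'L(bspace b, K))
    (V : 'L(rtensor bh al, rtensor al be)) (X : 'L(rtensor dh al, rtensor ga be)) :
  cstar_module3 (dag_base b) b (dag_base b) bh al be ->
  cstar_module2 b (dag_base b) ga dh ->
  unitary V -> oimage V (ltri bh al al) = rtri al be al ->
  oimage V (ltri bh al be) = ltri al be be ->
  unitary X -> oimage X (rtri dh al be) = ltri ga be dh ->
  sliced_pentagon V X -> cpmu V = oadj (cpmu V) ->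
  cstar_algebra2 b (dag_base b) ga dh (ahat X).
Proof.
move=> mV mX uV Val Vbe uX Xbe sl hC.
have [_ _ [ma mb eb _]] := mV; have [_ _ _ full] := mb.
have [||||||hA h1 h2] := sliced_algebra (@balg_commuting _ b) (@balg_osub _ b)
  (@balg_osub _ (dag_base b)) (cstar_module3_tri mV) (cstar_module2_duo mX)
  uX uV Val Vbe Xbe sl _ _ _ _ _ _ hC; last by split.
- by move=> a T aa hT; exact: cstar_module_right ma aa hT.
- by move=> a T aa hT; exact: (cstar_module_right mb aa hT).
- exact: (@balg_adj _ b).
- exact: (@balg_adj _ (dag_base b)).
- by rewrite full.
- by rewrite -[X in X `<=` _]eb.
Qed.

Theorem proposition5p5 (R : realType) (b : cstar_base R) (H : hilbertType R)
    (bh al be : set 'L(bspace b, H)) (V : 'L(rtensor bh al, rtensor al be))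
    (hV : is_pmu V) (hC : cpmu V = oadj (cpmu V)) :
  (forall (K : hilbertType R) (ga dh : set 'L(bspace b, K))
      (X : 'L(rtensor dh al, rtensor ga be)),
    is_representation V X ->
    cstar_algebra2 b (dag_base b) ga dh (ahat X)) /\
  (cstar_algebra2 b (dag_base b) al bh (ahat V) /\
   cstar_algebra2 (dag_base b) b be al (apmu V)).
Proof.
have [mV uV Val Vbhbe Vbhbh Vbe pent] := hV.
have tV := cstar_module3_tri mV.
have cb := @balg_commuting _ b.
have s1 := @balg_osub _ b; have s2 := @balg_osub _ (dag_base b).
have rep K (ga dh : set 'L(bspace b, K)) (X : 'L(rtensor dh al, rtensor ga be)) :
    is_representation V X -> cstar_algebra2 b (dag_base b) ga dh (ahat X).
  move=> [mX uX Xga Xbe Xbh pX].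
  apply: (ahat_cstar_algebra mV mX uV Val Vbe uX Xbe _ hC).
  by apply: (sliced_of_pentagon cb s1 s2 tV (cstar_module2_duo mX) uX) => //;
    apply: maps_oimage.
split=> //; split; first exact/rep/pmu_representation.
have [m1 m2 m3] := mV.
(* In the opposite unitary bh and be change places, and it is regarded as a representation of itself
   on (al, be). *)
have mW : cstar_module3 (dag_base b) b (dag_base b) be al bh.
  by split; exact: cstar_module2C.
have mK : cstar_module2 b (dag_base b) al be by [].
have bh_al := smod_compatible (commutingC cb) (tri_bh tV) (tri_al tV).
have al_be := smod_compatible cb (tri_al tV) (tri_be tV).
have al_bh := compatibleC bh_al; have be_al := compatibleC al_be.
have uW := oppu_unitary bh_al al_be uV.
have sW := sliced_op cb s1 s2 tV uV Val Vbe Vbhbh Vbhbe pent.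
have hCW : cpmu (oppu V) = oadj (cpmu (oppu V)).
  by rewrite cpmu_oppu // -hC.
have [mA cA a1 a2] : cstar_algebra2 b (dag_base b) al be (ahat (oppu V)).
  apply: (ahat_cstar_algebra mW mK uW _ _ uW _ sW hCW).
  - by apply: (oppu_oimage bh_al al_be uV _ _ _ _ Val);
      [exact: flip_ltri|exact: flip_rtri|exact: flip_ltri|exact: flip_rtri].
  - by apply: (oppu_oimage bh_al al_be uV _ _ _ _ Vbhbh);
      [exact: flip_ltri|exact: flip_rtri|exact: flip_rtri|exact: flip_ltri].
  - by apply: (oppu_oimage bh_al al_be uV _ _ _ _ Vbhbe);
      [exact: flip_rtri|exact: flip_ltri|exact: flip_rtri|exact: flip_ltri].
(* The slices of the opposite form the adjoint of A_V. They have just been shown to be a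
   self-adjoint algebra, so they form A_V itself. *)
have <- : ahat (oppu V) = apmu V.
  have [_ _ <-] := cA; rewrite ahat_oppu //; apply/seteqP; split.
    by move=> _ [_ [T hT <-] <-]; rewrite adjK.
  by move=> T hT; exists (adj T); [exists T|exact: adjK].
by split=> //; exact: cstar_module2C.
Qed.
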